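(* Let $k$ be a field, $R=k[x_1,\dots,x_d]$ a standard graded polynomial ring, and $I=(\alpha_1,\dots,\alpha_m)\subset R$ a perfect ideal of height $2$ with $m>d$ such that, with respect to $\alpha_1,\dots,\alpha_m$, $I$ has a Hilbert–Burch matrix $\varphi=[v_1|\cdots|v_{m-1}]$ with $v_i\in(R_1)^m$ for $1\le i\le m-2$ and $v_{m-1}\in(R_n)^m$ for some $n\ge1$. Assume $I$ satisfies $G_d$. Then, inside the fraction field of the domain $A$, the set $\mathcal D=\dfrac{\overline g\,\overline K^{(n)}}{\overline{x_d}^{\,n}}$ is an ideal of $A$ and $\mathcal D=\overline{\mathcal A}$. In particular $\overline{\mathcal A}\cong\overline K^{(n)}$ as $A$-modules.
   Context: $G_d$: $\mu(I_P)\le\operatorname{ht}P$ for all primes $P\supseteq I$ with $\operatorname{ht}P<d$. $S=R[T_1,\dots,T_m]$; $\mathcal A$ is the kernel of the $R$-algebra map $S\to R[It]$, $T_j\mapsto\alpha_jt$. Write $[T_1\cdots T_m]\cdot\varphi=[L_1\cdots L_{m-2}\ g]$. Let $B(\varphi')$ be the $d\times(m-2)$ matrix of linear forms in $k[T_1,\dots,T_m]$ with $[x_1\cdots x_d]\cdot B(\varphi')=[L_1\cdots L_{m-2}]$. Let $J=(L_1,\dots,L_{m-2})+I_d(B(\varphi'))$, $A=S/J$ (a domain), bars denote images in $A$; $B$ is $B(\varphi')$ with its last row deleted, and $K=(L_1,\dots,L_{m-2})+I_{d-1}(B)+(x_d)$. $\overline K^{(n)}$ is the $n$-th symbolic power of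 $\overline K$ (intersection of the primary components of $\overline K^n$ at minimal primes of $\overline K$). *)

(* Defs.v *)
From HB Require Import structures.
From mathcomp Require Import all_boot all_order all_algebra.
From mathcomp Require Import mpoly.
Set Implicit Arguments. Unset Strict Implicit. Unset Printing Implicit Defensive.
Import Order.TTheory GRing.Theory.
Local Open Scope ring_scope.

Section Ideals.
Variable R : comNzRingType.

Definition ideal_gen (G : R -> Prop) : R -> Prop :=
  fun x => exists (N : nat) (g c : 'I_N -> R),
    (forall i, G (g i)) /\ x = \sum_(i < N) c i * g i.

Definition ideal_of (N : nat) (g : 'I_N -> R) : R -> Prop :=
  ideal_gen (fun x => exists i, x = g i).

Definition ideal_add (I J : R -> Prop) : R -> Prop :=
  ideal_gen (fun x => I x \/ J x).

Definition ideal_pow (I : R -> Prop) (n : nat) : R -> Prop :=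
  ideal_gen (fun x => exists f : 'I_n -> R,
                 (forall i, I (f i)) /\ x = \prod_(i < n) f i).

Definition is_ideal (I : R -> Prop) : Prop :=
  [/\ I 0, (forall x y, I x -> I y -> I (x + y)) & (forall r x, I x -> I (r * x))].

Definition subI (I J : R -> Prop) : Prop := forall x, I x -> J x.

Definition prime_ideal (P : R -> Prop) : Prop :=
  [/\ is_ideal P, ~ P 1 & forall a b, P (a * b) -> P a \/ P b].

Definition minimal_prime (K P : R -> Prop) : Prop :=
  [/\ prime_ideal P, subI K P &
      forall Q, prime_ideal Q -> subI K Q -> subI Q P -> subI P Q].

Definition height_ge (P : R -> Prop) (h : nat) : Prop :=
  exists Q : nat -> (R -> Prop),
    [/\ forall i, (i <= h)%N -> prime_ideal (Q i),
        forall i, (i < h)%N -> subI (Q i) (Q i.+1) /\ exists x, Q i.+1 x /\ ~ Q i x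
      & subI (Q h) P /\ subI P (Q h)].

(* mu(I_P) <= h : I R_P is generated by h elements over R_P *)
Definition mu_loc_le (I P : R -> Prop) (h : nat) : Prop :=
  exists b : 'I_h -> R, (forall i, I (b i)) /\
    forall a, I a -> exists u, ~ P u /\ ideal_of b (u * a).

Definition G_cond (I : R -> Prop) (d : nat) : Prop :=
  forall P, prime_ideal P -> subI I P -> ~ height_ge P d ->
    exists h, height_ge P h /\ mu_loc_le I P h.

Definition ideal_height_eq (I : R -> Prop) (h : nat) : Prop :=
  (forall P, prime_ideal P -> subI I P -> height_ge P h) /\
  (exists P, prime_ideal P /\ subI I P /\ ~ height_ge P h.+1).

Definition regseq_in (I : R -> Prop) (g : nat) : Prop :=
  exists y : 'I_g -> R, (forall i, I (y i)) /\
    (~ ideal_of y 1) /\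
    forall (i : 'I_g) (z : R),
      ideal_gen (fun x => exists j : 'I_g, (j < i)%N /\ x = y j) (y i * z) ->
      ideal_gen (fun x => exists j : 'I_g, (j < i)%N /\ x = y j) z.

(* a finite free resolution of length p of R/I :
   0 -> F_(p+1) = 0 -> F_p -> ... -> F_1 -> F_0 = R -> R/I -> 0,
   F_j = R^(r j) for j >= 1 (row vectors, maps act by u |-> u *m M);
   M0 : F_1 -> F_0 = R^1 and Ms i : F_(i+2) -> F_(i+1). *)
Definition free_res (I : R -> Prop) (p : nat) : Prop :=
  exists (r : nat -> nat) (M0 : 'M[R]_(r 1%N, 1))
         (Ms : forall i, 'M[R]_(r i.+2, r i.+1)),
    [/\ r p.+1 = 0%N,
        (forall x : R, I x <-> exists u : 'rV[R]_(r 1%N), x = (u *m M0) ord0 ord0),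
        (0 < p)%N -> forall u : 'rV[R]_(r 1%N),
          u *m M0 = 0 <-> exists w, u = w *m Ms 0%N
      & forall i, (i.+2 <= p)%N -> forall u : 'rV[R]_(r i.+2),
          u *m Ms i = 0 <-> exists w, u = w *m Ms i.+1].

(* grade I = pd_R (R/I) *)
Definition perfect_ideal (I : R -> Prop) : Prop :=
  exists p, [/\ free_res I p, (forall q, (q < p)%N -> ~ free_res I q),
               regseq_in I p & ~ regseq_in I p.+1].

Definition hilbert_burch (m N : nat) (alpha : 'I_m -> R) (phi : 'M[R]_(m, N)) :=
  (forall u : 'cV[R]_m, \sum_i alpha i * u i ord0 = 0 <-> exists w, u = phi *m w) /\
  (forall w : 'cV[R]_N, phi *m w = 0 -> w = 0).

Definition minors_ideal (a b t : nat) (M : 'M[R]_(a, b)) : R -> Prop :=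
  ideal_gen (fun x => exists (f : 'I_t -> 'I_a) (g : 'I_t -> 'I_b),
                 x = \det (\matrix_(i, j) M (f i) (g j))).

(* lifted symbolic power: for J <= S and A = S/J, a lift f in S of an
   element of A lies in (Kbar)^(n), where Kbar is the image of K in A.
   Minimal primes of Kbar in A = images of the minimal primes of K + J in S. *)
Definition symb_pow_lift (J K : R -> Prop) (n : nat) (f : R) : Prop :=
  forall P, minimal_prime (ideal_add K J) P ->
    exists s, ~ P s /\ ideal_add (ideal_pow (ideal_add K J) n) J (s * f).

End Ideals.

(* homogeneous of degree e (the zero polynomial counts for every e) *)
Definition homog_deg (k : ringType) (n : nat) (e : nat) (p : {mpoly k[n]}) : Prop :=
  forall mo, mo \in msupp p -> mdeg mo = e.

(* Main.v *)
(* Off the ideal (x), the elements (L, g) and (L, x_d^n) are regular sequences, and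
   every prime containing (L, x_d) has dimension at most d + 1. Both facts follow
   from dimension counts: a prime q of R has dimension at most d - h and phi has
   rank at least m - h modulo q, by G_d; and in a polynomial ring a prime of
   dimension at most N - h contains, after localization, a regular sequence of
   length h, so that depth sensitivity of Koszul cohomology makes ideals generated
   by shorter regular sequences unmixed. Dimension is the growth of the spaces of
   polynomials of bounded degree modulo the prime.

   The powers of (x) are then removed by a degree argument: if y is a sequence of
   x-homogeneous elements, regular off (x), then the torsion H^0_x(S/(y)) is
   computed by the top local cohomology H^d_x(S), which lives in degrees at most
   -d. Hence an element of x-degree at least n that lies in (L, x_d^n), or in
   (L, g), off (x) lies in it. If f is in the symbolic power, then g f lies in
   (L, x_d^n) off (x) by unmixedness, so g f = x_d^n a; if a is in the kernel of
   the Rees map, then x_d^n a lies in (L, g) off (x), so x_d^n a = g f, and f lies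
   in (L, x_d^n) off (x). This suffices because no minimal prime of K contains
   (x). *)
Require Import Defs.
From HB Require Import structures.
From mathcomp Require Import all_boot all_order all_algebra.
From mathcomp Require Import mpoly.
From mathcomp Require Import boolp.
From mathcomp Require classical_sets.
From mathcomp Require Import perm ring zify.
Set Implicit Arguments. Unset Strict Implicit. Unset Printing Implicit Defensive.
Import Order.TTheory GRing.Theory.
Local Open Scope ring_scope.

(** * Koszul cohomology *)

(** Restricting to the complement of (x) is forced: G_d says nothing about primes of height d or
    more, so no dimension bound is available over (x). Off (x) the ideal J may be replaced by (L),
    because Cramer's rule for [x] B = [L] gives x_i J in (L); in the same way x_i (K + J) lies in
    (L, x_d). So all computations take place modulo regular sequences.

    The dimension count is tight. S has dimension d + m, and (L, x_d^n) and (L, g) have m - 1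
    generators, so unmixedness yields primes of dimension at least d + 1. This equals the bound over
    (L, x_d), which makes such a prime minimal over K, and it exceeds by one the bound over (L, g)
    and a nonzero element of R.

    Localizations are not formed: what holds at a prime, or off x_i, is stated up to a factor
    outside the prime, or up to a power of x_i. Membership in the fractional set D becomes the
    congruence g f = x_d^n a modulo J between lifts to S. *)

Section Koszul.
Variable C : comNzRingType.
Implicit Types (U : C -> Prop) (ws ys : seq C) (c e : seq bool -> C).

(* The Koszul differential. A cochain is a function on bit strings, the letters
   [true] marking the factors of a wedge; its degree is the number of these. *)
Fixpoint kd ws c (k : seq bool) : C :=
  match ws, k with
  | w :: ws', false :: k' => kd ws' (fun l => c (false :: l)) k'
  | w :: ws', true :: k' =>
      w * c (false :: k') - kd ws' (fun l => c (true :: l)) k'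
  | _, _ => 0
  end.

Lemma kdD ws c e k : kd ws (fun l => c l + e l) k = kd ws c k + kd ws e k.
Proof.
elim: ws c e k => [|w ws IH] c e [|[] k] /=; rewrite ?addr0 //.
by rewrite (IH (fun l => c (true :: l))); ring.
Qed.

Lemma kdZ ws r c k : kd ws (fun l => r * c l) k = r * kd ws c k.
Proof.
elim: ws c k => [|w ws IH] c [|[] k] /=; rewrite ?mulr0 //.
by rewrite (IH (fun l => c (true :: l))); ring.
Qed.

Lemma kdN ws c k : kd ws (fun l => - c l) k = - kd ws c k.
Proof.
rewrite -mulN1r -kdZ; congr (kd ws _ k).
by apply: funext => l; rewrite mulN1r.
Qed.

Lemma kdB ws c e k : kd ws (fun l => c l - e l) k = kd ws c k - kd ws e k.
Proof. by rewrite kdD kdN. Qed.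

(** Indexes the basis of the i-th exterior power of a free module of rank n. *)
Definition key n i (k : seq bool) := (size k == n) && (count id k == i).

(** Cochains are total functions; this allows resetting their values off the keys, for instance to
    0. *)
Lemma eq_kd ws i c e :
  (forall k, key (size ws) i k -> c k = e k) ->
  forall k, key (size ws) i.+1 k -> kd ws c k = kd ws e k.
Proof.
elim: ws i c e => [|w ws IH] i c e ce [|[] k] //= /andP[/= /eqP[sk] /eqP ck].
  congr (_ * _ - _); first by apply: ce; rewrite /key /= sk eqxx; lia.
  case: i ce ck => [|i] ce ck.
    have {ck} k0 : count id k = 0%N by lia.
    have kd0 c' l : count id l = 0%N -> kd ws c' l = 0.
      by elim: (ws) c' l => [|w' ws' IH'] c' [|[] l] //= l0; rewrite IH'.
    by rewrite !kd0.
  apply: (IH i) => [l kl|]; last by rewrite /key sk eqxx; lia.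
  by apply: ce; rewrite /key /=; move: kl; rewrite /key; lia.
apply: (IH i) => [l kl|]; last by rewrite /key sk eqxx; lia.
by apply: ce; rewrite /key /=; move: kl; rewrite /key; lia.
Qed.

Lemma kd_count0 ws c k : count id k = 0%N -> kd ws c k = 0.
Proof. by elim: ws c k => [|w ws IH] c [|[] k] //= k0; rewrite IH. Qed.

Lemma kdK ws c k : size k = size ws -> kd ws (kd ws c) k = 0.
Proof.
elim: ws c k => [|w ws IH] c [|[] k] //= [sk].
  rewrite kdB kdZ IH //; ring.
exact: IH.
Qed.

(** There are finitely many strings of length n, so exponents and degree bounds found key by key can
    be made uniform. *)
Lemma uniform_bound n (P : seq bool -> nat -> Prop) :
  (forall k a b, (a <= b)%N -> P k a -> P k b) ->
  (forall k, size k = n -> exists a, P k a) ->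
  exists a, forall k, size k = n -> P k a.
Proof.
elim: n P => [|n IH] P mono ex.
  by have [a Pa] := ex [::] erefl; exists a => -[].
have [|k sk|a Pa] := IH (fun k => P (true :: k)); first by move=> k; apply: mono.
  by apply: ex; rewrite /= sk.
have [|k sk|b Pb] := IH (fun k => P (false :: k)); first by move=> k; apply: mono.
  by apply: ex; rewrite /= sk.
exists (maxn a b) => -[|[] k] //= [sk].
  by apply: mono (Pa _ sk); rewrite leq_maxl.
by apply: mono (Pb _ sk); rewrite leq_maxr.
Qed.

End Koszul.

Section IdealFacts.
Variable C : comNzRingType.
Implicit Types (U P : C -> Prop).

Lemma ideal0 U : is_ideal U -> U 0. Proof. by case. Qed.
Lemma idealD U x y : is_ideal U -> U x -> U y -> U (x + y).
Proof. by case=> _ h _; apply: h. Qed.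
Lemma idealMl U r x : is_ideal U -> U x -> U (r * x).
Proof. by case=> _ _ h; apply: h. Qed.
Lemma idealMr U r x : is_ideal U -> U x -> U (x * r).
Proof. by rewrite mulrC; apply: idealMl. Qed.
Lemma idealN U x : is_ideal U -> U x -> U (- x).
Proof. by move=> iU Ux; rewrite -mulN1r; apply: idealMl. Qed.
Lemma idealB U x y : is_ideal U -> U x -> U y -> U (x - y).
Proof. by move=> iU Ux Uy; apply: idealD => //; apply: idealN. Qed.
Lemma ideal_sum U (I : Type) (r : seq I) (Q : pred I) F :
  is_ideal U -> (forall i, Q i -> U (F i)) -> U (\sum_(i <- r | Q i) F i).
Proof.
by move=> iU h; elim/big_rec: _ => [|i x Qi Ux]; [apply: ideal0 | apply: idealD; auto].
Qed.

Lemma prime_is_ideal P : prime_ideal P -> is_ideal P. Proof. by case. Qed.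

Lemma primeM P a b : prime_ideal P -> ~ P a -> ~ P b -> ~ P (a * b).
Proof. by case=> _ _ h na nb /h []. Qed.

Lemma primeX P a n : prime_ideal P -> ~ P a -> ~ P (a ^+ n).
Proof.
move=> pP na; elim: n => [|n IH]; first by rewrite expr0; case: pP.
by rewrite exprS; apply: primeM.
Qed.

Lemma is_ideal_gen (G : C -> Prop) : is_ideal (ideal_gen G).
Proof.
split.
- by exists 0%N, (fun=> 0), (fun=> 0); split; [case | rewrite big_ord0].
- move=> _ _ [N [g [c [Gg ->]]]] [N' [g' [c' [Gg' ->]]]].
  exists (N + N')%N, (fun i => match split i with inl j => g j | inr j => g' j end),
    (fun i => match split i with inl j => c j | inr j => c' j end).
  split=> [i|]; first by case: split.
  rewrite big_split_ord /=; congr (_ + _); apply: eq_bigr => i _.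
    by case: splitP => j /= ij; [rewrite (val_inj ij) | have := ltn_ord i; lia].
  by case: splitP => j /= ij; [have := ltn_ord j; lia | rewrite (_ : i = j) //; apply: val_inj => /=; lia].
- move=> r _ [N [g [c [Gg ->]]]]; exists N, g, (fun i => r * c i); split=> //.
  by rewrite mulr_sumr; apply: eq_bigr => i _; rewrite mulrA.
Qed.

Lemma gen_in (G : C -> Prop) x : G x -> ideal_gen G x.
Proof.
by move=> Gx; exists 1%N, (fun=> x), (fun=> 1); rewrite big_ord1 mul1r.
Qed.

Lemma gen_sub (G U : C -> Prop) :
  is_ideal U -> (forall x, G x -> U x) -> forall x, ideal_gen G x -> U x.
Proof.
move=> iU GU _ [N [g [c [Gg ->]]]]; apply: ideal_sum => // i _.
by apply: idealMl => //; apply: GU.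
Qed.

(** The ideal U + (y) with the coefficient of y explicit, so that relations modulo a sequence can be
    unwound one generator at a time. *)
Definition adjoin U y : C -> Prop := fun z => exists b, U (z - y * b).

Lemma is_ideal_adjoin U y : is_ideal U -> is_ideal (adjoin U y).
Proof.
move=> iU; split.
- by exists 0; rewrite mulr0 subr0; apply: ideal0.
- move=> a b [a' Ua] [b' Ub]; exists (a' + b').
  by rewrite (_ : _ - _ = (a - y * a') + (b - y * b')); [apply: idealD | ring].
- move=> r a [a' Ua]; exists (r * a').
  by rewrite (_ : _ - _ = r * (a - y * a')); [apply: idealMl | ring].
Qed.

Lemma adjoin_sub U y z : U z -> adjoin U y z.
Proof. by exists 0; rewrite mulr0 subr0. Qed.

Lemma adjoin_mem U y : is_ideal U -> adjoin U y y.
Proof. by exists 1; rewrite mulr1 subrr; apply: ideal0. Qed.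

Definition zero_ideal : C -> Prop := fun z => z = 0.

Lemma is_ideal0 : is_ideal zero_ideal.
Proof.
split=> // [x y -> ->|r x ->]; rewrite /zero_ideal; ring.
Qed.

Definition idl (ys : seq C) := foldl adjoin zero_ideal ys.

Lemma idl_rcons ys y : idl (rcons ys y) = adjoin (idl ys) y.
Proof. by rewrite /idl -cats1 foldl_cat. Qed.

Lemma is_ideal_idl ys : is_ideal (idl ys).
Proof.
elim/last_ind: ys => [|ys y IH]; first exact: is_ideal0.
by rewrite idl_rcons; apply: is_ideal_adjoin.
Qed.

Lemma idl_mem ys y : y \in ys -> idl ys y.
Proof.
elim/last_ind: ys => // ys x IH; rewrite mem_rcons inE idl_rcons => /orP[/eqP->|/IH].
  exact/adjoin_mem/is_ideal_idl.
exact: adjoin_sub.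
Qed.

Lemma idl_sub ys U : is_ideal U -> (forall y, y \in ys -> U y) -> forall z, idl ys z -> U z.
Proof.
move=> iU; elim/last_ind: ys => [_ z ->|ys y IH h z]; first exact: ideal0.
rewrite idl_rcons => -[b Ub].
rewrite -(subrK (y * b) z); apply: idealD => //.
  by apply: IH Ub => x xy; apply: h; rewrite mem_rcons inE xy orbT.
by apply: idealMr => //; apply: h; rewrite mem_rcons mem_head.
Qed.

End IdealFacts.

(** * Vanishing up to torsion and depth sensitivity *)

Section KoszulVanishing.
Variable C : comNzRingType.
Implicit Types (U : C -> Prop) (ws ys : seq C) (c e : seq bool -> C).

Lemma kd_ideal U ws i c : is_ideal U ->
  (forall k, key (size ws) i k -> U (c k)) ->
  forall k, key (size ws) i.+1 k -> U (kd ws c k).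
Proof.
move=> iU Uc k kk.
pose c' l := if key (size ws) i l then c l else 0.
rewrite (@eq_kd _ ws i c c') // => [|l kl]; last by rewrite /c' kl.
have {Uc} Uc l : U (c' l).
  by rewrite /c'; case: ifP => [/Uc //|_]; apply: ideal0.
elim: (ws) (c') (k) Uc {kk} => [|w vs IH] f l Uf; first exact: ideal0.
case: l => [|[] l] /=; first exact: ideal0.
  by apply: idealB => //; [apply: idealMl | apply: IH].
exact: IH.
Qed.

(* [H^i(ws; C/U)] is [s]-power torsion. *)
Definition koszul_vanish (s : C) U ws i := forall c,
  (forall k, key (size ws) i.+1 k -> U (kd ws c k)) ->
  exists M e, forall k, key (size ws) i k -> U (s ^+ M * c k - kd ws e k).

(** Equivalently, y is a nonzerodivisor on the localization of C/U at the powers of s. *)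
Definition nzd_upto (s : C) U y := forall z, U (y * z) -> exists M, U (s ^+ M * z).

Lemma ideal_expM U s M M' z : is_ideal U -> (M <= M')%N ->
  U (s ^+ M * z) -> U (s ^+ M' * z).
Proof.
by move=> iU /subnK <- h; rewrite exprD -mulrA; apply: idealMl.
Qed.

Lemma uniform_exp U s n i c : is_ideal U ->
  (forall k, key n i k -> exists M, U (s ^+ M * c k)) ->
  exists M, forall k, key n i k -> U (s ^+ M * c k).
Proof.
move=> iU h.
have [k a b ab Pa kk|k sk|M PM] :=
    @uniform_bound n (fun k M => key n i k -> U (s ^+ M * c k)).
- by apply: ideal_expM ab _ => //; apply: Pa.
- have [kk|] := boolP (key n i k); last by exists 0%N.
  by have [M] := h k kk; exists M.
- by exists M => k kk; apply: PM => //; case/andP: kk => /eqP.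
Qed.

(** Long exact sequence of multiplication by y on C/U: H^i modulo y sits between H^i and H^(i+1) of
    C/U. *)
Lemma koszul_vanish_adjoin s U ws y i : is_ideal U -> nzd_upto s U y ->
  koszul_vanish s U ws i -> koszul_vanish s U ws i.+1 ->
  koszul_vanish s (adjoin U y) ws i.
Proof.
move=> iU ny Vi Vi1 c cyc.
(* [b] represents the connecting class of [c] in degree i + 1. *)
have /choice[b Ub] k : exists b, key (size ws) i.+1 k -> U (kd ws c k - y * b).
  have [kk|] := boolP (key (size ws) i.+1 k); last by exists 0.
  by have [b] := cyc k kk; exists b.
have yb k : key (size ws) i.+2 k -> U (y * kd ws b k).
  move=> kk; have := kd_ideal iU Ub kk; rewrite kdB kdZ kdK ?sub0r.
    by move/(idealN iU); rewrite opprK.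
  by case/andP: kk => /eqP.
have [|M UM] := @uniform_exp U s (size ws) i.+2 (kd ws b) iU.
  by move=> k /yb /ny.
have [k kk|M1 [b' Ub']] := Vi1 (fun l => s ^+ M * b l).
  by rewrite kdZ; apply: UM.
(* Since [b'] bounds a multiple of [b], subtracting y b' turns a multiple of [c] into a cocycle
   modulo U itself. *)
have [k kk|M2 [e Ue]] := Vi (fun l => s ^+ (M1 + M) * c l - y * b' l).
  rewrite kdB !kdZ.
  rewrite (_ : _ - _ = s ^+ (M1 + M) * (kd ws c k - y * b k)
    + y * (s ^+ M1 * (s ^+ M * b k) - kd ws b' k)); last by rewrite exprD; ring.
  by apply: idealD => //; apply: idealMl => //; [apply: Ub | apply: Ub'].
exists (M2 + (M1 + M))%N, e => k kk; exists (s ^+ M2 * b' k).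
rewrite (_ : _ - _ - _ = s ^+ M2 * (s ^+ (M1 + M) * c k - y * b' k) - kd ws e k).
  exact: Ue.
by rewrite exprD; ring.
Qed.

Fixpoint regular_upto s U ys : Prop :=
  if ys is y :: ys' then nzd_upto s U y /\ regular_upto s (adjoin U y) ys' else True.

Lemma regular_upto_rcons s U ys y : regular_upto s U (rcons ys y) <->
  regular_upto s U ys /\ nzd_upto s (foldl (@adjoin C) U ys) y.
Proof.
elim: ys U => [|x ys IH] U /=; first by split=> [[h _]|[_ h]]; split.
by rewrite IH; split=> [[? []]|[[]]].
Qed.

Lemma nzd_upto_mul s t U y : is_ideal U -> nzd_upto s U y -> nzd_upto (s * t) U y.
Proof.
move=> iU h z /h [M UM]; exists M; rewrite exprMn -mulrA mulrCA.
exact: idealMl.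
Qed.

Lemma regular_upto_mul s t U ys :
  is_ideal U -> regular_upto s U ys -> regular_upto (s * t) U ys.
Proof.
elim: ys U => //= y ys IH U iU [h r]; split; first exact: nzd_upto_mul.
by apply: IH => //; apply: is_ideal_adjoin.
Qed.

Lemma koszul_vanish_mul s t U ws i :
  is_ideal U -> koszul_vanish s U ws i -> koszul_vanish (s * t) U ws i.
Proof.
move=> iU h c /h [M [e Ue]]; exists M, (fun l => t ^+ M * e l) => k kk.
rewrite kdZ exprMn (_ : _ - _ = t ^+ M * (s ^+ M * c k - kd ws e k)); last by ring.
by apply: idealMl => //; apply: Ue.
Qed.

(** Each adjunction uses up one cohomological degree, hence the range of i. *)
Lemma koszul_vanish_foldl s U ws ys : is_ideal U -> regular_upto s U ys ->
  (forall i, (i <= size ys)%N -> koszul_vanish s U ws i) ->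
  koszul_vanish s (foldl (@adjoin C) U ys) ws 0.
Proof.
elim: ys U => [|y ys IH] U iU /= => [_ h|[ny r] h]; first exact: h.
apply: IH => // [|i iy]; first exact: is_ideal_adjoin.
by apply: koszul_vanish_adjoin => //; apply: h; lia.
Qed.

(** In degree 0 only the value at the all-[false] key matters, so an element is fed to the complex
    as a constant cochain. *)
Lemma kd_count1 ws z k : key (size ws) 1 k ->
  exists2 w, w \in ws & kd ws (fun=> z) k = w * z.
Proof.
elim: ws k => [|w ws IH] [|[] k] //=; rewrite /key /= => /andP[/eqP[sk] /eqP ck].
  exists w; rewrite ?mem_head // kd_count0 ?subr0 //; lia.
have [|v vw ->] := IH k; first by apply/andP; split; apply/eqP => //; lia.
by exists v; rewrite // inE vw orbT.
Qed.

Lemma koszul_vanish0 s U ws z : is_ideal U -> koszul_vanish s U ws 0 ->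
  (forall w, w \in ws -> U (w * z)) -> exists M, U (s ^+ M * z).
Proof.
move=> iU V wz; have [k kk|M [e Ue]] := V (fun=> z).
  by have [w /wz ? ->] := kd_count1 z kk.
exists M; have := Ue (nseq (size ws) false).
rewrite kd_count0 ?subr0; last by rewrite count_nseq.
by apply; rewrite /key size_nseq count_nseq eqxx.
Qed.

Lemma koszul_vanish0_pow s U ws z : is_ideal U -> koszul_vanish s U ws 0 ->
  (forall w, w \in ws -> exists n, U (w ^+ n * z)) -> exists M, U (s ^+ M * z).
Proof.
move=> iU V wz.
(* [vs'] holds the elements that already kill z, [vs] those of which a power does. *)
suff H vs vs' : ws = vs' ++ vs -> forall z, (forall w, w \in vs -> exists n, U (w ^+ n * z)) ->
    (forall w, w \in vs' -> U (w * z)) -> exists M, U (s ^+ M * z).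
  exact: (H ws [::]).
elim: vs vs' => [|v vs IH] vs' E {wz}z wz wz'.
  by apply: (koszul_vanish0 iU V); rewrite E cats0.
have [n Un] := wz v (mem_head _ _).
elim: n z wz wz' Un => [|n IHn] z wz wz' Un.
  by exists 0%N; rewrite expr0 mul1r in Un *.
have [|||M UM] := IHn (v * z).
- move=> w /wz [a Ua]; exists a; rewrite mulrCA; exact: idealMl.
- by move=> w /wz' Uw; rewrite mulrCA; apply: idealMl.
- by rewrite mulrA -exprSr.
have [|||M' UM'] := IH (rcons vs' v) _ (s ^+ M * z).
- by rewrite cat_rcons.
- move=> w wv; have [|a Ua] := wz w; first by rewrite inE wv orbT.
  by exists a; rewrite mulrCA; apply: idealMl.
- move=> w; rewrite mem_rcons inE => /orP[/eqP->|/wz' Uw]; first by rewrite mulrCA.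
  by rewrite mulrCA; apply: idealMl.
by exists (M' + M)%N; rewrite exprD -mulrA.
Qed.

(* Grade sensitivity: a regular sequence longer than [ys] leaves no torsion mod [ys]. *)
Lemma grade_torsion s ys ws z : regular_upto s (@zero_ideal C) ys ->
  (forall i, (i <= size ys)%N -> koszul_vanish s (@zero_ideal C) ws i) ->
  (forall w, w \in ws -> exists n, idl ys (w ^+ n * z)) ->
  exists M, idl ys (s ^+ M * z).
Proof.
move=> r V; apply: koszul_vanish0_pow; first exact: is_ideal_idl.
by apply: koszul_vanish_foldl => //; apply: is_ideal0.
Qed.

End KoszulVanishing.

(** * Growth of quotients *)

Lemma leq_exp2 m n e : (m <= n)%N -> (m ^ e <= n ^ e)%N.
Proof. by case: e => // e mn; rewrite leq_exp2r. Qed.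

Section Growth.
Variables (k : fieldType) (C : comNzRingType) (i : {rmorphism k -> C}).
Implicit Types (Q : C -> Prop) (W : nat -> C -> Prop).

Definition indep Q (I : finType) (v : I -> C) :=
  forall c : I -> k, Q (\sum_j i (c j) * v j) -> forall j, c j = 0.

Record filtration W : Prop := Filtration {
  filtr0 : forall s, W s 0;
  filtrD : forall s x y, W s x -> W s y -> W s (x + y);
  filtrZ : forall s a x, W s x -> W s (i a * x);
  filtrM : forall s t x y, W s x -> W t y -> W (s + t)%N (x * y);
  filtr1 : W 0 1;
  filtr_le : forall s t x, (s <= t)%N -> W s x -> W t x;
  filtr_ex : forall x, exists s, W s x }.

Lemma filtr_sum W s (I : Type) (r : seq I) (P : pred I) F : filtration W ->
  (forall j, P j -> W s (F j)) -> W s (\sum_(j <- r | P j) F j).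
Proof.
move=> fW h; elim/big_rec: _ => [|j x Pj Wx]; first exact: filtr0.
by apply: filtrD; auto.
Qed.

Lemma filtrX W s x n : filtration W -> W s x -> W (s * n)%N (x ^+ n).
Proof.
move=> fW Wx; elim: n => [|n IH]; first by rewrite muln0; apply: filtr1.
by rewrite exprS mulnS; apply: filtrM.
Qed.

Lemma indep_sub Q Q' (I : finType) (v : I -> C) :
  subI Q Q' -> indep Q' v -> indep Q v.
Proof. by move=> QQ h c /QQ /h. Qed.

Lemma indep_mul Q (I : finType) (v : I -> C) a : prime_ideal Q -> ~ Q a ->
  indep Q v -> indep Q (fun j => a * v j).
Proof.
move=> [_ _ pQ] na h c Qc; apply: h; have [| |//] := pQ a (\sum_j i (c j) * v j).
  by rewrite mulr_sumr; under eq_bigr do rewrite mulrCA.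
by move/na.
Qed.

(** An independent family of maximal size in W spans the image of W. *)
Lemma indep_span Q (W : C -> Prop) n : is_ideal Q ->
  (forall (I : finType) (v : I -> C), (forall j, W (v j)) -> indep Q v -> (#|I| <= n)%N) ->
  exists n' (v : 'I_n' -> C), (n' <= n)%N /\
    forall x, W x -> exists c : 'I_n' -> k, Q (x - \sum_j i (c j) * v j).
Proof.
move=> iQ bnd.
pose P n' := `[< exists v : 'I_n' -> C, (forall j, W (v j)) /\ indep Q v >].
have Pbnd n' : P n' -> (n' <= n)%N.
  by move=> /asboolP[v [Wv iv]]; rewrite -[n'](card_ord); apply: bnd iv.
have exP : exists n', P n'.
  by exists 0%N; apply/asboolP; exists (fun=> 0); split=> [[]//|c _ []].
case: (ex_maxnP exP Pbnd) => n' /asboolP[v [Wv iv]] maxn'.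
exists n', v; split; first by apply/Pbnd/asboolP; exists v.
move=> x Wx; apply: contrapT => nx.
suff /maxn' : P n'.+1 by rewrite ltnn.
apply/asboolP; exists (fun j => if unlift ord0 j is Some l then v l else x).
split=> [j|c]; first by case: unliftP.
rewrite big_ord_recl unlift_none.
under eq_bigr do rewrite liftK.
have [c0|c0] := eqVneq (c ord0) 0.
  rewrite c0 rmorph0 mul0r add0r => /iv h j.
  by case: (unliftP ord0 j) => [l|] ->; [apply: h | rewrite c0].
move=> Qc; case: nx; exists (fun l => - (c ord0)^-1 * c (lift ord0 l)).
have -> : x - \sum_j i (- (c ord0)^-1 * c (lift ord0 j)) * v j =
   i (c ord0)^-1 * (i (c ord0) * x + \sum_j i (c (lift ord0 j)) * v j).
  rewrite mulrDr mulrA -rmorphM mulVf // rmorph1 mul1r mulr_sumr -sumrN; congr (_ + _).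
  by apply: eq_bigr => l _; rewrite rmorphM rmorphN; ring.
exact: idealMl.
Qed.

(** Coordinates in a spanning family give a matrix with more rows than columns; a vector of its left
    kernel is the relation. *)
Lemma dependent_coords Q (W : C -> Prop) n : is_ideal Q ->
  (forall (I : finType) (v : I -> C), (forall j, W (v j)) -> indep Q v -> (#|I| <= n)%N) ->
  forall (J K : finType) (x : J -> K -> C), (forall j l, W (x j l)) ->
  (n * #|K| < #|J|)%N ->
  exists a : J -> k, (exists j, a j != 0) /\ forall l, Q (\sum_j i (a j) * x j l).
Proof.
move=> iQ bnd J K x Wx ltJ.
have [n' [v [le_n' span]]] := indep_span iQ bnd.
have /choice[c Qc] : forall p : J * K, exists c : 'I_n' -> k,
  Q (x p.1 p.2 - \sum_j i (c j) * v j) by move=> p; apply: span.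
pose M := \matrix_(r < #|J|, s < #|{: K * 'I_n'}|)
  c (enum_val r, (enum_val s).1) (enum_val s).2.
have : kermx M != 0.
  rewrite -mxrank_eq0 mxrank_ker subn_eq0 -ltnNge.
  apply: leq_ltn_trans (rank_leq_col _) _.
  rewrite card_prod card_ord; apply: leq_ltn_trans ltJ.
  by rewrite mulnC leq_mul2r le_n' orbT.
have := mulmx_ker M; move: (kermx M) => N NM /matrix0Pn[r [s nz]].
exists (fun j => N r (enum_rank j)); split.
  by exists (enum_val s); rewrite enum_valK.
move=> l.
have -> : \sum_j i (N r (enum_rank j)) * x j l =
   \sum_j i (N r (enum_rank j)) *
     (x j l - \sum_h i (c (j, l) h) * v h).
  rewrite [RHS](eq_bigr (fun j => i (N r (enum_rank j)) * x j l -
     \sum_h i (N r (enum_rank j) * c (j, l) h) * v h)); last first.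
    move=> j _; rewrite mulrBr mulr_sumr; congr (_ - _).
    by apply: eq_bigr => h _; rewrite rmorphM mulrA.
  rewrite sumrB exchange_big /= [X in _ - X]big1 ?subr0 // => h _.
  rewrite -mulr_suml -rmorph_sum /=.
  have := congr1 (fun A : 'M_(_, _) => A r (enum_rank (l, h))) NM.
  rewrite mxE [in RHS]mxE (reindex (@enum_rank J)) /=; last first.
    by exists enum_val => j _; rewrite ?enum_rankK ?enum_valK.
  under eq_bigr do rewrite [M _ _]mxE !enum_rankK /=.
  by move=> ->; rewrite rmorph0 mul0r.
by apply: ideal_sum => // j _; apply: idealMl => //; apply: (Qc (j, l)).
Qed.

(* Dimension of [C/Q], measured by the growth of the images of the [W s]. *)
Definition growth_le W Q a := exists c, forall s (I : finType) (v : I -> C),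
  (forall j, W s (v j)) -> indep Q v -> (#|I| <= c * s.+1 ^ a)%N.

(** Asked only at the levels c (t + 1), where boxes of (t + 1)^e monomials provide it directly. *)
Definition growth_ge W Q e := exists c, forall t, exists (I : finType) (v : I -> C),
  [/\ #|I| = (t.+1 ^ e)%N, forall j, W (c * t.+1)%N (v j) & indep Q v].

Lemma growth_ge_le W Q e a : growth_ge W Q e -> growth_le W Q a -> (e <= a)%N.
Proof.
move=> [b lb] [c ub]; rewrite leqNgt; apply/negP => lt_ae.
(* With this t the upper bound at level b (t + 1) is at most t (t + 1)^a, which is less than (t +
   1)^e. *)
pose t := (c * b.+1 ^ a)%N.
have [I [v [cI Wv iv]]] := lb t.
have := ub _ _ _ Wv iv; rewrite cI leqNgt => /negP; apply.
apply: (@leq_ltn_trans (c * (b.+1 * t.+1) ^ a)%N).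
  by rewrite leq_mul2l leq_exp2 ?orbT //; nia.
rewrite expnMn mulnA -/t -(subnK lt_ae) expnD expnS mulnA.
have : (0 < t.+1 ^ a)%N by rewrite expn_gt0.
have : (0 < t.+1 ^ (e - a.+1))%N by rewrite expn_gt0.
by nia.
Qed.

Lemma growth_le_mono W Q a b : (a <= b)%N -> growth_le W Q a -> growth_le W Q b.
Proof.
move=> ab [c h]; exists c => s I v Wv iv; apply: leq_trans (h s I v Wv iv) _.
by rewrite leq_mul2l leq_pexp2l ?orbT.
Qed.

Lemma growth_le_sub W Q Q' a : subI Q Q' -> growth_le W Q a -> growth_le W Q' a.
Proof.
by move=> QQ [c h]; exists c => s I v Wv iv; apply: h => //; apply: indep_sub iv.
Qed.

Section Strict.
Variables (W : nat -> C -> Prop) (Q Q' : C -> Prop) (F : C).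
Hypotheses (fW : filtration W) (pQ : prime_ideal Q) (iQ' : is_ideal Q').
Hypotheses (QQ' : subI Q Q') (Q'F : Q' F) (nQF : ~ Q F).

(** A relation modulo Q reduces modulo Q' to its terms free of F; once these vanish, F cancels
    because Q is prime. *)
Lemma indep_powers (I : finType) (v : I -> C) n : indep Q' v ->
  indep Q (fun p : I * 'I_n => F ^+ p.2 * v p.1).
Proof.
move=> iv c.
rewrite (eq_bigr (fun p => i (c (p.1, p.2)) * (F ^+ p.2 * v p.1))); last by case.
rewrite -(pair_bigA _ (fun l (j : 'I_n) => i (c (l, j)) * (F ^+ j * v l))) /=.
rewrite exchange_big /=.
pose u (j : 'I_n) := \sum_l i (c (l, j)) * v l.
rewrite (eq_bigr (fun j : 'I_n => F ^+ j * u j)); last first.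
  by move=> j _; rewrite mulr_sumr; apply: eq_bigr => l _; rewrite mulrCA.
suff H N (w : 'I_N -> C) : (forall j, Q' (w j) -> w j = 0) ->
   Q (\sum_(j < N) F ^+ j * w j) -> forall j, w j = 0.
  move=> Qu [l j]; apply: (iv (fun l => c (l, j))).
  rewrite -/(u j) (H _ u) //; first exact: ideal0.
  move=> {}j Q'u; rewrite /u big1 // => l' _.
  by rewrite (iv (fun l => c (l, j))) ?rmorph0 ?mul0r.
elim: N w => [|N IH] w hw; first by move=> _ [].
rewrite big_ord_recl expr0 mul1r.
rewrite (eq_bigr (fun j : 'I_N => F * (F ^+ j * w (lift ord0 j)))); last first.
  by move=> j _; rewrite mulrA -exprS.
rewrite -mulr_sumr => Qs.
have w0 : w ord0 = 0.
  apply: hw; rewrite -(addrK (F * \sum_(j < N) F ^+ j * w (lift ord0 j)) (w ord0)).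
  by apply: idealB => //; [apply: QQ' | apply: idealMr].
move: Qs; rewrite w0 add0r => Qs.
have {}Qs : Q (\sum_(j < N) F ^+ j * w (lift ord0 j)).
  by case: pQ => _ _ /(_ _ _ Qs) [].
move=> j; case: (unliftP ord0 j) => [l|] -> //.
by apply: (IH (fun l => w (lift ord0 l))) => // l' /hw.
Qed.

(** Multiplying by s + 1 powers of F makes a family s + 1 times larger, at a level still linear in
    s. *)
Lemma growth_le_strict a : growth_le W Q a.+1 -> growth_le W Q' a.
Proof.
move=> [c h]; have [f Wf] := filtr_ex fW F.
exists (c * f.+1 ^ a.+1)%N => s I v Wv iv.
have : (#|{: I * 'I_s.+1}| <= c * (f * s + s).+1 ^ a.+1)%N.
  apply: h (indep_powers (n := s.+1) iv) => -[l j] /=; apply: filtrM => //.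
  by apply: (filtr_le fW) (filtrX j fW Wf); rewrite leq_mul2l -ltnS ltn_ord orbT.
rewrite card_prod card_ord => le1; rewrite -(leq_pmul2r (ltn0Sn s)); apply: leq_trans le1 _.
rewrite -!mulnA leq_mul2l -expnSr -expnMn leq_exp2 ?orbT //; nia.
Qed.

(** Otherwise any number of powers of F would be independent modulo Q. *)
Lemma growth_le0_strict : growth_le W Q 0 -> Q' 1.
Proof.
move=> [c h]; apply: contrapT => nQ1; have [f Wf] := filtr_ex fW F.
have iv : indep Q' (fun _ : 'I_1 => 1).
  move=> b; rewrite big_ord1 => Qb j; rewrite (ord1 j).
  have [//|b0] := eqVneq (b ord0) 0; case: nQ1.
  by rewrite -(rmorph1 i) -(mulVf b0) rmorphM -[i (b _)]mulr1; apply: idealMl.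
have : (#|{: 'I_1 * 'I_c.+1}| <= c * (f * c).+1 ^ 0)%N; last first.
  by rewrite card_prod !card_ord mul1n expn0 muln1 ltnn.
apply: h (indep_powers (n := c.+1) iv) => -[l j] /=; rewrite mulr1.
by apply: (filtr_le fW) (filtrX j fW Wf); rewrite leq_mul2l -ltnS ltn_ord orbT.
Qed.

End Strict.

Lemma growth_le_height W Q D h : filtration W ->
  (forall P, is_ideal P -> growth_le W P D) ->
  prime_ideal Q -> height_ge Q h -> (h <= D)%N /\ growth_le W Q (D - h).
Proof.
move=> fW ub pQ [P [pP chain [PQ _]]].
suff : (h <= D)%N /\ growth_le W (P h) (D - h).
  by case=> hD /(growth_le_sub PQ).
have : forall j, (j <= h)%N -> (j <= D)%N /\ growth_le W (P j) (D - j).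
  elim=> [_|j IH lt_jh]; first by rewrite subn0; split=> //; apply/ub/prime_is_ideal/pP.
  have [le_jD gj] := IH (ltnW lt_jh).
  have [sub [F [PF nPF]]] := chain j lt_jh.
  have iP := prime_is_ideal (pP _ lt_jh).
  have pj := pP _ (ltnW lt_jh).
  have lt_jD : (j < D)%N.
    rewrite ltn_neqAle le_jD andbT; apply/eqP => jD; move: gj.
    rewrite jD subnn -jD => /(growth_le0_strict fW pj iP sub PF nPF).
    by case: (pP _ lt_jh).
  split=> //; apply: (growth_le_strict fW pj iP sub PF nPF).
  by rewrite -subSn // subSS.
by apply.
Qed.

End Growth.

Section PolyFiltration.
Variables (k : fieldType) (C : comNzRingType) (i : {rmorphism k -> C}).
Variables (W : nat -> C -> Prop) (m : nat).
Hypothesis fW : filtration i W.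

Definition mpoly_scalar : {rmorphism k -> {mpoly C[m]}} := @mpolyC m C \o i.

Definition mpoly_filtr s (F : {mpoly C[m]}) :=
  (forall nu, W s F@_nu) /\ (forall nu, (s < mdeg nu)%N -> F@_nu = 0).

Lemma mpoly_filtr_bound (F : {mpoly C[m]}) : exists s, forall nu, W s F@_nu.
Proof.
have /choice[b Wb] nu : exists b, W b F@_nu by apply: filtr_ex fW _.
exists (\max_(nu <- msupp F) b nu) => nu.
have [nuF|/memN_msupp_eq0->] := boolP (nu \in msupp F); last exact: (filtr0 fW).
by apply: (filtr_le fW) (Wb nu); rewrite leq_bigmax_seq.
Qed.

Lemma mpoly_filtration : filtration mpoly_scalar mpoly_filtr.
Proof.
split.
- by move=> s; split=> nu; rewrite mcoeff0 //; apply: (filtr0 fW).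
- move=> s F G [WF dF] [WG dG]; split=> nu; rewrite mcoeffD; first exact: (filtrD fW).
  by move=> nus; rewrite dF // dG // addr0.
- move=> s a F [WF dF]; split=> nu; rewrite mcoeffCM; first exact: (filtrZ fW).
  by move=> nus; rewrite dF // mulr0.
- move=> s t F G [WF dF] [WG dG]; split=> nu; rewrite mcoeffM.
    by apply: (filtr_sum _ fW) => p _; apply: (filtrM fW).
  move=> nus; rewrite big1 // => p /eqP E.
  have [lt|le] := ltnP s (mdeg p.1); first by rewrite dF ?mul0r.
  rewrite (dG p.2) ?mulr0 // -(ltn_add2l s); have := congr1 (@mdeg m) E.
  by rewrite mdegD => H; rewrite (leq_trans nus) // (leq_trans (eq_leq H)) ?leq_add2r.
- split=> nu; rewrite mcoeff1.
    by case: eqP => _; [apply: (filtr1 fW) | apply: (filtr0 fW)].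
  by rewrite -mdeg_eq0; case: eqP => // ->.
- move=> s t F st [WF dF]; split=> nu; first exact: (filtr_le fW) (WF nu).
  by move=> nut; apply: dF; apply: leq_ltn_trans nut.
- move=> F; have [b Wb] := mpoly_filtr_bound F; exists (maxn b (msize F)); split=> nu.
    by apply: (filtr_le fW) (Wb nu); apply: leq_maxl.
  by move=> nub; apply: memN_msupp_eq0; apply: msize_mdeg_ge; lia.
Qed.

Lemma mpoly_filtr_const s c : W s c -> mpoly_filtr s c%:MP.
Proof.
move=> Wc; split=> nu; rewrite mcoeffC.
  by case: eqP => _; rewrite ?mulr1 ?mulr0 //; apply: (filtr0 fW).
by rewrite -mdeg_eq0; case: eqP => [->|_ _] //; rewrite mulr0.
Qed.

Section LinearRelations.
Variables (Q : {mpoly C[m]} -> Prop) (r rho : nat) (psi : 'M[C]_(m, r)).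
Variables (f : 'I_rho -> 'I_m) (g : 'I_rho -> 'I_r).
Hypothesis pQ : prime_ideal Q.
Hypothesis inj_f : injective f.
Hypothesis Qpsi : forall j, Q (\sum_l 'X_l * (psi l j)%:MP).
Let Delta : C := \det (\matrix_(a, b) psi (f a) (g b)).
Hypothesis nQ : ~ Q Delta%:MP.

Let iQ : is_ideal Q := prime_is_ideal pQ.

Let off t (F : {mpoly C[m]}) := forall nu, F@_nu != 0 ->
  (mdeg nu <= t)%N /\ forall a, nu (f a) = 0%N.

Lemma off_sum t (I : Type) (s : seq I) (P : pred I) F :
  (forall j, P j -> off t (F j)) -> off t (\sum_(j <- s | P j) F j).
Proof.
move=> h; elim/big_rec: _ => [|j G Pj oG] nu; first by rewrite mcoeff0 eqxx.
rewrite mcoeffD; have [->|nz _] := eqVneq ((F j)@_nu) 0; last exact: (h j Pj nu nz).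
by rewrite add0r; apply: (oG nu).
Qed.

Lemma off_mul t u F G : off t F -> off u G -> off (t + u)%N (F * G).
Proof.
move=> oF oG nu; rewrite mcoeffM => nz.
have [p1 [p2 [-> nz2]]] : exists p1 p2 : 'X_{1..m}, nu = (p1 + p2)%MM /\ F@_p1 * G@_p2 != 0.
  apply: contrapT => np; move: nz; rewrite big1 ?eqxx // => p /eqP E.
  by apply: contrapT => nz; apply: np; exists p.1, p.2; split=> //; apply/eqP.
have /oF[dF zF] : F@_p1 != 0 by apply: contraNneq nz2 => ->; rewrite mul0r.
have /oG[dG zG] : G@_p2 != 0 by apply: contraNneq nz2 => ->; rewrite mulr0.
by rewrite mdegD leq_add //; split=> // a; rewrite mnmDE zF zG.
Qed.

Lemma off_const t c : off t c%:MP.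
Proof.
move=> nu; rewrite mcoeffC; have [->|_] := eqVneq nu 0%MM; last by rewrite mulr0 eqxx.
by move=> _; rewrite mdeg0; split=> // a; rewrite mnm0E.
Qed.

Lemma off_var l : l \notin codom f -> off 1 'X_l.
Proof.
move=> lf nu; rewrite mcoeffX; have [<- _|_] := eqVneq U_(l)%MM nu; last by rewrite eqxx.
rewrite mdeg1; split=> // a; rewrite mnm1E; case: eqP => // E.
by rewrite E codom_f in lf.
Qed.

(** Cramer's rule: the relations combined by the adjugate express Delta times an eliminated variable
    through the others. *)
Lemma eliminate_var l : exists F, off 1 F /\ Q (Delta%:MP * 'X_l - F).
Proof.
have [/codomP[a ->]|lf] := boolP (l \in codom f); last first.
  exists (Delta%:MP * 'X_l); rewrite subrr; split; last exact: ideal0.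
  by apply: (@off_mul 0 1); [apply: off_const | apply: off_var].
pose A := \matrix_(a, b) psi (f a) (g b).
exists (- \sum_(l | l \notin codom f) (\sum_y psi l (g y) * \adj A y a)%:MP * 'X_l).
split.
  rewrite -sumrN; apply: off_sum => l' lf; rewrite -mulNr -mpolyCN.
  by apply: (@off_mul 0 1); [apply: off_const | apply: off_var].
have -> : Delta%:MP * 'X_(f a) -
   - (\sum_(l | l \notin codom f) (\sum_y psi l (g y) * \adj A y a)%:MP * 'X_l)
   = \sum_y (\adj A y a)%:MP * \sum_l 'X_l * (psi l (g y))%:MP; last first.
  by apply: ideal_sum => // y _; apply: idealMl.
under [RHS]eq_bigr do rewrite mulr_sumr.
rewrite exchange_big [RHS](bigID (mem (codom f))) /= opprK; congr (_ + _).
  have uf : uniq (codom f) by apply/injectiveP.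
  rewrite -(big_uniq _ uf) /= /codom /image_mem big_map big_enum /=.
  rewrite (eq_bigr (fun x => ((A *m \adj A) x a)%:MP * 'X_(f x))); last first.
    move=> x _; rewrite mxE raddf_sum mulr_suml; apply: eq_bigr => y _.
    by rewrite [A _ _]mxE /= mpolyCM; ring.
  rewrite mul_mx_adj (bigD1 a) //= big1 ?addr0; first by rewrite mxE eqxx.
  by move=> x /negPf xa; rewrite mxE xa mpolyC0 mul0r.
apply: eq_bigr => l' _; rewrite raddf_sum mulr_suml; apply: eq_bigr => y _.
by rewrite /= mpolyCM; ring.
Qed.

(** Once Delta is inverted, rho of the variables are combinations of the rest modulo Q, so only m -
    rho of them contribute. The denominators are cleared by Delta^s, whose level is linear in s. *)
Lemma growth_le_linear a : growth_le i W (fun c => Q c%:MP) a ->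
  growth_le mpoly_scalar mpoly_filtr Q (a + (m - rho)).
Proof.
move=> [c ub]; have fS := mpoly_filtration.
have /choice[E HE] := eliminate_var.
have [b [WD WE]] : exists b, W b Delta /\ forall l nu, W b (E l)@_nu.
  have [b0 W0] := filtr_ex fW Delta.
  have /choice[b1 W1] : forall l, exists b, forall nu, W b (E l)@_nu.
    by move=> l; apply: mpoly_filtr_bound.
  exists (b0 + \sum_l b1 l)%N; split=> [|l nu].
    by apply: (filtr_le fW) W0; apply: leq_addr.
  by apply: (filtr_le fW) (W1 l nu); rewrite (bigD1 l) //=; lia.
have mono (nu : 'X_{1..m}) : exists F, [/\ off (mdeg nu) F,
    forall mu, W (b * mdeg nu)%N F@_mu & Q ((Delta ^+ mdeg nu)%:MP * 'X_[nu] - F)].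
  move: {2}(mdeg nu) (erefl (mdeg nu)) => n; elim: n nu => [|n IH] nu dnu.
    move/eqP: (dnu); rewrite mdeg_eq0 => /eqP ->; rewrite mdeg0 expr0 mpolyX0.
    exists 1; rewrite mulr1 subrr; split; last exact: ideal0.
      by apply: (@off_const 0 1).
    move=> mu; rewrite mcoeff1 muln0.
    by case: eqP => _; [apply: (filtr1 fW) | apply: (filtr0 fW)].
  have [l nul] : exists l, nu l != 0%N.
    apply: contrapT => nl; suff nu0 : nu = 0%MM by rewrite nu0 mdeg0 in dnu.
    by apply/mnmP => l; rewrite mnm0E; apply/eqP/negP => ?; apply: nl; exists l; apply/negP.
  have nuE : nu = (U_(l) + (nu - U_(l)))%MM by rewrite addmC submK // lep1mP.
  have dnu' : mdeg (nu - U_(l)) = n.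
    by apply: succn_inj; rewrite -dnu {2}nuE mdegD mdeg1.
  have [F [oF WF QF]] := IH _ dnu'; have [oE QE] := HE l.
  exists (E l * F); rewrite {1 2 3 4}nuE mdegD mdeg1; split.
  - exact: off_mul.
  - move=> mu; rewrite mcoeffM; apply: (filtr_sum _ fW) => p _.
    by rewrite mulnDr muln1; apply: (filtrM fW).
  rewrite mpolyXD exprD expr1 mpolyCM.
  set D' := (Delta ^+ _)%:MP in QF *.
  have -> : Delta%:MP * D' * ('X_l * 'X_[nu - U_(l)]) - E l * F
    = (Delta%:MP * 'X_l - E l) * (D' * 'X_[nu - U_(l)])
      + E l * (D' * 'X_[nu - U_(l)] - F) by ring.
  by apply: idealD => //; [apply: idealMr | apply: idealMl].
have /choice[M HM] := mono.
(* Delta^s F rewritten modulo Q in the surviving variables. *)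
pose red s (F : {mpoly C[m]}) :=
  \sum_(nu <- msupp F) (F@_nu * Delta ^+ (s - mdeg nu))%:MP * M nu.
have red_off s F : mpoly_filtr s F -> off s (red s F).
  move=> [_ dF]; rewrite /red big_seq; apply: off_sum => nu nuF.
  have le_s : (mdeg nu <= s)%N.
    by rewrite leqNgt; apply/negP => /dF E0; rewrite mcoeff_msupp E0 eqxx in nuF.
  rewrite -(subnK le_s); apply: off_mul; first exact: off_const.
  by have [] := HM nu.
have red_W s F nu : mpoly_filtr s F -> W (b.+1 * s)%N (red s F)@_nu.
  move=> [WF dF]; rewrite /red raddf_sum /= big_seq; apply: (filtr_sum _ fW) => mu muF.
  have le_s : (mdeg mu <= s)%N.
    by rewrite leqNgt; apply/negP => /dF E0; rewrite mcoeff_msupp E0 eqxx in muF.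
  rewrite mcoeffCM; have [_ WM _] := HM mu.
  rewrite (_ : (b.+1 * s = s + b * (s - mdeg mu) + b * mdeg mu)%N); last first.
    by rewrite mulSn -addnA -mulnDr subnK.
  by apply: (filtrM fW) => //; apply: (filtrM fW) => //; apply: (filtrX _ fW).
have red_Q s F : mpoly_filtr s F -> Q ((Delta ^+ s)%:MP * F - red s F).
  move=> [_ dF]; rewrite {1}[F]mpolyE mulr_sumr -sumrB big_seq.
  apply: ideal_sum => // nu nuF.
  have le_s : (mdeg nu <= s)%N.
    by rewrite leqNgt; apply/negP => /dF E0; rewrite mcoeff_msupp E0 eqxx in nuF.
  have [_ _ QM] := HM nu.
  rewrite -mul_mpolyC -{1}(subnK le_s) exprD !mpolyCM.
  set x := (F@_nu)%:MP; set y := (Delta ^+ (s - _))%:MP; set z := (Delta ^+ _)%:MP.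
  rewrite (_ : _ - _ = x * y * (z * 'X_[nu] - M nu)); last by ring.
  exact: idealMl.
(* Coefficients of [red s] lie at level (b + 1) s, hence the factor (b + 1)^a; there are (s + 1)^(m
   - rho) exponent vectors [mon e]. *)
exists (c * b.+1 ^ a)%N => s I v Wv iv.
rewrite leqNgt; apply/negP => ltI.
pose off_t := {l : 'I_m | l \notin codom f}.
pose mon (e : {ffun off_t -> 'I_s.+1}) : 'X_{1..m} :=
  [multinom (if insub l is Some l' then e l' : nat else 0%N) | l < m].
have iq : is_ideal (fun c => Q c%:MP).
  split=> [|x y Qx Qy|x y Qy]; rewrite ?mpolyC0 ?mpolyCD ?mpolyCM.
  - exact: ideal0.
  - exact: idealD.
  - exact: idealMl.
have [//| | |d [[j0 nzj] Qd]] := @dependent_coords _ _ i _ (W (b.+1 * s)%N)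
   (c * (b.+1 * s).+1 ^ a)%N iq _ I {ffun off_t -> 'I_s.+1}
   (fun j e => (red s (v j))@_(mon e)).
- by move=> I' v' W' iv'; apply: ub W' iv'.
- by move=> j e; apply: red_W.
- rewrite card_ffun card_ord card_sig.
  have -> : #|[pred l | l \notin codom f]| = (m - rho)%N.
    rewrite -[LHS](addKn rho); congr (_ - _)%N.
    have := cardC (mem (codom f)); rewrite card_codom // !card_ord => E'.
    by apply: etrans E'; congr (_ + _)%N; apply: eq_card => l; rewrite !inE.
  apply: leq_ltn_trans ltI; rewrite expnD mulnA leq_mul2r -mulnA -expnMn leq_mul2l.
  by rewrite leq_exp2 ?orbT //; nia.
have : Q (\sum_j mpoly_scalar (d j) * red s (v j)).
  rewrite [X in Q X]mpolyE; apply: ideal_sum => // nu _.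
  rewrite -mul_mpolyC; apply: idealMr => //.
  rewrite raddf_sum /=.
  have [[dnu znu]|no] := pselect ((mdeg nu <= s)%N /\ forall a, nu (f a) = 0%N).
    have lt_s l : (nu l < s.+1)%N.
      by rewrite ltnS; apply: leq_trans dnu; rewrite mdegE (bigD1 l) //= leq_addr.
    have -> : nu = mon [ffun l => Ordinal (lt_s (val l))].
      apply/mnmP => l; rewrite mnmE; case: insubP => [l' _ <-|]; first by rewrite ffunE.
      by rewrite negbK => /codomP[a' ->].
    rewrite (eq_bigr (fun j => i (d j) * (red s (v j))@_(mon [ffun l => Ordinal (lt_s (val l))]))) //.
    by move=> j _; rewrite mcoeffCM.
  rewrite big1 ?mpolyC0; first exact: ideal0.
  move=> j _; rewrite mcoeffCM.
  have [->|nz] := eqVneq ((red s (v j))@_nu) 0; first by rewrite mulr0.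
  by case: no; apply: red_off nz.
(* Delta^s is outside Q, so the elements Delta^s v_j stay independent, against the relation among
   their reductions. *)
move=> Qred; move/eqP: nzj; apply.
apply: (indep_mul pQ _ iv (a := (Delta ^+ s)%:MP)).
  rewrite rmorphXn; exact: primeX.
rewrite (eq_bigr (fun j => mpoly_scalar (d j) * ((Delta ^+ s)%:MP * v j - red s (v j))
   + mpoly_scalar (d j) * red s (v j))); last by move=> j _; rewrite mulrBr subrK.
rewrite big_split; apply: idealD => //.
by apply: ideal_sum => // j _; apply: idealMl => //; apply: red_Q.
Qed.

End LinearRelations.

Lemma growth_le_mpoly (Q : {mpoly C[m]} -> Prop) a : prime_ideal Q ->
  growth_le i W (fun c => Q c%:MP) a ->
  growth_le mpoly_scalar mpoly_filtr Q (a + m).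
Proof.
move=> pQ ub; rewrite -[m in (a + m)%N]subn0.
(* No relations: the empty minor is 1. *)
apply: (@growth_le_linear Q 0 0 0 (fun x => False_rect _ (notF (ltn_ord x)))
  (fun x => False_rect _ (notF (ltn_ord x)))) => //.
- by case.
- by case.
- by rewrite det_mx00 mpolyC1; case: pQ.
Qed.

End PolyFiltration.

Arguments mpoly_filtr {C} W {m} s F.

(** * Regular sequences and primes of polynomial rings *)

Section KoszulExtension.
Implicit Types C D : comNzRingType.

Lemma kd_map C D (f : {rmorphism C -> D}) ws c k :
  kd (map f ws) (fun l => f (c l)) k = f (kd ws c k).
Proof.
elim: ws c k => [|w ws IH] c [|[] k] /=; rewrite ?rmorph0 //.
by rewrite rmorphB rmorphM -IH.
Qed.

Lemma coef_kd C (ws : seq C) (c : seq bool -> {poly C}) k j :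
  (kd (map polyC ws) c k)`_j = kd ws (fun l => (c l)`_j) k.
Proof.
elim: ws c k => [|w ws IH] c [|[] k] /=; rewrite ?coef0 //.
by rewrite coefB coefCM IH.
Qed.

Lemma kd0 C (ws : seq C) k : kd ws (fun=> 0) k = 0.
Proof.
rewrite -[RHS](mul0r (kd ws (fun=> 0) k)) -kdZ; congr (kd ws _ k).
by apply: funext => l; rewrite mul0r.
Qed.

(* [F] is, up to [s]-torsion, injective on each cohomology module of [ws]. *)
Lemma koszul_vanish_cons C (s F : C) ws :
  (forall i, (i < size ws)%N -> koszul_vanish s (@zero_ideal C) ws i) ->
  (forall i c e, (forall k, key (size ws) i k -> F * c k = kd ws e k) ->
    exists M e', forall k, key (size ws) i k -> s ^+ M * c k = kd ws e' k) ->
  forall i, (i < (size ws).+1)%N -> koszul_vanish s (@zero_ideal C) (F :: ws) i.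
Proof.
move=> V inj i lt_i c cyc.
pose a l := c (false :: l); pose b l := c (true :: l).
have kda k : key (size ws) i.+1 k -> kd ws a k = 0.
  by move=> kk; apply: (cyc (false :: k)); move: kk; rewrite /key /=; lia.
have Fa k : key (size ws) i k -> F * a k = kd ws b k.
  move=> kk; apply/eqP; rewrite -subr_eq0; apply/eqP.
  by apply: (cyc (true :: k)); move: kk; rewrite /key /=; lia.
have [M [e ae]] := inj i a b Fa.
(* A cocycle: F a = d b and s^M a = d e give d (s^M b) = d (F e). *)
pose b' l := s ^+ M * b l - F * e l.
have [M' [e' be']] : exists M' e', forall k, size k = size ws ->
    (count id k).+1 = i -> s ^+ M' * b' k = kd ws e' k.
  case: i lt_i cyc kda Fa ae => [|i] lt_i cyc kda Fa ae; first by exists 0%N, a.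
  have [k kk|M' [e' E]] := V i lt_i b'.
    rewrite /zero_ideal kdB !kdZ -ae // -Fa //; ring.
  exists M', e' => k sk [ck]; apply/eqP; rewrite -subr_eq0; apply/eqP/E.
  by rewrite /key sk ck !eqxx.
exists (M' + M)%N, (fun l => if l is true :: l' then - e' l' else
  if l is false :: l' then s ^+ M' * e l' else 0).
move=> [|[] k] /andP[/= /eqP // [sk] /eqP ck]; rewrite /zero_ideal.
  rewrite kdN exprD -mulrA (_ : c (true :: k) = b k) //.
  have := be' k sk ck; rewrite /b' => <-; ring.
rewrite kdZ -ae; last by rewrite /key sk eqxx; apply/eqP; lia.
by rewrite exprD -mulrA subrr.
Qed.

(** As [ws] consists of constants, the complex splits by degree in the indeterminate, and only
    finitely many degrees occur. *)
Lemma koszul_vanish_polyC C (s : C) ws i :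
  koszul_vanish s (@zero_ideal C) ws i ->
  koszul_vanish s%:P (@zero_ideal {poly C}) (map polyC ws) i.
Proof.
move=> V c; rewrite size_map => cyc.
have [k a b ab sa|k sk|N cN] :=
    @uniform_bound (size ws) (fun k N => size (c k) <= N)%N.
- exact: leq_trans sa ab.
- by exists (size (c k)).
have /choice[Me HMe] j : exists Me : nat * (seq bool -> C),
    forall k, key (size ws) i k -> s ^+ Me.1 * (c k)`_j = kd ws Me.2 k.
  have [k kk|M [e E]] := V (fun l => (c l)`_j).
    by rewrite /zero_ideal -coef_kd cyc // coef0.
  by exists (M, e) => k kk; apply/eqP; rewrite -subr_eq0; apply/eqP/E.
pose M := (\sum_(j < N) (Me j).1)%N.
exists M, (fun k => \poly_(j < N) (s ^+ (M - (Me j).1) * (Me j).2 k)) => k kk.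
apply/polyP => j; rewrite coef0 coefB coef_kd -rmorphXn coefCM.
have sk : size k = size ws by case/andP: kk => /eqP.
have [jN|Nj] := ltnP j N; last first.
  rewrite nth_default ?mulr0 ?sub0r; last exact: leq_trans (cN k sk) Nj.
  rewrite (_ : (fun l => _) = (fun=> 0)) ?kd0 ?oppr0 //.
  by apply: funext => l; rewrite coef_poly ltnNge Nj.
rewrite (_ : (fun l => _) = (fun l => s ^+ (M - (Me j).1) * (Me j).2 l)); last first.
  by apply: funext => l; rewrite coef_poly jN.
rewrite kdZ -HMe // mulrA -exprD subnK ?subrr //.
by rewrite /M (bigD1 (Ordinal jN)) //= leq_addr.
Qed.

(** If F c is a boundary, so is the leading coefficient of F times the top coefficient of c;
    subtracting the latter lowers the degree of c. *)
Lemma koszul_inj_poly C (F : {poly C}) (ws : seq C) i c e :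
  (forall k, key (size ws) i k -> F * c k = kd (map polyC ws) e k) ->
  exists M e', forall k, key (size ws) i k ->
    (lead_coef F)%:P ^+ M * c k = kd (map polyC ws) e' k.
Proof.
have [->|nzF] := eqVneq F 0.
  move=> _; exists 1%N, (fun=> 0) => k _.
  by rewrite lead_coef0 expr1 mul0r kd0.
have [k a b ab sa|k sk|N] := @uniform_bound (size ws) (fun k N => size (c k) <= N)%N.
- exact: leq_trans sa ab.
- by exists (size (c k)).
move=> cN; have {cN} : forall k, key (size ws) i k -> (size (c k) <= N)%N.
  by move=> k /andP[/eqP sk _]; apply: cN.
set a0 := lead_coef F; elim: N c e => [|N IH] c e cN Fc.
  exists 0%N, (fun=> 0) => k /cN; rewrite leqn0 size_poly_eq0 => /eqP ->.
  by rewrite mulr0 kd0.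
pose n := (size F).-1.
(* n + N is the highest degree that F c can reach. *)
pose E l := ((e l)`_(n + N))%:P.
have top k : key (size ws) i k -> a0%:P * ((c k)`_N)%:P = kd (map polyC ws) E k.
  move=> kk; rewrite (kd_map (@polyC C)) -coef_kd -Fc // -polyCM; congr _%:P.
  rewrite coefM (bigD1 (inord n)) //= inordK; last by lia.
  rewrite addKn big1 ?addr0 // => j nj.
  have [lt|] := ltnP n j.
    rewrite [F`_j]nth_default ?mul0r // -(prednK (_ : 0 < size F)%N) //.
    by rewrite size_poly_gt0.
  move=> le_jn; have lt_jn : (j < n)%N.
    rewrite ltn_neqAle le_jn andbT; apply: contra nj => /eqP jn; apply/eqP/val_inj.
    by rewrite /= inordK ?jn //; lia.
  by rewrite [(c k)`_ _]nth_default ?mulr0 //; apply: leq_trans (cN k kk) _; lia.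
have [k kk|k kk|M [e1 E1]] := IH (fun k => a0%:P * c k - 'X^N * (a0%:P * ((c k)`_N)%:P))
   (fun l => a0%:P * e l - F * ('X^N * E l)).
- apply/leq_sizeP => j Nj.
  rewrite coefB coefCM -polyCM ['X^N * _]mulrC coefCM coefXn.
  move: Nj; rewrite leq_eqVlt => /orP[/eqP <-|Nj]; first by rewrite eqxx mulr1 subrr.
  rewrite gtn_eqF // mulr0 subr0 nth_default ?mulr0 //.
  exact: leq_trans (cN k kk) Nj.
- rewrite kdB !kdZ -top // -Fc //; ring.
exists M.+1, (fun l => a0%:P ^+ M * ('X^N * E l) + e1 l) => k kk.
by rewrite kdD !kdZ -top // -E1 // exprS; ring.
Qed.

End KoszulExtension.

Section PrimeDimension.
Variable k : fieldType.
Implicit Types C D : comNzRingType.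

(* At a prime [Q] of a polynomial ring in [nu] variables, locally a regular
   sequence of some length [h] in [Q], and dimension at least [nu - h] of the
   quotient by [Q]. *)
Definition dim_prime C (i : {rmorphism k -> C}) W nu (Q : C -> Prop) :=
  exists (ws : seq C) (s : C),
  [/\ (size ws <= nu)%N, forall w, w \in ws -> Q w, ~ Q s,
      forall j, (j < size ws)%N -> koszul_vanish s (@zero_ideal C) ws j
    & growth_ge i W Q (nu - size ws)].

Definition dim_formula C (i : {rmorphism k -> C}) W nu :=
  forall Q : C -> Prop, prime_ideal Q -> dim_prime i W nu Q.

Lemma prime_preim C D (f : {rmorphism C -> D}) (Q : D -> Prop) :
  prime_ideal Q -> prime_ideal (fun c => Q (f c)).
Proof.
move=> [iQ nQ1 pQ]; split; rewrite ?rmorph1 //.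
- split=> [|x y|r x]; rewrite ?rmorph0 ?rmorphD ?rmorphM.
  + exact: ideal0.
  + exact: idealD.
  + exact: idealMl.
- by move=> a b; rewrite rmorphM => /pQ.
Qed.

Lemma dim_formula_field : dim_formula (idfun : {rmorphism k -> k}) (fun _ _ => True) 0.
Proof.
move=> Q [iQ nQ1 _]; exists [::], 1; split=> //.
exists 0%N => t; exists unit, (fun=> 1); split=> //; first by rewrite card_unit.
move=> c; rewrite (big_pred1 tt) ?mulr1 => [|[]] //= Qc [].
have [//|nz] := eqVneq (c tt) 0; case: nQ1.
by rewrite -(mulVf nz); apply: idealMl.
Qed.

Definition poly_filtr C (W : nat -> C -> Prop) s (F : {poly C}) :=
  (size F <= s.+1)%N /\ forall j, W s F`_j.

Lemma indep_polyC C (i : {rmorphism k -> C}) (Q : {poly C} -> Prop) (I : finType) (v : I -> C) :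
  indep i (fun c => Q c%:P) v -> indep (@polyC C \o i) Q (fun j => (v j)%:P).
Proof.
move=> iv c Qc; apply: iv; rewrite raddf_sum.
by under eq_bigr do rewrite /= polyCM.
Qed.

(** A leading term with coefficient in Q can be removed without leaving Q, and the coefficient at j
    stays outside Q. *)
Lemma nonextended_lead C (Q : {poly C} -> Prop) F j : prime_ideal Q -> Q F ->
  ~ Q (F`_j)%:P -> exists G, Q G /\ ~ Q (lead_coef G)%:P.
Proof.
move=> pQ; have iQ := prime_is_ideal pQ.
move: {2}(size F) (leqnn (size F)) => n; elim: n F => [|n IH] F.
  by rewrite leqn0 size_poly_eq0 => /eqP ->; rewrite coef0 polyC0 => _ []; apply: ideal0.
move=> sF QF nQ; have [Ql|] := pselect (Q (lead_coef F)%:P); last by exists F.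
have nz : (0 < size F)%N.
  by rewrite lt0n size_poly_eq0; apply/eqP => F0; case: nQ; rewrite F0 coef0 polyC0; apply: ideal0.
apply: (IH (F - (lead_coef F)%:P * 'X^((size F).-1))).
- apply/leq_sizeP => l; rewrite leq_eqVlt => /orP[/eqP <-|nl].
    rewrite coefB coefCM coefXn; have [E|ne] := eqVneq n (size F).-1.
      by rewrite mulr1 lead_coefE E subrr.
    rewrite mulr0 subr0 nth_default //.
    by move: sF; rewrite leq_eqVlt => /orP[/eqP E|//]; rewrite E eqxx in ne.
  rewrite coefB coefCM coefXn nth_default; last exact: leq_trans sF nl.
  by rewrite gtn_eqF ?mulr0 ?subr0 // prednK // (leq_trans sF).
- by apply: idealB => //; apply: idealMr.
- move=> Q1; apply: nQ; move: Q1; rewrite coefB coefCM coefXn polyCB => Q1.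
  rewrite -(subrK ((lead_coef F * (j == (size F).-1)%:R)%:P) (F`_j)%:P).
  by apply: idealD => //; rewrite polyCM; apply: idealMr.
Qed.

(** If Q is extended from its contraction, [ws] is kept and the powers of the indeterminate raise
    the dimension by one. Otherwise Q contains an F with leading coefficient outside Q; F prolongs
    the sequence and the dimension of the contraction suffices. *)
Lemma dim_formula_poly C (i : {rmorphism k -> C}) W nu : filtration i W ->
  dim_formula i W nu ->
  dim_formula (@polyC C \o i) (poly_filtr W) nu.+1.
Proof.
move=> fW dC Q pQ; have iQ := prime_is_ideal pQ.
have pq : prime_ideal (fun c => Q c%:P) by apply: prime_preim.
have [ws [s [le_h Qws nQs V [b lb]]]] := dC _ pq.
have Vs j : (j < size ws)%N ->
    koszul_vanish s%:P (@zero_ideal {poly C}) (map polyC ws) j.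
  by move=> jh; apply/koszul_vanish_polyC/V.
have WC t c : W t c -> poly_filtr W t c%:P.
  move=> Wc; split=> [|j]; first by rewrite size_polyC; case: eqP.
  by rewrite coefC; case: eqP => // _; apply: (filtr0 fW).
have [ext|next] := pselect (forall F, Q F -> forall j, Q (F`_j)%:P).
  exists (map polyC ws), s%:P; rewrite size_map; split=> //.
  - exact: leq_trans le_h _.
  - by move=> _ /mapP[w /Qws Qw ->].
  exists b.+1 => t; have [I [v [cI Wv iv]]] := lb t.
  exists (I * 'I_t.+1)%type, (fun p : I * 'I_t.+1 => (v p.1)%:P * 'X^(p.2)); split.
  - by rewrite card_prod cI card_ord subSn // expnSr.
  - move=> [l j] /=; split=> [|j'].
      apply: leq_trans (size_polyMleq _ _) _; rewrite size_polyC size_polyXn.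
      by have := ltn_ord j; case: (v l != 0) => /=; nia.
    rewrite coefCM coefXn; case: eqP => _; rewrite ?mulr1 ?mulr0; last exact: (filtr0 fW).
    by apply: (filtr_le fW) (Wv l); nia.
  - move=> c Qc [l j]; apply: (iv (fun l => c (l, j))).
    have := ext _ Qc j; congr (Q _%:P).
    rewrite (eq_bigr (fun p : I * 'I_t.+1 => (i (c (p.1, p.2)))%:P * ((v p.1)%:P * 'X^(p.2)))); last by case.
    rewrite -(pair_bigA _ (fun l (j : 'I_t.+1) => (i (c (l, j)))%:P * ((v l)%:P * 'X^j))) /=.
    rewrite coef_sum; apply: eq_bigr => l' _.
    rewrite coef_sum (bigD1 j) //= !coefCM coefXn eqxx mulr1 big1 ?addr0 // => j' nj.
    by rewrite !coefCM coefXn (inj_eq val_inj) eq_sym (negPf nj) !mulr0.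
have [F [j [QF nQF]]] : exists F j, Q F /\ ~ Q (F`_j)%:P.
  apply: contrapT => no; apply: next => F QF j; apply: contrapT => nQF.
  by apply: no; exists F, j.
have [{F j nQF QF}F [QF nQF]] := nonextended_lead pQ QF nQF.
exists (F :: map polyC ws), (s * lead_coef F)%:P.
rewrite /= size_map subSS; split=> //.
- by move=> w; rewrite inE => /orP[/eqP ->//|/mapP[w' /Qws Qw ->]].
- by rewrite polyCM; apply: primeM.
- rewrite -(size_map polyC ws); apply: koszul_vanish_cons.
    move=> l; rewrite size_map => lh; rewrite polyCM.
    by apply: koszul_vanish_mul; [apply: is_ideal0 | apply: Vs].
  move=> l c e; rewrite size_map => /koszul_inj_poly[M [e' E]].
  exists M, (fun l => s%:P ^+ M * e' l) => k' kk.
  by rewrite polyCM exprMn kdZ -E // mulrA.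
- exists b => t; have [I [v [cI Wv iv]]] := lb t.
  by exists I, (fun l => (v l)%:P); split=> // [l|]; [apply: WC | apply: indep_polyC].
Qed.

Lemma dim_formula_iso C D (i : {rmorphism k -> C}) (i' : {rmorphism k -> D}) W W' nu
  (f : {rmorphism C -> D}) (g : {rmorphism D -> C}) b :
  filtration i' W' ->
  cancel f g -> cancel g f -> f \o i =1 i' ->
  (forall s x, W s x -> W' (b * s)%N (f x)) ->
  dim_formula i W nu -> dim_formula i' W' nu.
Proof.
move=> fW' fK gK fi fW dC Q pQ.
have [ws [s [le_h Qws nQs V [c lb]]]] := dC _ (prime_preim f pQ).
exists (map f ws), (f s); rewrite size_map; split=> //.
- by move=> _ /mapP[w /Qws Qw ->].
- move=> j jh c'; rewrite size_map => cyc.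
  have [k' kk|M [e E]] := V j jh (fun l => g (c' l)).
    rewrite /zero_ideal -[LHS]fK -(kd_map f) /=.
    rewrite (_ : (fun l => _) = c') ?cyc ?rmorph0 //.
    by apply: funext => l; rewrite gK.
  exists M, (fun l => f (e l)) => k' kk.
  by rewrite -(gK (c' k')) -rmorphXn -rmorphM kd_map -rmorphB E // rmorph0.
- exists (b * c)%N => t; have [I [v [cI Wv iv]]] := lb t.
  exists I, (fun l => f (v l)); split=> // [l|]; first by rewrite -mulnA; apply: fW.
  move=> a Qa; apply: iv; rewrite rmorph_sum.
  rewrite (eq_bigr (fun j => i' (a j) * f (v j))) // => j _.
  by rewrite rmorphM -fi.
Qed.

Section Uni.
Variables (C : comNzRingType) (n : nat).
Let R := {mpoly C[n]}.
Let S := {mpoly C[n.+1]}.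

(** The inverse of [muni], used to split off one variable and apply [dim_formula_poly]. *)
Definition of_uni : {rmorphism {poly R} -> S} :=
  horner_eval ('X_ord_max : S) \o map_poly (@mwiden n C).

Lemma max_widen_neq (l : 'I_n) : (ord_max == widen_ord (leqnSn n) l) = false.
Proof. by apply/negbTE/eqP => /(congr1 val) /= E; have := ltn_ord l; rewrite -E ltnn. Qed.

Lemma muniX (m : 'X_{1..n.+1}) : muni ('X_[m] : S) =
  'X_[[multinom (m (widen_ord (leqnSn n) i)) | i < n]] *: 'X^(m ord_max).
Proof. by rewrite muniE msuppX big_seq1 mcoeffX eqxx scale1r. Qed.

Lemma muniCM c (q : S) : muni (c%:MP * q) = (c%:MP)%:P * muni q.
Proof. by rewrite muniM muniC. Qed.

Lemma of_uniC c : of_uni c%:P = mwiden c.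
Proof. by rewrite /of_uni /= map_polyC /= /horner_eval hornerC. Qed.

Lemma of_uniX : of_uni 'X = 'X_ord_max.
Proof. by rewrite /of_uni /= map_polyX /horner_eval hornerX. Qed.

Lemma muniK : cancel (@muni n C) of_uni.
Proof.
move=> p; rewrite {2}[p]mpolyE {1}[p]mpolyE (rmorph_sum (@muni n C)) (rmorph_sum of_uni).
apply: eq_bigr => m _; rewrite -mul_mpolyC.
suff H c : of_uni (muni (c%:MP * 'X_[m])) = c%:MP * 'X_[m] by exact: H.
rewrite muniCM muniX -mul_polyC !rmorphM rmorphXn of_uniX !of_uniC.
rewrite mwidenC mwidenX mpolyXn -mpolyXD; congr (_ * 'X_[_]).
apply/mnmP => j; rewrite mnmDE mulmnE mnm1E.
case: (unliftP ord_max j) => [l|] ->.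
  have -> : lift ord_max l = widen_ord (leqnSn n) l by apply/val_inj/lift_max.
  by rewrite mnmwiden_widen mnmE max_widen_neq addn0.
by rewrite mnmwiden_ordmax eqxx mul1n.
Qed.

Lemma of_uniK : cancel of_uni (@muni n C).
Proof.
have widK c : muni (mwiden c) = c%:P :> {poly R}.
  rewrite {2}[c]mpolyE {1}[c]mpolyE (rmorph_sum (@mwiden n C)).
  rewrite (rmorph_sum (@muni n C)) (rmorph_sum (@polyC _)); apply: eq_bigr => m _.
  rewrite -mul_mpolyC.
  suff H a : muni (mwiden (a%:MP * 'X_[m])) = (a%:MP * 'X_[m])%:P :> {poly R} by exact: H.
  rewrite mwidenM mwidenC mwidenX muniCM muniX polyCM.
  rewrite mnmwiden_ordmax expr0 alg_polyC; congr (_ * ('X_[_])%:P).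
  by apply/mnmP => l; rewrite mnmE mnmwiden_widen.
have muniXmax : muni ('X_ord_max : S) = 'X :> {poly R}.
  rewrite muniX mnm1E eqxx expr1 (_ : [multinom _ | _ < _] = 0%MM) ?mpolyX0 ?scale1r //.
  by apply/mnmP => l; rewrite mnmE mnm1E mnm0E max_widen_neq.
move=> p; rewrite -[p]coefK poly_def (rmorph_sum of_uni) (rmorph_sum (@muni n C)).
apply: eq_bigr => j _; rewrite -mul_polyC.
suff H c : muni (of_uni (c%:P * 'X^j)) = c%:P * 'X^j by exact: H.
rewrite rmorphM rmorphXn of_uniX of_uniC muniM widK; congr (_ * _).
by rewrite -muniXmax -(rmorphXn (@muni n C)).
Qed.

Variables (i : {rmorphism k -> C}) (W : nat -> C -> Prop).
Hypothesis fW : filtration i W.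

Lemma mpoly_filtrX r (nu : 'X_{1..r}) : mpoly_filtr W (mdeg nu) ('X_[nu] : {mpoly C[r]}).
Proof.
split=> mu; rewrite mcoeffX; have [E|_] := eqVneq nu mu => //.
- by apply: (filtr_le fW) (filtr1 fW).
- exact: (filtr0 fW).
- by rewrite -E ltnn.
Qed.

Lemma of_uni_filtr s p : poly_filtr (mpoly_filtr W) s p ->
  mpoly_filtr W (3 * s)%N (of_uni p).
Proof.
move=> [sp Wp]; have fS := mpoly_filtration n.+1 fW.
rewrite -[p]coefK poly_def (rmorph_sum of_uni); apply: (filtr_sum _ fS) => j _.
rewrite -mul_polyC.
suff : mpoly_filtr W (3 * s)%N (of_uni ((p`_j)%:P * 'X^j)) by [].
rewrite rmorphM rmorphXn of_uniC of_uniX.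
(* One s each for the level of the coefficients, the degree in the first n variables and the degree
   in the last one. *)
rewrite (_ : (3 * s = s + s + s)%N); last by lia.
apply: (filtrM fS); last first.
  rewrite mpolyXn; apply: (filtr_le fS) (mpoly_filtrX _).
  by rewrite mdegMn mdeg1 mul1n -ltnS; apply: leq_trans (ltn_ord j) sp.
rewrite [p`_j]mpolyE (rmorph_sum (@mwiden n C)) big_seq; apply: (filtr_sum _ fS) => m mp.
rewrite -mul_mpolyC.
suff : mpoly_filtr W (s + s)%N (mwiden ((p`_j@_m)%:MP * 'X_[m])) by [].
rewrite mwidenM mwidenC mwidenX; have [Wc dc] := Wp j.
apply: (filtrM fS); first exact: (mpoly_filtr_const _ fW).
apply: (filtr_le fS) (mpoly_filtrX _).
have -> : mdeg (mnmwiden m) = mdeg m.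
  rewrite !mdegE big_ord_recr /= mnmwiden_ordmax addn0.
  by apply: eq_bigr => l _; rewrite mnmwiden_widen.
by rewrite leqNgt; apply/negP => /dc E0; rewrite mcoeff_msupp E0 eqxx in mp.
Qed.

End Uni.

Lemma dim_formula_mpoly C (i : {rmorphism k -> C}) W nu n : filtration i W ->
  dim_formula i W nu ->
  dim_formula (mpoly_scalar i n) (mpoly_filtr W) (nu + n).
Proof.
move=> fW dC; elim: n => [|n IH].
  rewrite addn0; have fS := mpoly_filtration 0 fW.
  apply: (@dim_formula_iso C _ i _ W _ nu (@mpolyC 0 C) (mcoeff 0%MM) 1) => //.
  - exact: mpolyCK.
  - exact: mpolyKC.
  - by move=> s x Wx; rewrite mul1n; apply: (mpoly_filtr_const _ fW).
have fR := mpoly_filtration n fW; have fS := mpoly_filtration n.+1 fW.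
rewrite addnS.
apply: (dim_formula_iso fS (@of_uniK C n) (@muniK C n) _ (of_uni_filtr fW)
  (dim_formula_poly fR IH)).
by move=> a /=; rewrite -mwidenC -[RHS]of_uniC.
Qed.

End PrimeDimension.

(** * Minimal primes by Zorn's lemma, and unmixedness *)

Section PrimeAvoiding.
Variable C : comNzRingType.
Implicit Types H Q : C -> Prop.

Lemma binomial_ideal H a b u n m : is_ideal H -> H (u * a ^+ n) -> H (u * b ^+ m) ->
  H (u * (a + b) ^+ (n + m)).
Proof.
move=> iH Ha Hb; rewrite exprDn mulr_sumr; apply: ideal_sum => // j _.
rewrite mulrnAr -mulr_natr; apply: idealMr => //.
have [mj|jm] := leqP m j.
  have -> : b ^+ j = b ^+ (j - m) * b ^+ m by rewrite -exprD subnK.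
  by rewrite (_ : _ * _ = a ^+ (n + m - j) * b ^+ (j - m) * (u * b ^+ m));
    [apply: idealMl | ring].
rewrite (_ : (n + m - j = m - j + n)%N) ?exprD; last by lia.
by rewrite (_ : _ * _ = a ^+ (m - j) * b ^+ j * (u * a ^+ n)); [apply: idealMl | ring].
Qed.

(** Multiplicative sets avoiding H are maximized rather than ideals: the complement of a maximal one
    is a minimal prime of H, which yields the last clause, that its elements are nilpotent modulo H
    locally at Q. *)
Lemma prime_avoiding_powers H x : is_ideal H -> (forall M, ~ H (x ^+ M)) ->
  exists Q, [/\ prime_ideal Q, subI H Q, ~ Q x &
    forall F, Q F -> exists u n, ~ Q u /\ H (u * F ^+ n)].
Proof.
move=> iH nHx.
pose good (S : C -> Prop) := [/\ forall M, S (x ^+ M), forall a b, S a -> S b -> S (a * b)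
  & forall a, S a -> ~ H a].
pose T := {S : C -> Prop | good S}.
have good0 : good (fun z => exists M, z = x ^+ M).
  split=> [M|a b [M ->] [M' ->]|a [M ->]] //; first by exists M.
  by exists (M + M')%N; rewrite exprD.
pose R (S S' : T) := `[< forall z, sval S z -> sval S' z >].
have [||A totA|[S gS] maxS] := @classical_sets.ZL_preorder T (exist _ _ good0) R.
- by move=> S; apply/asboolP.
- by move=> S1 S2 S3 /asboolP h /asboolP h'; apply/asboolP => z /h /h'.
- have gU : good (fun z => (exists M, z = x ^+ M) \/ exists S : T, A S /\ sval S z).
    split=> [M|a b|a]; first by left; exists M.
    - move=> [[M ->]|[S [AS Sa]]] [[M' ->]|[S' [AS' Sb]]].
      + by left; exists (M + M')%N; rewrite exprD.
      + by right; exists S'; split=> //; have [Sx Sm _] := svalP S'; apply: Sm.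
      + by right; exists S; split=> //; have [Sx Sm _] := svalP S; apply: Sm.
      + have [/asboolP SS'|/asboolP S'S] := totA _ _ AS AS'; right.
          by exists S'; split=> //; have [_ Sm _] := svalP S'; apply: Sm => //; apply: SS'.
        by exists S; split=> //; have [_ Sm _] := svalP S; apply: Sm => //; apply: S'S.
    - move=> [[M ->]|[S [AS Sa]]] //; by have [_ _] := svalP S; apply.
  by exists (exist _ _ gU) => S AS; apply/asboolP => z Sz; right; exists S.
have [Sx SM SH] := gS.
have S1 : S 1 by have := Sx 0%N; rewrite expr0.
have SX a n : S a -> S (a ^+ n).
  by move=> Sa; elim: n => [|n IH]; rewrite ?expr0 // exprS; apply: SM.
(* Otherwise the products u a^n with u in S would form a larger multiplicative set avoiding H. *)
have notS a : ~ S a -> exists u n, S u /\ H (u * a ^+ n).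
  move=> nSa; apply: contrapT => no.
  have gS' : good (fun z => exists u n, S u /\ z = u * a ^+ n).
    split=> [M|b c [u [n [Su ->]]] [u' [n' [Su' ->]]]|b [u [n [Su ->]]] Hu].
    - by exists (x ^+ M), 0%N; rewrite expr0 mulr1.
    - exists (u * u'), (n + n')%N; split; first exact: SM.
      by rewrite exprD; ring.
    - by apply: no; exists u, n.
  have /asboolP/= : R (exist _ _ gS') (exist _ _ gS).
    apply: maxS; apply/asboolP => z /= Sz.
    by exists z, 0%N; rewrite expr0 mulr1.
  by move=> h; apply: nSa; apply: h; exists 1, 1%N; rewrite mul1r expr1.
exists (fun z => ~ S z); split.
- split.
  + split=> [S0|a b /notS[u [n [Su Ha]]] /notS[u' [n' [Su' Hb]]] Sab|r a /notS[u [n [Su Ha]]] Sra].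
    * by apply: (SH 0) => //; apply: ideal0.
    * apply: (SH (u * u' * (a + b) ^+ (n + n'))).
        by apply: (SM _ _ (SM _ _ Su Su')); apply: SX.
      apply: binomial_ideal => //.
        by rewrite mulrAC; apply: idealMr.
      by rewrite -mulrA; apply: idealMl.
    * apply: (SH (u * (r * a) ^+ n)); first by apply: SM => //; apply: SX.
      by rewrite exprMn mulrCA; apply: idealMl.
  + by apply.
  + move=> a b nSab; have [Sa|] := pselect (S a); last by left.
    by right=> Sb; apply: nSab; apply: SM.
- by move=> z Hz /SH.
- by apply; have := Sx 1%N; rewrite expr1.
- move=> F /notS[u [n [Su Hu]]]; exists u, n; split=> //; exact.
Qed.

End PrimeAvoiding.

Section Unmixed.
Variables (k : fieldType) (C : comNzRingType) (i : {rmorphism k -> C}).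
Variables (W : nat -> C -> Prop) (nu : nat).
Hypothesis dC : dim_formula i W nu.

(* Unmixedness of ideals generated by regular sequences: torsion modulo [ys]
   is supported on primes of dimension at least [nu - size ys]. *)
Lemma regular_unmixed x ys z : regular_upto x (@zero_ideal C) ys ->
  (forall M, ~ idl ys (x ^+ M * z)) ->
  exists Q, [/\ prime_ideal Q, forall F, idl ys (F * z) -> Q F, ~ Q x
    & forall a, growth_le i W Q a -> (nu <= a + size ys)%N].
Proof.
move=> reg tors; have iI := is_ideal_idl ys.
(* A minimal prime of the annihilator of z modulo [ys] plays the part of an associated prime. *)
have iH : is_ideal (fun F => idl ys (F * z)).
  split=> [|a b|r a]; rewrite ?mul0r ?mulrDl -?mulrA.
  - exact: ideal0.
  - exact: idealD.
  - exact: idealMl.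
have [Q [pQ HQ nQx QH]] := prime_avoiding_powers iH tors.
exists Q; split=> // a ub.
have [ws [s [le_nu Qws nQs V lb]]] := dC pQ.
suff le_h : (size ws <= size ys)%N by have := growth_ge_le lb ub; lia.
(* Were [ws] longer, powers of its elements would kill u z for a single u outside Q, and depth
   sensitivity would put (x s)^M u into Q. *)
rewrite leqNgt; apply/negP => lt_h.
have [u [nQu Hu]] : exists u, ~ Q u /\ forall w, w \in ws -> exists n, idl ys (w ^+ n * (u * z)).
  elim: (ws) Qws => [|w vs IH] Qws; first by exists 1; split=> //; case: pQ.
  have [|u [nQu Hu]] := IH; first by move=> v vv; apply: Qws; rewrite inE vv orbT.
  have [u' [n [nQu' Hu']]] := QH w (Qws _ (mem_head _ _)).
  exists (u * u'); split; first exact: primeM.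
  move=> v; rewrite inE => /orP[/eqP ->|/Hu[n' Hn']].
    exists n; rewrite (_ : _ * _ = u * (u' * w ^+ n * z)); last by ring.
    exact: idealMl.
  exists n'; rewrite (_ : _ * _ = u' * (v ^+ n' * (u * z))); last by ring.
  exact: idealMl.
have [|j jy|//|M HM] := @grade_torsion _ (x * s) ys ws (u * z).
- by apply: regular_upto_mul => //; apply: is_ideal0.
- rewrite mulrC; apply: koszul_vanish_mul; first exact: is_ideal0.
  by apply: V; apply: leq_ltn_trans jy lt_h.
have : Q ((x * s) ^+ M * u) by apply: HQ; rewrite -mulrA.
apply: primeM => //; apply: primeX => //; exact: primeM.
Qed.

End Unmixed.

(** * Residue fields, ranks and the condition G_d *)

Section ResidueField.
Variables (C : comNzRingType) (P : C -> Prop) (pP : prime_ideal P).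

Definition prime_pred (Q : prime_ideal P) : {pred C} := fun x => `[< P x >].

Lemma prime_pred_idealr : idealr_closed (prime_pred pP).
Proof.
have [iP nP1 _] := pP; split.
- by apply/asboolP; apply: ideal0.
- by apply/negP => /asboolP.
- move=> a u v /asboolP Pu /asboolP Pv; apply/asboolP.
  by apply: idealD => //; apply: idealMl.
Qed.

Lemma prime_pred_prime : prime_idealr_closed (prime_pred pP).
Proof.
have [_ _ h] := pP; move=> u v /asboolP/h[] ?; apply/orP; [left|right]; exact/asboolP.
Qed.

HB.instance Definition _ := isIdealr.Build C (prime_pred pP) prime_pred_idealr.
HB.instance Definition _ := isPrimeIdealrClosed.Build C (prime_pred pP) prime_pred_prime.

Definition prime_quot := {ideal_quot (prime_pred pP)}.

HB.instance Definition _ := GRing.ComNzRing.on prime_quot.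

(** An integral domain structure carries an inverse, which is chosen classically here. *)
Definition quot_unit : pred prime_quot := fun x => `[< exists y, y * x = 1 >].
Definition quot_inv (x : prime_quot) : prime_quot :=
  if pselect (exists y, y * x = 1) is left h then projT1 (cid h) else x.

Lemma quot_mulVx : {in quot_unit, left_inverse 1 quot_inv *%R}.
Proof.
move=> x /asboolP ex; rewrite /quot_inv; case: pselect => // h.
by case: cid.
Qed.

Lemma quot_unitP x y : y * x = 1 -> quot_unit x.
Proof. by move=> E; apply/asboolP; exists y. Qed.

Lemma quot_inv_out : {in [predC quot_unit], quot_inv =1 id}.
Proof.
by move=> x /asboolPn nex; rewrite /quot_inv; case: pselect.
Qed.

HB.instance Definition _ := GRing.ComNzRing_hasMulInverse.Build prime_quot
  quot_mulVx quot_unitP quot_inv_out.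

Lemma quot_idomain : GRing.integral_domain_axiom prime_quot.
Proof. exact: (@Quotient.rquot_IdomainAxiom C (prime_pred pP)). Qed.

HB.instance Definition _ := GRing.ComUnitRing_isIntegral.Build prime_quot quot_idomain.

End ResidueField.

Lemma fraction_numden (D : idomainType) (z : {fraction D}) :
  exists a b : D, b != 0 /\ z * FracField.tofrac b = FracField.tofrac a.
Proof.
pose r := repr z; exists (frac r).1, (frac r).2; split; first exact: denom_ratioP.
rewrite -[z]reprK -/r /FracField.tofrac; unlock.
rewrite -[LHS]FracField.pi_mul; apply/eqmodP; rewrite /= FracField.equivfE.
have nz : (frac r).2 != 0 := denom_ratioP r.
by rewrite /FracField.mulf !numden_Ratio ?oner_neq0 ?mulr1 ?mulf_neq0 ?oner_neq0 // mulrC.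
Qed.

Lemma residue_field (C : comNzRingType) (P : C -> Prop) : prime_ideal P ->
  exists (F : fieldType) (f : {rmorphism C -> F}),
    (forall x, f x = 0 <-> P x) /\
    forall z, exists a b, f b != 0 /\ z * f b = f a.
Proof.
move=> pP; pose D := prime_quot pP.
pose pi : {rmorphism C -> D} := \pi_D%qT.
have pi0 x : pi x = 0 <-> P x.
  rewrite -(rmorph0 pi); split=> [/eqP|Px].
    by rewrite /pi /= -Quotient.idealrBE subr0 => /asboolP.
  by apply/eqP; rewrite /pi /= -Quotient.idealrBE subr0; apply/asboolP.
exists {fraction D}, (@FracField.tofrac D \o pi); split=> [x|z] /=.
  rewrite -pi0; split=> [/eqP|->]; last by rewrite rmorph0.
  by rewrite tofrac_eq0 => /eqP.
have [a [b [nz E]]] := fraction_numden z.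
exists (repr a), (repr b); rewrite /pi /= !reprK; split=> //.
by rewrite tofrac_eq0.
Qed.

Lemma ideal_ofP (C : comNzRingType) N (g : 'I_N -> C) x :
  ideal_of g x <-> exists c : 'I_N -> C, x = \sum_j c j * g j.
Proof.
split=> [|[c ->]]; last first.
  apply: ideal_sum => [|j _]; first exact: is_ideal_gen.
  by apply: idealMl; [apply: is_ideal_gen | apply: gen_in; exists j].
move: x; apply: gen_sub; last first.
  move=> _ [j ->]; exists (fun l => (l == j)%:R).
  by rewrite (bigD1 j) //= eqxx mul1r big1 ?addr0 // => l /negPf ->; rewrite mul0r.
split=> [|_ _ [c ->] [c' ->]|r _ [c ->]].
- by exists (fun=> 0); rewrite big1 // => j _; rewrite mul0r.
- exists (fun j => c j + c' j); rewrite -big_split; apply: eq_bigr => j _.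
  by rewrite mulrDl.
- by exists (fun j => r * c j); rewrite mulr_sumr; apply: eq_bigr => j _; rewrite mulrA.
Qed.

Section Minors.
Variables (F : fieldType) (m n : nat).
Implicit Type A : 'M[F]_(m, n).

Lemma rank_minor A : exists (f : 'I_(\rank A) -> 'I_m) (g : 'I_(\rank A) -> 'I_n),
  injective f /\ \det (\matrix_(a, b) A (f a) (g b)) != 0.
Proof.
pose B := rowsub (maxrankfun A) A.
have fullB : row_full B^T by rewrite /row_full mxrank_tr; apply: maxrowsub_free.
exists (maxrankfun A), (fullrankfun fullB); split; first exact: maxrankfun_inj.
have := fullrowsub_unit fullB; rewrite unitmxE unitfE -det_tr.
by congr (\det _ != 0); apply/matrixP => a b; rewrite !mxE.
Qed.

Lemma minor_rank A r (f : 'I_r -> 'I_m) (g : 'I_r -> 'I_n) :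
  \det (\matrix_(a, b) A (f a) (g b)) != 0 -> (r <= \rank A)%N.
Proof.
move=> nz; have -> : r = \rank (\matrix_(a, b) A (f a) (g b)).
  by apply/esym/eqP; rewrite -/(row_free _) row_free_unit unitmxE unitfE.
have -> : \matrix_(a, b) A (f a) (g b) = rowsub f (colsub g A).
  by apply/matrixP => a b; rewrite !mxE.
apply: leq_trans (mxrankS (rowsub_sub _ _)) _.
rewrite -mxrank_tr trmx_mxsub -[X in (_ <= X)%N]mxrank_tr.
exact/mxrankS/rowsub_sub.
Qed.

End Minors.

Section Presentation.
Variables (C : comNzRingType) (m N : nat) (alpha : 'I_m -> C) (phi : 'M[C]_(m, N)).
Hypothesis HB : hilbert_burch alpha phi.
Variables (P : C -> Prop) (F : fieldType) (f : {rmorphism C -> F}).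
Hypotheses (pP : prime_ideal P) (kerf : forall x, f x = 0 <-> P x).

(** Rewriting u alpha_j through the h generators gives u id = phi Y + W, where W factors through a
    free module of rank h. Modulo P the left side has rank m. *)
Lemma rank_local_generators h (b : 'I_h -> C) :
  (forall l, ideal_of alpha (b l)) ->
  (forall j, exists u, ~ P u /\ ideal_of b (u * alpha j)) ->
  (m <= \rank (map_mx f phi) + h)%N.
Proof.
move=> Ib bgen.
have /choice[w Hw] l : exists w : 'I_m -> C, b l = \sum_s w s * alpha s.
  exact/ideal_ofP/Ib.
have [u [nPu Hu]] : exists u, ~ P u /\ forall j, ideal_of b (u * alpha j).
  have /choice[v Hv] := bgen; exists (\prod_j v j); split.
    elim/big_rec: _ => [|j x _ nPx]; first by case: pP.
    by apply: primeM => //; case: (Hv j).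
  move=> j; rewrite (bigD1 j) //= [v j * _]mulrC -mulrA; apply: idealMl.
    exact: is_ideal_gen.
  by case: (Hv j).
have /choice[c Hc] j : exists c : 'I_h -> C, u * alpha j = \sum_l c l * b l.
  exact/ideal_ofP/Hu.
pose cw := \matrix_(s, j) \sum_l w l s * c j l.
have /choice[y Hy] j : exists y : 'cV[C]_N, \col_s (u%:M - cw) s j = phi *m y.
  apply/(HB.1 _); under eq_bigr do rewrite !mxE.
  rewrite (eq_bigr (fun s => u * (alpha s *+ (s == j)) - \sum_l alpha s * (w l s * c j l))).
    rewrite sumrB -mulr_sumr (bigD1 j) //= eqxx big1 ?addr0 => [|s /negPf-> //].
    rewrite Hc exchange_big /= -sumrB big1 // => l _.
    rewrite Hw mulr_sumr -sumrB big1 // => s _; ring.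
  move=> s _; rewrite mulrBr mulr_sumr; congr (_ - _).
  by case: eqP => _; rewrite ?mulr0n ?mulr1n ?mulr0 // mulrC.
pose Y := \matrix_(s, j) y j s ord0.
have E : u%:M = phi *m Y + cw.
  apply/matrixP => s j; rewrite [RHS]mxE -[LHS](subrK (cw s j)); congr (_ + _).
  have := congr1 (fun A : 'cV_m => A s ord0) (Hy j); rewrite [in RHS]mxE mxE.
  have -> : (u%:M - cw) s j = u%:M s j - cw s j by rewrite !mxE.
  by move=> ->; rewrite mxE; apply: eq_bigr => l _; rewrite mxE.
have {}E : (f u)%:M = map_mx f phi *m map_mx f Y + map_mx f cw.
  by rewrite -map_scalar_mx E map_mxD map_mxM.
have nz : f u != 0 by apply/eqP => /kerf.
have rk : \rank ((f u)%:M : 'M_m) = m.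
  by apply: mxrank_unit; rewrite unitmxE det_scalar unitfE expf_neq0.
rewrite -[X in (X <= _)%N]rk E; apply: leq_trans (mxrank_add _ _) _.
apply: leq_add; first exact: mxrankM_maxl.
have -> : cw = (\matrix_(s, l) w l s) *m (\matrix_(l, j) c j l).
  by apply/matrixP => s j; rewrite !mxE; apply: eq_bigr => l _; rewrite !mxE.
by rewrite map_mxM; apply: leq_trans (mxrankM_maxl _ _) (rank_leq_col _).
Qed.

End Presentation.

Section Homogeneous.
Variables (k : fieldType) (D : nat).
Let R := {mpoly k[D]}.

Lemma homogM a b (p q : R) : homog_deg a p -> homog_deg b q -> homog_deg (a + b) (p * q).
Proof.
move=> hp hq mo /msuppM_le /allpairsP[[m1 m2] /= [/hp <- /hq <- ->]].
by rewrite mdegD.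
Qed.

Lemma homog_sum a (I : Type) (r : seq I) (Q : pred I) (F : I -> R) :
  (forall j, Q j -> homog_deg a (F j)) -> homog_deg a (\sum_(j <- r | Q j) F j).
Proof.
move=> h; elim/big_rec: _ => [|j x Qj hx] mo; first by rewrite msupp0.
by move/msuppD_le; rewrite mem_cat => /orP[/(h j Qj)|/hx].
Qed.

Lemma homog_det r (A : 'M[R]_r) (e : 'I_r -> nat) :
  (forall i j, homog_deg (e j) (A i j)) -> homog_deg (\sum_j e j) (\det A).
Proof.
move=> hA; apply: homog_sum => s _.
have hp : homog_deg (\sum_j e j) (\prod_i A i (s i)).
  rewrite (reindex_inj (@perm_inj _ s)) /=.
  elim: (index_enum _) => [|j l IH]; first by rewrite !big_nil => mo; rewrite msupp1 inE => /eqP ->; rewrite mdeg0.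
  by rewrite !big_cons; apply: homogM.
rewrite mulr_sign; case: (odd_perm s) => // mo.
by rewrite (perm_mem (msuppN _)); apply: hp.
Qed.

(** Substitutes xi_j t for x_j. With xi = x it separates homogeneous components; for
    [minimal_prime_off_x] xi comes from a kernel vector. *)
Definition dilate (C : comNzRingType) (f : {rmorphism k -> C}) (xi : 'I_D -> C) :
    {rmorphism R -> {poly C}} :=
  mmap (@polyC C \o f) (fun j => (xi j)%:P * 'X).

Lemma dilate_mon (C : comNzRingType) (f : {rmorphism k -> C}) xi c m :
  dilate f xi (c%:MP * 'X_[m]) = (f c * \prod_j xi j ^+ m j)%:P * 'X^(mdeg m).
Proof.
rewrite rmorphM {1}/dilate /= mmapC mmapX /= polyCM -mulrA; congr (_ * _).
rewrite /mmap1 rmorph_prod /= mdegE -prodrXr -big_split /=.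
by apply: eq_bigr => j _; rewrite exprMn rmorphXn.
Qed.

End Homogeneous.

(** The kernel of reduction to polynomials over the residue field of P. *)
Lemma prime_poly_ext (C : comNzRingType) (P : C -> Prop) : prime_ideal P ->
  prime_ideal (fun F : {poly C} => forall j, P F`_j).
Proof.
move=> pP; have [K [f [kerf _]]] := residue_field pP.
have ext (F : {poly C}) : (forall j, P F`_j) <-> map_poly f F = 0.
  split=> [h|/polyP E j]; last by apply/kerf; rewrite -coef_map E coef0.
  by apply/polyP => j; rewrite coef_map coef0; apply/kerf/h.
have iP := prime_is_ideal pP; split.
- split=> [j|F G PF PG j|F G PG]; rewrite ?coef0 ?coefD; first exact: ideal0.
    exact: idealD.
  by apply/ext; rewrite rmorphM /= ((ext G).1 PG) mulr0.
- by move/(_ 0%N); rewrite coef1 eqxx; case: pP.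
- move=> F G /ext/eqP; rewrite rmorphM /= mulf_eq0 => /orP[]/eqP/ext; [left|right]; done.
Qed.

(** * Homogeneous primes and the ranks given by G_D *)

Section PolynomialRing.
Variables (k : fieldType) (D : nat).
Let R := {mpoly k[D]}.

Definition trivial_filtr : nat -> k -> Prop := fun _ _ => True.
Definition scalar_R : {rmorphism k -> R} := mpoly_scalar (idfun : {rmorphism k -> k}) D.
Definition filtr_R : nat -> R -> Prop := mpoly_filtr trivial_filtr.

Lemma trivial_filtration : filtration (idfun : {rmorphism k -> k}) trivial_filtr.
Proof. by split=> //; exists 0%N. Qed.

Lemma filtration_R : filtration scalar_R filtr_R.
Proof. exact: mpoly_filtration trivial_filtration. Qed.

Lemma dim_formula_R : dim_formula scalar_R filtr_R D.
Proof.
exact: (@dim_formula_mpoly k k _ _ 0 D trivial_filtration (@dim_formula_field k)).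
Qed.

Lemma growth_le_field (Q : k -> Prop) : is_ideal Q ->
  growth_le (idfun : {rmorphism k -> k}) trivial_filtr Q 0.
Proof.
move=> iQ; exists 1%N => s I v _ iv; rewrite muln1.
have {}iv (c : I -> k) : \sum_j c j * v j = 0 -> forall j, c j = 0.
  by move=> E; apply: iv; rewrite E; apply: ideal0.
apply/fintype_le1P => x y; apply: contrapT => /eqP xy.
have delta a z : \sum_l (a *+ (l == z)) * v l = a * v z.
  rewrite (bigD1 z) //= eqxx big1 ?addr0 ?mulr1n // => l /negPf->.
  by rewrite mulr0n mul0r.
have vy : v y = 0.
  have E : \sum_l (v y *+ (l == x) - v x *+ (l == y)) * v l = 0.
    by under eq_bigr do rewrite mulrBl; rewrite sumrB !delta; ring.
  by have /= := iv _ E x; rewrite eqxx [x == y]eq_sym (negPf xy) subr0.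
have E : \sum_l (1 *+ (l == y)) * v l = 0 by rewrite delta vy mulr0.
by have /= := iv _ E y; rewrite eqxx => /eqP; rewrite oner_eq0.
Qed.

Lemma growth_le_R (Q : R -> Prop) : is_ideal Q -> growth_le scalar_R filtr_R Q D.
Proof.
move=> iQ; have p0 : prime_ideal (@zero_ideal R).
  split; [exact: is_ideal0 | by move/eqP; rewrite oner_eq0 |].
  by move=> a b /eqP; rewrite mulf_eq0 => /orP[]/eqP; [left|right].
apply: (@growth_le_sub _ _ _ _ (@zero_ideal R)) => [x ->|]; first exact: ideal0.
apply: (@growth_le_mpoly _ _ _ _ _ trivial_filtration _ 0) => //.
apply: growth_le_field; apply: prime_is_ideal; exact: (prime_preim (@mpolyC D k)).
Qed.

Definition scale_x : {rmorphism R -> {poly R}} := dilate (@mpolyC D k) (fun j => 'X_j).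

Lemma scale_x_mon c (m : 'X_{1..D}) :
  scale_x (c%:MP * 'X_[m]) = (c%:MP * 'X_[m])%:P * 'X^(mdeg m).
Proof. by rewrite dilate_mon -mpolyXE_id. Qed.

Lemma scale_x_homog e (F : R) : homog_deg e F -> scale_x F = F%:P * 'X^e.
Proof.
move=> hF; rewrite {2}[F]mpolyE {1}[F]mpolyE (rmorph_sum scale_x) (rmorph_sum (@polyC R)) mulr_suml.
rewrite big_seq [RHS]big_seq; apply: eq_bigr => m /hF <-.
by rewrite -mul_mpolyC; exact: scale_x_mon.
Qed.

Lemma scale_x_at1 (F : R) : (scale_x F).[1] = F.
Proof.
rewrite {2}[F]mpolyE {1}[F]mpolyE (rmorph_sum scale_x) horner_sum; apply: eq_bigr => m _.
rewrite -mul_mpolyC; suff H : (scale_x ((F@_m)%:MP * 'X_[m])).[1] = (F@_m)%:MP * 'X_[m] by exact: H.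
by rewrite scale_x_mon hornerCM hornerXn expr1n mulr1.
Qed.

Lemma scale_x_coef0 (F : R) : (scale_x F)`_0 = (F@_0)%:MP.
Proof.
have mcoeff0P : (F@_0)%:MP = \sum_(m <- msupp F) (F@_m * (m == 0%MM)%:R)%:MP :> R.
  rewrite {1}[F]mpolyE raddf_sum raddf_sum; apply: eq_bigr => m _.
  by rewrite /= mcoeffZ mcoeffX.
rewrite mcoeff0P {1}[F]mpolyE (rmorph_sum scale_x) coef_sum; apply: eq_bigr => m _.
rewrite -mul_mpolyC.
suff H : (scale_x ((F@_m)%:MP * 'X_[m]))`_0 = (F@_m * (m == 0%MM)%:R)%:MP by exact: H.
rewrite scale_x_mon coefCM coefXn [0%N == _]eq_sym mdeg_eq0.
by case: eqP => [->|]; rewrite ?mpolyX0 ?mulr1 ?mulr0.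
Qed.

(* [F(t x)] lies in [q[t]]: the prime generated by the homogeneous elements of [q]. *)
Definition homog_part (q : R -> Prop) : R -> Prop := fun F => forall j, q (scale_x F)`_j.

Section HomogPart.
Variable q : R -> Prop.
Hypothesis pq : prime_ideal q.

Lemma prime_homog_part : prime_ideal (homog_part q).
Proof. exact: (prime_preim scale_x (prime_poly_ext pq)). Qed.

Lemma homog_part_sub : subI (homog_part q) q.
Proof.
move=> F qF; rewrite -(scale_x_at1 F) horner_coef; apply: ideal_sum => [|j _].
  exact: prime_is_ideal.
by rewrite expr1n mulr1; apply: qF.
Qed.

Lemma homog_part_homog e F : homog_deg e F -> q F -> homog_part q F.
Proof.
move=> hF qF j; rewrite (scale_x_homog hF) coefCM; apply: idealMr => //.
exact: prime_is_ideal.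
Qed.

(** Constant terms of its elements vanish, so the homogeneous part is strictly inside the ideal (x).
    At height D its growth would be 0, leaving no room for a larger proper ideal. Thus G_D applies,
    even if q itself has height D. *)
Lemma homog_part_height j : ~ q 'X_j -> ~ height_ge (homog_part q) D.
Proof.
move=> nqX ht.
have [_] := growth_le_height filtration_R growth_le_R prime_homog_part ht.
rewrite subnn => g0.
pose Q' (F : R) := F@_0%MM = 0.
have iQ' : is_ideal Q'.
  split=> [|x y|r x]; rewrite /Q' ?mcoeff0 ?mcoeffD ?rmorphM //.
  - by move=> -> ->; rewrite addr0.
  - by move=> /= ->; rewrite mulr0.
suff : Q' 1 by rewrite /Q' mcoeff1 eqxx => /eqP; rewrite oner_eq0.
apply: (growth_le0_strict (F := 'X_j) filtration_R prime_homog_part iQ' _ _ _ g0).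
- move=> F /(_ 0%N); rewrite scale_x_coef0 => qF; apply: contrapT => /eqP nz.
  case: pq => iq nq1 _; apply: nq1; rewrite -mpolyC1 -(mulVf nz) mpolyCM.
  exact: idealMl.
- by rewrite /Q' mcoeffX mnm1_eq0.
- by move/homog_part_sub.
Qed.

End HomogPart.

Section RankGrowth.
Variables (m N : nat) (alpha : 'I_m -> R) (phi : 'M[R]_(m, N)) (e : 'I_N -> nat).
Hypothesis HB : hilbert_burch alpha phi.
Hypothesis hphi : forall i j, homog_deg (e j) (phi i j).
Hypothesis G : G_cond (ideal_of alpha) D.

(* The two alternatives: [q] does not contain the ideal, or [G_D] applies to
   the homogeneous part of [q]. *)
Lemma rank_growth (q : R -> Prop) (F : fieldType) (f : {rmorphism R -> F}) j0 :
  prime_ideal q -> (forall x, f x = 0 <-> q x) -> ~ q 'X_j0 ->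
  exists h, (m <= \rank (map_mx f phi) + h)%N /\
    (h = 1%N \/ (h < D)%N /\ growth_le scalar_R filtr_R q (D - h)).
Proof.
move=> pq kerf nqX.
have pq' := prime_homog_part pq; have qq' := homog_part_sub pq.
have [F' [f' [kerf' _]]] := residue_field pq'.
(* Degrees depend only on the column, so minors of [phi] are homogeneous, and one outside the
   homogeneous part is outside q. *)
have le_rk : (\rank (map_mx f' phi) <= \rank (map_mx f phi))%N.
  have [a [b [_ nz]]] := rank_minor (map_mx f' phi).
  apply: (minor_rank (f := a) (g := b)); apply: contraNneq nz.
  have E (K : fieldType) (g : {rmorphism R -> K}) :
      \det (\matrix_(x, y) map_mx g phi (a x) (b y)) = g (\det (\matrix_(x, y) phi (a x) (b y))).
    by rewrite -det_map_mx; congr (\det _); apply/matrixP => x y; rewrite !mxE.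
  rewrite !E => /kerf qd; apply/eqP/kerf'.
  apply: (homog_part_homog pq (e := \sum_y e (b y))) => //.
  by apply: homog_det => x y; rewrite mxE.
have [sub|nsub] := pselect (subI (ideal_of alpha) (homog_part q)).
  have [h [hth [b [Ib bgen]]]] := G pq' sub (homog_part_height pq nqX).
  have [hD gh] := growth_le_height filtration_R growth_le_R pq' hth.
  have lt_hD : (h < D)%N.
    rewrite ltn_neqAle hD andbT; apply/eqP => E; apply: (homog_part_height pq nqX).
    by move: hth; rewrite E.
  exists h; split; last by right; split=> //; apply: growth_le_sub gh.
  apply: leq_trans (rank_local_generators HB pq' kerf' Ib _) _; last by rewrite leq_add2r.
  by move=> j; apply: bgen; apply/ideal_ofP; exists (fun l => (l == j)%:R);
    rewrite (bigD1 j) //= eqxx mul1r big1 ?addr0 // => l /negPf->; rewrite mul0r.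
have [j nqj] : exists j, ~ homog_part q (alpha j).
  have iq' := prime_is_ideal pq'.
  apply: contrapT => no; apply: nsub => _ /ideal_ofP[c ->].
  apply: (ideal_sum _ iq') => j _; apply: (idealMl _ iq').
  by apply: contrapT => nqj; apply: no; exists j.
(* Some alpha_j is a unit locally at the homogeneous part, so one generator suffices. *)
exists 1%N; split; last by left.
have gen l : ideal_of alpha (alpha l) by apply: gen_in; exists l.
apply: leq_trans (@rank_local_generators _ _ _ _ _ HB _ _ f' pq' kerf' 1 (fun=> alpha j) _ _) _ => //.
  move=> l; exists (alpha j); split=> //; apply/ideal_ofP; exists (fun=> alpha l).
  by rewrite big_ord1 mulrC.
by rewrite leq_add2r.
Qed.

End RankGrowth.

End PolynomialRing.

(** * Graded local cohomology *)

Section KoszulTransition.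
Variable C : comNzRingType.
Implicit Types (xs : seq C) (c : seq bool -> C).

Definition powers N xs : seq C := [seq x ^+ N | x <- xs].

(* The map from the Koszul complex of the [x ^+ N] to that of the [x ^+ (N + M)]. *)
Fixpoint trans M xs (k : seq bool) : C :=
  match xs, k with
  | x :: xs', b :: k' => (if b then x ^+ M else 1) * trans M xs' k'
  | _, _ => 1
  end.

Lemma kd_trans N M xs c k :
  kd (powers (N + M) xs) (fun l => trans M xs l * c l) k = trans M xs k * kd (powers N xs) c k.
Proof.
elim: xs c k => [|x xs IH] c [|[] k] /=; rewrite ?mulr0 //.
  under [X in kd _ X]funext do rewrite -mulrA.
  rewrite (kdZ _ (x ^+ M) (fun l => trans M xs l * c (true :: l))) IH exprD; ring.
rewrite mul1r -IH; congr (kd _ _ k); apply: funext => l; by rewrite mul1r.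
Qed.

Lemma transD M M' xs k : trans (M + M') xs k = trans M xs k * trans M' xs k.
Proof.
elim: xs k => [|x xs IH] [|[] k] /=; rewrite ?mulr1 // IH ?exprD; ring.
Qed.

Lemma trans_factor M xs k : size k = size xs -> (0 < count id k)%N ->
  exists x r, x \in xs /\ trans M xs k = r * x ^+ M.
Proof.
elim: xs k => [|x xs IH] [|[] k] //= [sk] ck.
  by exists x, (trans M xs k); rewrite mem_head mulrC.
have [y [r [yx ->]]] := IH k sk ck.
by exists y, r; rewrite inE yx orbT mul1r.
Qed.

Lemma trans0 xs k : trans 0 xs k = 1.
Proof. by elim: xs k => [|x xs IH] [|b k] //=; rewrite IH expr0 if_same mulr1. Qed.

Lemma trans_count0 M xs k : count id k = 0%N -> trans M xs k = 1.
Proof. by elim: xs k => [|x xs IH] [|[] k] //= ck; rewrite mul1r IH. Qed.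

End KoszulTransition.

Section Bigraded.
Variables (k : fieldType) (D m : nat).
Let R := {mpoly k[D]}.
Let S := {mpoly R[m]}.
Implicit Types (y z : S) (U : S -> Prop).

Lemma coef2P y z : (forall nu mu, y@_nu@_mu = z@_nu@_mu) -> y = z.
Proof. by move=> h; apply/mpolyP => nu; apply/mpolyP => mu. Qed.

Lemma mpoly_of_coef (A : comNzRingType) n (E : 'X_{1..n} -> A) b :
  (forall mu, (b <= mdeg mu)%N -> E mu = 0) -> exists p : {mpoly A[n]}, forall mu, p@_mu = E mu.
Proof.
move=> E0; exists (\sum_(mu : 'X_{1..n < b}) E mu *: 'X_[mu]) => mu.
have [lt|le] := ltnP (mdeg mu) b; first exact: mcoeff_mpoly.
rewrite E0 // raddf_sum big1 //= => nu _; rewrite mcoeffZ mcoeffX.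
case: eqP => [Enu|]; last by rewrite mulr0.
by have := bmdeg nu; rewrite Enu ltnNge le.
Qed.

(** Covers truncation in x-degree ([s] the identity) and division by a power of a variable ([s] a
    translation). The degree condition keeps supports finite. *)
Lemma coef_operator (c : pred 'X_{1..D}) (s : 'X_{1..D} -> 'X_{1..D}) :
  (forall mu, mdeg mu <= mdeg (s mu))%N ->
  exists op : S -> S, forall z nu mu, (op z)@_nu@_mu = if c mu then z@_nu@_(s mu) else 0.
Proof.
move=> le_s.
have /choice[G HG] (p : R) : exists p' : R, forall mu, p'@_mu = if c mu then p@_(s mu) else 0.
  apply: (@mpoly_of_coef _ _ _ (msize p)) => mu le_mu; case: (c mu) => //.
  apply: memN_msupp_eq0; apply: msize_mdeg_ge; exact: leq_trans le_mu (le_s mu).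
have G0 : G 0 = 0 by apply/mpolyP => mu; rewrite HG !mcoeff0 if_same.
have /choice[op Hop] (z : S) : exists z' : S, forall nu, z'@_nu = G z@_nu.
  apply: (@mpoly_of_coef _ _ _ (msize z)) => nu le_nu.
  by rewrite memN_msupp_eq0 // msize_mdeg_ge.
by exists op => z nu mu; rewrite Hop HG.
Qed.

Definition xvar j : S := ('X_j : R)%:MP.

Lemma mcoeffXM (p : R) mu mu' :
  ('X_[mu'] * p)@_mu = if (mu' <= mu)%MM then p@_(mu - mu') else 0.
Proof.
case: ifP => [le|nle].
  by rewrite -{1}(submK le) addmC mulrC mcoeffMX.
rewrite mcoeffM big1 // => q /eqP E; rewrite mcoeffX; case: eqP => [E'|]; last by rewrite mul0r.
by case/negP: nle; rewrite E E' lem_addr.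
Qed.

Lemma xvar_coef j N z nu mu : (xvar j ^+ N * z)@_nu@_mu =
  if (N <= mu j)%N then z@_nu@_(mu - U_(j) *+ N)%MM else 0.
Proof.
rewrite /xvar -rmorphXn mcoeffCM /= mpolyXn mcoeffXM.
congr (if _ then _ else _); apply/mnm_lepP/idP => [/(_ j)|le l].
  by rewrite mulmnE mnm1E eqxx mul1n.
by rewrite mulmnE mnm1E; case: eqP => [<-|_]; rewrite ?mul1n ?mul0n.
Qed.

Definition xge t z := forall nu mu, z@_nu@_mu != 0 -> (t <= mdeg mu)%N.
Definition xhomog e z := forall nu mu, z@_nu@_mu != 0 -> mdeg mu = e.

Lemma coef2M y z nu mu : (y * z)@_nu@_mu != 0 -> exists nu1 mu1 nu2 mu2,
  [/\ y@_nu1@_mu1 != 0, z@_nu2@_mu2 != 0 & mdeg mu = (mdeg mu1 + mdeg mu2)%N].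
Proof.
move=> nz; apply: contrapT => no; move/eqP: nz; apply.
rewrite mcoeffM raddf_sum big1 // => p _ /=.
rewrite mcoeffM big1 // => q /eqP E.
apply: contrapT => /eqP; rewrite mulf_eq0 negb_or => /andP[n1 n2]; apply: no.
exists p.1, q.1, p.2, q.2; split=> //.
by rewrite -mdegD; exact: (congr1 (@mdeg D) E).
Qed.

Lemma xgeM s t y z : xge s y -> xge t z -> xge (s + t) (y * z).
Proof.
move=> hy hz nu mu /coef2M[nu1 [mu1 [nu2 [mu2 [/hy h1 /hz h2 ->]]]]].
exact: leq_add.
Qed.

Lemma xgeD t y z : xge t y -> xge t z -> xge t (y + z).
Proof.
move=> hy hz nu mu; rewrite !mcoeffD.
have [->|n0 _] := eqVneq (y@_nu@_mu) 0; last exact: hy n0.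
by rewrite add0r; apply: hz.
Qed.

Lemma xgeN t y : xge t y -> xge t (- y).
Proof. by move=> hy nu mu; rewrite !mcoeffN oppr_eq0; apply: hy. Qed.

Lemma xge_le s t z : (s <= t)%N -> xge t z -> xge s z.
Proof. by move=> st hz nu mu /hz; apply: leq_trans. Qed.

Lemma xge0 t : xge t 0.
Proof. by move=> nu mu; rewrite !mcoeff0 eqxx. Qed.

Lemma xhomog_xge e z : xhomog e z -> xge e z.
Proof. by move=> h nu mu /h ->. Qed.

Lemma xhomogM a b y z : xhomog a y -> xhomog b z -> xhomog (a + b) (y * z).
Proof.
by move=> hy hz nu mu /coef2M[nu1 [mu1 [nu2 [mu2 [/hy h1 /hz h2 ->]]]]]; rewrite h1 h2.
Qed.

Lemma xhomog_sum a (I : Type) (r : seq I) (P : pred I) F :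
  (forall j, P j -> xhomog a (F j)) -> xhomog a (\sum_(j <- r | P j) F j).
Proof.
move=> h; elim/big_rec: _ => [|j x Pj hx] nu mu; first by rewrite !mcoeff0 eqxx.
rewrite !mcoeffD; have [->|n0 _] := eqVneq ((F j)@_nu@_mu) 0; last exact: h n0.
by rewrite add0r; apply: hx.
Qed.

Lemma xhomog_const e (p : R) : homog_deg e p -> xhomog e (p%:MP).
Proof.
move=> hp nu mu; rewrite mcoeffC; have [_|_] := eqVneq nu 0%MM; last first.
  by rewrite mulr0 mcoeff0 eqxx.
by rewrite mulr1 -mcoeff_msupp => /hp.
Qed.

Lemma xhomog_T l : xhomog 0 ('X_l : S).
Proof.
move=> nu mu; rewrite mcoeffX; have [_|_] := eqVneq _ nu; last by rewrite mcoeff0 eqxx.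
by rewrite mcoeff1; have [->|_] := eqVneq mu 0%MM; rewrite ?mdeg0 ?eqxx.
Qed.

Lemma xhomog_xvar j N : xhomog N (xvar j ^+ N).
Proof.
rewrite /xvar -rmorphXn; apply: xhomog_const => /= mo.
by rewrite mpolyXn msuppX inE => /eqP ->; rewrite mdegMn mdeg1 mul1n.
Qed.

Definition truncation (Tr : nat -> S -> S) := forall t z nu mu,
  (Tr t z)@_nu@_mu = if (t <= mdeg mu)%N then z@_nu@_mu else 0.

Lemma truncation_exists : exists Tr, truncation Tr.
Proof.
have /choice[Tr H] t := @coef_operator (fun mu => t <= mdeg mu)%N id (fun mu => leqnn _).
by exists Tr => t z nu mu; apply: H.
Qed.

Section Truncation.
Variable Tr : nat -> S -> S.
Hypothesis HTr : truncation Tr.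

Lemma TrD t y z : Tr t (y + z) = Tr t y + Tr t z.
Proof.
apply: coef2P => nu mu; rewrite HTr !mcoeffD !HTr.
by case: ifP; rewrite ?addr0.
Qed.

Lemma TrN t y : Tr t (- y) = - Tr t y.
Proof.
by apply: coef2P => nu mu; rewrite HTr !mcoeffN !HTr; case: ifP; rewrite ?oppr0.
Qed.

Lemma Tr0 t : Tr t 0 = 0.
Proof. by apply: coef2P => nu mu; rewrite HTr !mcoeff0 if_same. Qed.

Lemma Tr_id t z : xge t z -> Tr t z = z.
Proof.
move=> h; apply: coef2P => nu mu; rewrite HTr; case: ifPn => // nle.
by apply/esym/eqP/negPn; apply: contra nle; apply: h.
Qed.

Lemma Tr_xge t z : xge t (Tr t z).
Proof. by move=> nu mu; rewrite HTr; case: ifP; rewrite ?eqxx. Qed.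

(** For t < e the truncated subtraction is harmless: y z already has x-degree at least t. *)
Lemma TrM t e y z : xhomog e y -> Tr t (y * z) = y * Tr (t - e) z.
Proof.
move=> hy; rewrite -{1}(subrK (Tr (t - e) z) z) mulrDr TrD.
rewrite [X in _ + X]Tr_id; last first.
  apply: (@xge_le _ (e + (t - e))); first by lia.
  by apply: xgeM; [apply: xhomog_xge | apply: Tr_xge].
rewrite [X in X + _](_ : _ = 0) ?add0r //.
apply: coef2P => nu mu; rewrite HTr !mcoeff0; case: ifP => // le_t.
apply/eqP/negPn/negP => /coef2M[nu1 [mu1 [nu2 [mu2 [/hy h1 + E]]]]].
rewrite !mcoeffB HTr; case: ifPn; rewrite ?subrr ?eqxx // -ltnNge => lt _.
by move: le_t; rewrite E h1; lia.
Qed.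

Lemma Tr_idl ys t z : (forall y, y \in ys -> exists e, xhomog e y) ->
  idl ys z -> idl ys (Tr t z).
Proof.
elim/last_ind: ys t z => [|ys y IH] t z hys; first by move=> ->; rewrite Tr0.
rewrite idl_rcons => -[b Ub].
have [|e he] := hys y; first by rewrite mem_rcons mem_head.
exists (Tr (t - e) b); rewrite -TrM // -TrN -TrD; apply: IH => // y' yy'.
by apply: hys; rewrite mem_rcons inE yy' orbT.
Qed.

Lemma kd_Tr N ws t (e : seq bool -> S) key : (forall w, w \in ws -> xhomog N w) ->
  kd ws (fun l => Tr (t - N) (e l)) key = Tr t (kd ws e key).
Proof.
elim: ws e key => [|w ws IH] e [|[] key] hw /=; rewrite ?Tr0 //.
  rewrite TrD TrN (TrM _ _ (hw w (mem_head _ _))) -IH // => v vw.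
  by apply: hw; rewrite inE vw orbT.
by rewrite -IH // => v vw; apply: hw; rewrite inE vw orbT.
Qed.

End Truncation.

End Bigraded.

Section GradedVanishing.
Variables (k : fieldType) (D m : nat).
Let R := {mpoly k[D]}.
Let S := {mpoly R[m]}.
Implicit Types (y z : S) (U : S -> Prop) (c e : seq bool -> S).
Local Notation X := (@xvar k D m).

Definition division j N (dv : S -> S) := forall z nu mu,
  (dv z)@_nu@_mu = z@_nu@_(mu + U_(j) *+ N)%MM.

Lemma division_exists j N : exists dv, division j N dv.
Proof.
have [mu|dv H] := @coef_operator k D m predT (fun mu => mu + U_(j) *+ N)%MM.
  by rewrite mdegD leq_addr.
by exists dv => z nu mu; rewrite H.
Qed.

Lemma divisionK j N dv z : division j N dv -> dv (X j ^+ N * z) = z.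
Proof.
move=> H; apply: coef2P => nu mu; rewrite H xvar_coef mnmDE mulmnE mnm1E eqxx mul1n leq_addl.
by rewrite addmK.
Qed.

Lemma division_mul j l N M dv z : division j N dv -> l != j ->
  dv (X l ^+ M * z) = X l ^+ M * dv z.
Proof.
move=> H lj; apply: coef2P => nu mu; rewrite H !xvar_coef H.
rewrite mnmDE mulmnE mnm1E eq_sym (negPf lj) mul0n addn0.
case: ifP => // le; congr (_ @_ _); apply/mnmP => h.
rewrite !(mnmDE, mnmBE, mulmnE, mnm1E).
have [<-|_] := eqVneq l h; last by rewrite !mul0n !subn0.
by rewrite eq_sym (negPf lj) mul0n !addn0.
Qed.

Lemma divisionB j N dv y z : division j N dv -> dv (y - z) = dv y - dv z.
Proof. by move=> H; apply: coef2P => nu mu; rewrite H !mcoeffB !H. Qed.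

Lemma division0 j N dv : division j N dv -> dv 0 = 0.
Proof. by move=> H; apply: coef2P => nu mu; rewrite H !mcoeff0. Qed.

Lemma kd_division j N M dv js c key : division j N dv -> j \notin js ->
  kd (powers M (map X js)) (fun l => dv (c l)) key = dv (kd (powers M (map X js)) c key).
Proof.
move=> H; elim: js c key => [|l js IH] c [|[] key] /=; rewrite ?(division0 H) // inE negb_or.
  by case/andP=> jl js'; rewrite (divisionB _ _ H) (division_mul _ _ H) ?IH // eq_sym.
by case/andP=> jl js'; rewrite -IH.
Qed.

(** Coefficientwise division by X_j^N commutes with the differential on the other variables, so
    X_j^N acts injectively on their cohomology. *)
Lemma koszul_vanish_vars js N i : uniq js -> (i < size js)%N ->
  koszul_vanish 1 (@zero_ideal S) (powers N (map X js)) i.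
Proof.
elim: js i => [|j js IH] i //= /andP[nj uj] lt_i.
apply: koszul_vanish_cons; last by rewrite !size_map.
  by move=> l; rewrite !size_map; apply: IH.
move=> {i lt_i} i c e Fc; have [dv H] := division_exists j N.
exists 0%N, (fun l => dv (e l)) => key kk.
by rewrite expr0 mul1r (kd_division _ _ _ H) // -Fc // (divisionK _ H).
Qed.

Lemma kd_full js N z :
  (forall nu mu, z@_nu@_mu != 0 -> exists2 j, j \in js & (N <= mu j)%N) ->
  exists e, kd (powers N (map X js)) e (nseq (size js) true) = z.
Proof.
elim: js z => [|j js IH] z hz.
  exists (fun=> 0); apply: coef2P => nu mu; rewrite !mcoeff0; apply/esym/eqP.
  by apply/negPn/negP => /hz[].
have [dv H] := division_exists j N.
have [nu mu|e E] := IH (X j ^+ N * dv z - z).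
  rewrite !mcoeffB xvar_coef; have [le|lt] := leqP N (mu j).
    rewrite H submK ?subrr ?eqxx //; apply/mnm_lepP => l.
    by rewrite mulmnE mnm1E; case: eqP => [<-|_]; rewrite ?mul1n ?mul0n.
  rewrite sub0r oppr_eq0 => /hz[l]; rewrite inE => /orP[/eqP->|]; last by exists l.
  by rewrite leqNgt lt.
exists (fun l => if l is true :: l' then e l' else dv z) => /=.
by rewrite E; ring.
Qed.

Definition xvars : seq S := map X (enum 'I_D).

Lemma size_xvars : size xvars = D. Proof. by rewrite size_map size_enum_ord. Qed.

Lemma size_powers N : size (powers N xvars) = D. Proof. by rewrite size_map size_xvars. Qed.

Lemma powers_xhomog N w : w \in powers N xvars -> xhomog N w.
Proof. by case/mapP => _ /mapP[j _ ->] ->; apply: xhomog_xvar. Qed.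

(** [tau] is a degree raised by D, since degrees down to 1 - D must be handled with natural
    numbers. *)
Definition ordreq tau N i := (tau + N * i - D)%N.

(* [H^i_m(S/U)] vanishes in degrees at least [tau - D]; the component of a
   Koszul cochain at a key with [i] letters [true] has its degree shifted by [N i]. *)
Definition graded_vanish U i tau := forall N c, (0 < N)%N ->
  (forall l, key D i l -> xge (ordreq tau N i) (c l)) ->
  (forall l, key D i.+1 l -> U (kd (powers N xvars) c l)) ->
  exists M e, forall l, key D i l ->
    U (trans M xvars l * c l - kd (powers (N + M) xvars) e l).

Lemma xge_trans M js l : size l = size js -> xge (M * count id l) (trans M (map X js) l).
Proof.
elim: js l => [|j js IH] [|b l] //=; first by rewrite muln0.
case=> sl.
rewrite mulnDr; apply: xgeM; last exact: IH.
by case: b; rewrite ?muln1; [apply/xhomog_xge/xhomog_xvar | rewrite muln0].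
Qed.

Lemma xge_transM M t i l z : key D i l -> xge t z ->
  xge (t + M * i) (trans M xvars l * z).
Proof.
move=> /andP[/eqP sl /eqP <-] h; rewrite addnC; apply: xgeM => //.
by apply: xge_trans; rewrite size_enum_ord.
Qed.

Lemma kd_xge N t c i l : (forall l', key D i l' -> xge t (c l')) ->
  key D i.+1 l -> xge (t + N) (kd (powers N xvars) c l).
Proof.
move=> hc kl; pose c' l := if key D i l then c l else 0.
rewrite (@eq_kd _ _ i _ c') ?size_powers // => [|l' kl']; last by rewrite /c' kl'.
have {}hc l' : xge t (c' l').
  by rewrite /c'; case: ifP => [/hc //|_]; apply: xge0.
have : forall w, w \in powers N xvars -> xhomog N w by apply: powers_xhomog.
elim: (powers N xvars) (c') l hc {kl} => [|w ws IH] f [|[] l] hf hw /=; try exact: xge0.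
  apply: xgeD.
    by rewrite addnC; apply: xgeM; first by apply/xhomog_xge/hw/mem_head.
  by apply: xgeN; apply: IH => [l'|v vw]; [apply: hf | apply: hw; rewrite inE vw orbT].
by apply: IH => [l'|v vw]; [apply: hf | apply: hw; rewrite inE vw orbT].
Qed.

Section Step.
Variables (ys : seq S) (y : S) (e : nat).
Let U := idl ys.
Hypothesis hys : forall w, w \in ys -> exists a, xhomog a w.
Hypothesis hy : xhomog e y.
Hypothesis nzd : forall j, nzd_upto (X j) U y.

Let iU : is_ideal U := is_ideal_idl ys.

(** In positive cohomological degree every component of the transition map contains some X_j^M, and
    a power of each X_j kills f modulo U. *)
Lemma trans_kill i (f : seq bool -> S) :
  (forall l, key D i.+1 l -> U (y * f l)) ->
  exists M, forall l, key D i.+1 l -> U (trans M xvars l * f l).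
Proof.
move=> yf.
have [l a b ab Pa kk j|l sl|M PM] := @uniform_bound D
    (fun l M => key D i.+1 l -> forall j, U (X j ^+ M * f l)).
- by apply: (ideal_expM iU ab); apply: Pa.
- have [kk|] := boolP (key D i.+1 l); last by exists 0%N.
  have /choice[Mj HMj] j : exists M, U (X j ^+ M * f l) by apply/nzd/yf.
  exists (\sum_j Mj j)%N => _ j; apply: (ideal_expM iU) (HMj j).
  by rewrite (bigD1 j) //= leq_addr.
exists M => l kk; have /andP[/eqP sl /eqP cl] := kk.
have [||x [r [/mapP[j _ ->] ->]]] := @trans_factor _ M xvars l; rewrite ?size_xvars ?cl //.
by rewrite -mulrA; apply: idealMl => //; apply: PM.
Qed.

(** The long exact sequence of [koszul_vanish_adjoin] with degrees: the connecting map lowers them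
    by e, the degree of y. *)
Lemma graded_vanish_adjoin i tau : (e <= tau)%N ->
  graded_vanish U i tau -> graded_vanish U i.+1 (tau - e) ->
  graded_vanish (adjoin U y) i tau.
Proof.
move=> le_e Vi Vi1 N c N0 oc cyc.
have [Tr HTr] := truncation_exists k D m.
have TrU t z : U z -> U (Tr t z) by apply: Tr_idl HTr _ _ _ hys.
have homP N' := @powers_xhomog N'.
have /choice[b0 Ub0] l : exists b, key D i.+1 l -> U (kd (powers N xvars) c l - y * b).
  have [kl|] := boolP (key D i.+1 l); last by exists 0.
  by have [b] := cyc l kl; exists b.
(* Dropping the low-degree part of [b0] is allowed since U is generated by x-homogeneous elements;
   it gives [b] the order required by [Vi1]. *)
pose b l := Tr (ordreq (tau - e) N i.+1) (b0 l).
have Ub l : key D i.+1 l -> U (kd (powers N xvars) c l - y * b l).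
  move=> kl; have := TrU (ordreq tau N i.+1) _ (Ub0 l kl).
  rewrite (TrD HTr) (TrN HTr) (TrM HTr _ _ hy) (Tr_id HTr); last first.
    apply: xge_le (kd_xge oc kl); rewrite /ordreq mulnS; lia.
  by rewrite /b (_ : ordreq tau N i.+1 - e = ordreq (tau - e) N i.+1)%N // /ordreq; lia.
have yb l : key D i.+2 l -> U (y * kd (powers N xvars) b l).
  have kdi := kd_ideal (ws := powers N xvars) (i := i.+1) iU; rewrite size_powers in kdi.
  move=> kl; have := kdi _ Ub l kl; rewrite kdB kdZ kdK ?sub0r.
    by move/(idealN iU); rewrite opprK.
  by rewrite size_powers; case/andP: kl => /eqP.
have [M HM] := trans_kill yb.
have [| |l kl|M1 [e1 He1]] := Vi1 (N + M)%N (fun l => trans M xvars l * b l).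
- by lia.
- move=> l kl; apply: xge_le (xge_transM (t := ordreq (tau - e) N i.+1) kl _).
    by rewrite /ordreq mulnDl; lia.
  exact: Tr_xge.
- by rewrite kd_trans; apply: HM.
pose e1' l := Tr (ordreq (tau - e) (N + M + M1) i.+1 - (N + M + M1))%N (e1 l).
have {}He1 l : key D i.+1 l ->
    U (trans M1 xvars l * (trans M xvars l * b l) - kd (powers (N + M + M1) xvars) e1' l).
  move=> kl; have := TrU (ordreq (tau - e) (N + M + M1) i.+1) _ (He1 l kl).
  rewrite (TrD HTr) (TrN HTr) (kd_Tr HTr _ _ _ (homP _)) (Tr_id HTr) //.
  rewrite mulrA -transD.
  have ob : xge (ordreq (tau - e) N i.+1) (b l) by apply: Tr_xge.
  apply: xge_le (xge_transM (M := M1 + M) kl ob).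
  by rewrite /ordreq !mulnDl; lia.
have [| |l kl|M2 [e2 He2]] := Vi (N + M + M1)%N
    (fun l => trans (M + M1) xvars l * c l - y * e1' l).
- by lia.
- move=> l kl; apply: xgeD.
    apply: xge_le (xge_transM (t := ordreq tau N i) kl (oc l kl)).
    by rewrite /ordreq !mulnDl; lia.
  apply: xgeN; apply: (@xge_le _ _ _ _ (e + (ordreq (tau - e) (N + M + M1) i.+1 - (N + M + M1)))%N).
    by rewrite /ordreq mulnS; lia.
  by apply: xgeM; [apply: xhomog_xge | apply: Tr_xge].
- rewrite kdB kdZ -addnA kd_trans.
  rewrite (_ : _ - _ = trans (M + M1) xvars l * (kd (powers N xvars) c l - y * b l)
    + y * (trans M1 xvars l * (trans M xvars l * b l) - kd (powers (N + (M + M1)) xvars) e1' l)).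
    apply: idealD => //; apply: idealMl => //; first exact: Ub.
    by rewrite addnA; apply: He1.
  by rewrite transD; ring.
exists (M + M1 + M2)%N, e2 => l kl; exists (trans M2 xvars l * e1' l).
have := He2 l kl; rewrite !addnA; congr U; rewrite !transD; ring.
Qed.

End Step.

Lemma graded_vanish_top ys i tau : (D < i)%N -> graded_vanish (idl ys) i tau.
Proof.
move=> lt_i N c _ _ _; exists 0%N, c => l /andP[/eqP sl /eqP cl].
by have := count_size id l; rewrite sl cl leqNgt lt_i.
Qed.

Lemma graded_vanish_zero i tau : (i <= D)%N -> (D.+1 - i <= tau)%N ->
  graded_vanish (@zero_ideal S) i tau.
Proof.
rewrite leq_eqVlt => /orP[/eqP -> le1|lt_i _] N c N0 oc cyc; last first.
  have [||l|M [e He]] := @koszul_vanish_vars (enum 'I_D) N i _ _ c.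
  - exact: enum_uniq.
  - by rewrite size_enum_ord.
  - by rewrite size_powers; apply: cyc.
  exists 0%N, e => l kl; rewrite addn0.
  by have := He l; rewrite size_powers expr1n trans0; apply.
have [|e He] := @kd_full (enum 'I_D) N (c (nseq D true)).
  move=> nu mu nz; apply: contrapT => no.
  have := oc (nseq D true); rewrite /key size_nseq count_nseq mul1n eqxx => /(_ isT nu mu nz).
  (* A monomial with all exponents below N has degree at most D N - D, under the order required of
     the cochain. *)
  have : (mdeg mu <= D * N.-1)%N.
    rewrite mdegE -[X in (_ <= X * _)%N]card_ord -sum_nat_const; apply: leq_sum => j _.
    rewrite -ltnS prednK // ltnNge; apply/negP => le; apply: no; exists j => //.
    by rewrite mem_enum.
  by rewrite /ordreq; move: le1; rewrite subSn // subnn; nia.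
exists 0%N, e => l kl.
have -> : l = nseq D true.
  case/andP: kl => /eqP sl /eqP cl.
  have /all_pred1P : all (pred1 true) l.
    by rewrite all_count (eq_count (a2 := id)) ?cl ?sl // => -[].
  by rewrite sl.
rewrite size_enum_ord in He; rewrite trans0 addn0 He mul1r subrr; done.
Qed.

(** The bound D + 1 - i for H^i, due to H^D, is stable under adjoining forms of degree 1, as i + 1
    and tau - 1 satisfy it too. Adjoining y needs tau at least D + 1 for H^0 and tau - n at least D
    for H^1; tau = D + n meets both, so H^0 vanishes from degree n on. *)
Lemma graded_saturation ys y n z : (0 < n)%N ->
  (forall w, w \in ys -> xhomog 1 w) -> xhomog n y ->
  (forall j, regular_upto (X j) (@zero_ideal S) (rcons ys y)) ->
  xge n z -> (forall j, exists M, idl (rcons ys y) (X j ^+ M * z)) ->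
  idl (rcons ys y) z.
Proof.
move=> n0 hys hy reg oz xz.
have V i tau : (D.+1 - i <= tau)%N -> graded_vanish (idl ys) i tau.
  have {}reg j : regular_upto (X j) (@zero_ideal S) ys.
    by have /regular_upto_rcons[] := reg j.
  elim/last_ind: ys i tau hys reg {xz} => [|vs v IH] i tau hys reg le_tau.
    have [le|lt] := leqP i D; first exact: graded_vanish_zero.
    exact: graded_vanish_top.
  have [le|lt] := leqP i D; last exact: graded_vanish_top.
  have hv : xhomog 1 v by apply: hys; rewrite mem_rcons mem_head.
  have hvs w : w \in vs -> xhomog 1 w by move=> wv; apply: hys; rewrite mem_rcons inE wv orbT.
  have reg1 j : regular_upto (X j) (@zero_ideal S) vs /\ nzd_upto (X j) (idl vs) v.
    exact/regular_upto_rcons.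
  rewrite idl_rcons; apply: (@graded_vanish_adjoin vs v 1).
  - by move=> w /hvs hw; exists 1%N.
  - by [].
  - by move=> j; case: (reg1 j).
  - by lia.
  - by apply: IH => // j; case: (reg1 j).
  - by apply: IH => // [j|]; [case: (reg1 j) | lia].
have {}V : graded_vanish (idl (rcons ys y)) 0 (D + n).
  rewrite idl_rcons; apply: (@graded_vanish_adjoin ys y n).
  - by move=> w /hys hw; exists 1%N.
  - by [].
  - by move=> j; have /regular_upto_rcons[] := reg j.
  - by lia.
  - by apply: V; lia.
  - by apply: V; lia.
have iU := is_ideal_idl (rcons ys y).
(* N exceeds every exponent, so z is a cocycle for the powers X_j^N. *)
have /choice[M HM] := xz; pose N := (\sum_j M j).+1.
have [||l kl|M' [e He]] := V N (fun=> z); first by [].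
- by move=> l _; rewrite /ordreq muln0 addn0 addKn.
- have [|w /mapP[_ /mapP[j _ ->] ->] ->] := @kd_count1 _ (powers N xvars) z l.
    by rewrite size_powers.
  apply: (ideal_expM iU) (HM j); rewrite /N (bigD1 j) //=; lia.
have := He (nseq D false); rewrite /key size_nseq count_nseq eqxx => /(_ isT).
by rewrite kd_count0 ?trans_count0 ?count_nseq // mul1r subr0.
Qed.

End GradedVanishing.

(** * Almost linear presentations *)

Lemma rank_colsub (F : fieldType) m N r (A : 'M[F]_(m, N)) (c : 'I_r -> 'I_N) :
  injective c -> (\rank A <= \rank (colsub c A) + (N - r))%N.
Proof.
move=> inj_c; pose J := [pred j | j \notin codom c].
have cJ : #|J| = (N - r)%N.
  rewrite -[LHS](addKn r); congr (_ - _)%N.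
  have := cardC (mem (codom c)); rewrite card_codom // !card_ord => E.
  by apply: etrans E; congr (_ + _)%N; apply: eq_card => l; rewrite !inE.
rewrite -(mxrank_tr A) -(mxrank_tr (colsub c A)) -cJ.
pose A1 := rowsub c A^T; pose A2 := rowsub (@enum_val _ J) A^T.
have -> : (colsub c A)^T = A1 by apply/matrixP => a b; rewrite !mxE.
apply: (@leq_trans (\rank (A1 + A2)%MS)); last first.
  apply: leq_trans (mxrank_adds_leqif _ _) _.
  by rewrite leq_add2l rank_leq_row.
apply: mxrankS; apply/row_subP => j.
have [/codomP[l ->]|nj] := boolP (j \in codom c).
  by apply: submx_trans (addsmxSl _ _); rewrite -row_rowsub; apply: row_sub.
apply: submx_trans (addsmxSr _ _).
have jJ : j \in J by [].
have -> : row j A^T = row (enum_rank_in jJ j) A2 by rewrite row_rowsub enum_rankK_in.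
exact: row_sub.
Qed.

Lemma mpoly_gen_ind (A : comNzRingType) n (Pr : {mpoly A[n]} -> Prop) :
  (forall c, Pr c%:MP) -> (forall j, Pr 'X_j) ->
  (forall p q, Pr p -> Pr q -> Pr (p + q)) -> (forall p q, Pr p -> Pr q -> Pr (p * q)) ->
  forall p, Pr p.
Proof.
move=> PC PX PD PM p; rewrite [p]mpolyE; elim: (msupp p) => [|mu s IH].
  by rewrite big_nil -mpolyC0.
rewrite big_cons; apply: (PD) => //; rewrite -mul_mpolyC; apply: (PM) => //.
rewrite mpolyXE_id; elim: (index_enum _) => [|j l IHl].
  by rewrite big_nil -mpolyC1.
rewrite big_cons; apply: (PM) => //; elim: (mu j) => [|a IHa].
  by rewrite expr0 -mpolyC1.
by rewrite exprS; apply: PM.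
Qed.

Section AlmostLinear.
Variables (k : fieldType) (D m N : nat).
Let R := {mpoly k[D]}.
Let S := {mpoly R[m]}.
Local Notation X := (@xvar k D m).
Definition scalar_S : {rmorphism k -> S} := mpoly_scalar (scalar_R k D) m.
Definition filtr_S : nat -> S -> Prop := mpoly_filtr (@filtr_R k D).

Lemma filtration_S : filtration scalar_S filtr_S.
Proof. exact: (mpoly_filtration m (filtration_R k D)). Qed.

Lemma dim_formula_S : dim_formula scalar_S filtr_S (D + m).
Proof. exact: (dim_formula_mpoly (filtration_R k D) (@dim_formula_R k D)). Qed.

Variables (alpha : 'I_m -> R) (phi : 'M[R]_(m, N)) (e : 'I_N -> nat).
Hypothesis HB : hilbert_burch alpha phi.
Hypothesis hphi : forall i j, homog_deg (e j) (phi i j).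
Hypothesis G : G_cond (ideal_of alpha) D.
Hypothesis D_gt0 : (0 < D)%N.
Hypothesis mN : m = N.+1.

Definition colform j : S := \sum_l 'X_l * (phi l j)%:MP.

Section Dimension.
Variables (Q : S -> Prop) (r : nat) (c : 'I_r -> 'I_N) (j0 : 'I_D).
Hypotheses (pQ : prime_ideal Q) (inj_c : injective c).
Hypotheses (Qc : forall b, Q (colform (c b))) (nQX : ~ Q (X j0)).

Lemma le_rN : (r <= N)%N.
Proof. by rewrite -[r]card_ord -[N]card_ord; apply: leq_card inj_c. Qed.

(** The r chosen columns have rank at least m - h - (N - r) modulo the contraction of Q, so each of
    the remaining h + (N - r) variables adds one to its dimension b. *)
Lemma growth_forms a : (forall h, (h = 1%N \/ (h < D)%N /\
    growth_le (scalar_R k D) (@filtr_R k D) (fun c => Q c%:MP) (D - h)) ->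
  exists b, growth_le (scalar_R k D) (@filtr_R k D) (fun c => Q c%:MP) b /\
    (b + h + (N - r) <= a)%N) -> growth_le scalar_S filtr_S Q a.
Proof.
move=> H; have pq := prime_preim (@mpolyC m R) pQ.
have [F [f [kerf _]]] := residue_field pq.
have [h [le_m Hh]] := rank_growth HB hphi G pq kerf nQX.
have [b [gb le_a]] := H h Hh.
pose psi := colsub c phi.
have le_rk := rank_colsub (map_mx f phi) inj_c.
have [f' [g' [inj_f nz]]] := rank_minor (map_mx f psi).
have := @growth_le_linear _ _ _ _ _ (filtration_R k D) Q r _ psi f' g' pQ inj_f _ _ b gb.
have E : map_mx f psi = colsub c (map_mx f phi) by rewrite /psi map_mxsub.
move=> H'; apply: growth_le_mono (H' _ _).
- rewrite -E in le_rk; move: le_rk le_m le_a.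
  by move: (\rank (map_mx f psi)) (\rank (map_mx f phi)) => x y; lia.
- move=> l; have := Qc l; congr Q; apply: eq_bigr => s _; by rewrite mxE.
- move=> /kerf Qd; move/eqP: nz; apply.
  rewrite -[RHS]Qd -det_map_mx; congr (\det _).
  by apply/matrixP => x y; rewrite !mxE.
Qed.

(** Since m = N + 1, the case h = 1 with b = D gives exactly this bound, and the case b = D - h one
    less. *)
Lemma growth_forms_le : growth_le scalar_S filtr_S Q (D + m - r).
Proof.
have rN := le_rN; apply: growth_forms => h [->|[lt gh]].
  exists D; split; last by lia.
  by apply: growth_le_R; apply: prime_is_ideal; apply: prime_preim pQ.
by exists (D - h)%N; split=> //; lia.
Qed.

(** A nonzero p in the contraction lowers b to D - 1 when h = 1; the other case has one to spare. *)
Lemma growth_forms_lt p : p != 0 -> Q p%:MP ->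
  growth_le scalar_S filtr_S Q (D + m - r.+1).
Proof.
move=> nz Qp; have rN := le_rN; apply: growth_forms => h [->|[lt gh]].
  exists D.-1; split; last by lia.
  have p0 : prime_ideal (@zero_ideal R).
    split; [exact: is_ideal0 | by move/eqP; rewrite oner_eq0 |].
    by move=> a b /eqP; rewrite mulf_eq0 => /orP[]/eqP; [left|right].
  have iq := prime_is_ideal (prime_preim (@mpolyC m R) pQ).
  apply: (growth_le_strict (F := p) (filtration_R k D) p0 iq _ Qp).
  - by move=> x ->; exact: (ideal0 iq).
  - by move/eqP: nz.
  - by rewrite prednK //; apply: growth_le_R; apply: is_ideal0.
by exists (D - h)%N; split=> //; lia.
Qed.

End Dimension.

Definition colforms js : seq S := map colform js.

Section Forms.
Variables (Q : S -> Prop) (js : seq 'I_N) (j0 : 'I_D).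
Hypotheses (pQ : prime_ideal Q) (ujs : uniq js).
Hypotheses (Qc : forall y, y \in colforms js -> Q y) (nQX : ~ Q (X j0)).

Let c (b : 'I_(size js)) := tnth (in_tuple js) b.

Lemma inj_cols : injective c.
Proof. by apply/tuple_uniqP. Qed.

Lemma Q_cols b : Q (colform (c b)).
Proof. by apply/Qc/map_f/mem_tnth. Qed.

Lemma growth_cols_le : growth_le scalar_S filtr_S Q (D + m - size js).
Proof. exact: (growth_forms_le pQ inj_cols Q_cols nQX). Qed.

Lemma growth_cols_lt p : p != 0 -> Q p%:MP ->
  growth_le scalar_S filtr_S Q (D + m - (size js).+1).
Proof. exact: (growth_forms_lt pQ inj_cols Q_cols nQX). Qed.

Lemma size_cols : (size js <= N)%N.
Proof. exact: (le_rN inj_cols). Qed.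

End Forms.

(** If the next form were a zerodivisor off X_j0, unmixedness would give a prime containing it and
    the previous forms, of dimension one above the bound of [growth_cols_le]. *)
Lemma regular_cols js j0 : uniq js -> regular_upto (X j0) (@zero_ideal S) (colforms js).
Proof.
elim/last_ind: js => [|js j IH] // ujs.
rewrite /colforms map_rcons; apply/regular_upto_rcons.
have {}IH : regular_upto (X j0) (@zero_ideal S) (colforms js).
  by apply: IH; move: ujs; rewrite rcons_uniq => /andP[].
split=> // z yz; apply: contrapT => nz.
have [|Q [pQ HQ nQX bnd]] := regular_unmixed dim_formula_S (z := z) IH.
  by move=> M UM; apply: nz; exists M.
have := bnd _ (@growth_cols_le Q (rcons js j) j0 pQ ujs _ nQX).
have := size_cols ujs; rewrite size_rcons /colforms size_map.
move=> le_N; suff H : forall y, y \in [seq colform j | j <- rcons js j] -> Q y.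
  by move/(_ H); lia.
move=> y; rewrite map_rcons mem_rcons inE => /orP[/eqP ->|ys]; apply: HQ => //.
by apply: idealMr; [apply: is_ideal_idl | apply: idl_mem].
Qed.

End AlmostLinear.

Lemma subrMM (A : comNzRingType) (a b c d : A) :
  a * b - c * d = (a - c) * b + c * (b - d).
Proof. by rewrite mulrBl mulrBr addrA subrK. Qed.

(** The elements congruent to their image form a subring, so generators suffice. *)
Lemma congr_substitution (k : fieldType) D m (P : {mpoly {mpoly k[D]}[m]} -> Prop)
    (h : {rmorphism {mpoly {mpoly k[D]}[m]} -> {mpoly {mpoly k[D]}[m]}}) :
  is_ideal P -> (forall c : k, P ((c%:MP)%:MP - h (c%:MP)%:MP)) ->
  (forall j, P (@xvar k D m j - h (@xvar k D m j))) -> (forall l, P ('X_l - h 'X_l)) ->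
  forall z, P (z - h z).
Proof.
move=> iP hC hX hT.
have PD y z : P (y - h y) -> P (z - h z) -> P (y + z - h (y + z)).
  by move=> Py Pz; rewrite rmorphD opprD addrACA; apply: idealD.
have PM y z : P (y - h y) -> P (z - h z) -> P (y * z - h (y * z)).
  move=> Py Pz; rewrite rmorphM subrMM.
  by apply: idealD => //; [apply: idealMr | apply: idealMl].
apply: mpoly_gen_ind => //; apply: mpoly_gen_ind => // p q.
  by rewrite mpolyCD; apply: PD.
by rewrite mpolyCM; apply: PM.
Qed.

(** * The symbolic power of K and the kernel of the Rees map *)

Section MainArgument.
Variables (k : fieldType) (d m n : nat).
Let D := d.+1.
Let R := {mpoly k[D]}.
Let S := {mpoly R[m]}.
Local Notation X := (@xvar k D m).
Variables (alpha : 'I_m -> R) (phi1 : 'M[R]_(m, m - 2)) (v : 'cV[R]_m).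
Variable B : 'M[S]_(D, m - 2).
Hypothesis lt_dm : (D < m)%N.
Hypothesis n_gt0 : (0 < n)%N.
Hypothesis alpha_nz : exists j, alpha j != 0.
Hypothesis HB : hilbert_burch alpha (row_mx phi1 v).
Hypothesis h_phi1 : forall i j, homog_deg 1 (phi1 i j).
Hypothesis h_v : forall i, homog_deg n (v i ord0).
Hypothesis G : G_cond (ideal_of alpha) D.
Hypothesis linB : forall i j, exists c : 'I_m -> k,
  B i j = \sum_(l < m) ((c l)%:MP)%:MP * 'X_l.
Let L (j : 'I_(m - 2)) : S := \sum_(l < m) 'X_l * (phi1 l j)%:MP.
Hypothesis xB : forall j, \sum_(i < D) X i * B i j = L j.
Let g : S := \sum_(l < m) 'X_l * (v l ord0)%:MP.
Let xd : S := X ord_max.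
Let J := ideal_add (ideal_of L) (minors_ideal D B).
Let Bdel := \matrix_(i < d, j < m - 2) B (widen_ord (leqnSn d) i) j.
Let K := ideal_add (ideal_add (ideal_of L) (minors_ideal d Bdel))
                   (ideal_of (fun _ : 'I_1 => xd)).
Let KJ := ideal_add K J.

Let phi := row_mx phi1 v.
Let e (j : 'I_(m - 2 + 1)) := if split j is inl _ then 1%N else n.

Lemma h_phi i j : homog_deg (e j) (phi i j).
Proof. by rewrite /e /phi mxE; case: split => j'; rewrite ?ord1. Qed.

Lemma m_cols : m = (m - 2 + 1).+1. Proof. by move: lt_dm; rewrite /D; lia. Qed.

Let jsL := map (lshift 1) (enum 'I_(m - 2)).
Let jg : 'I_(m - 2 + 1) := rshift (m - 2) ord0.
Let ysL := colforms phi jsL.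

Lemma colform_L j : colform phi (lshift 1 j) = L j.
Proof. by apply: eq_bigr => l _; rewrite row_mxEl. Qed.

Lemma colform_g : colform phi jg = g.
Proof. by apply: eq_bigr => l _; rewrite row_mxEr. Qed.

Lemma uniq_jsL : uniq jsL.
Proof. by rewrite map_inj_uniq ?enum_uniq //; apply: lshift_inj. Qed.

Lemma uniq_jsg : uniq (rcons jsL jg).
Proof.
rewrite rcons_uniq uniq_jsL andbT; apply/mapP => -[j _ /(congr1 val) /= E].
by have := ltn_ord j; rewrite -E; lia.
Qed.

Lemma size_jsL : size jsL = (m - 2)%N.
Proof. by rewrite size_map size_enum_ord. Qed.

Lemma size_ysL : size ysL = (m - 2)%N.
Proof. by rewrite size_map size_jsL. Qed.

Lemma mem_ysL j : L j \in ysL.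
Proof. by rewrite -colform_L; apply/map_f/map_f; rewrite mem_enum. Qed.

Lemma mem_ysLP y : y \in ysL -> exists j, y = L j.
Proof. by case/mapP => _ /mapP[j _ ->] ->; exists j; rewrite colform_L. Qed.

Lemma idl_L j : idl ysL (L j). Proof. exact/idl_mem/mem_ysL. Qed.

Lemma idl_ysL_sub U : is_ideal U -> (forall j, U (L j)) -> subI (idl ysL) U.
Proof. by move=> iU UL; apply: idl_sub => // y /mem_ysLP[j ->]. Qed.

Lemma J_L j : J (L j).
Proof. by apply: gen_in; left; apply: gen_in; exists j. Qed.

Lemma is_ideal_J : is_ideal J. Proof. exact: is_ideal_gen. Qed.

Lemma idl_J : subI (idl ysL) J.
Proof. exact: idl_ysL_sub is_ideal_J J_L. Qed.

Lemma L_xhomog y : y \in ysL -> xhomog 1 y.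
Proof.
case/mem_ysLP => j ->; apply: xhomog_sum => l _.
by apply: (xhomogM (a := 0) (b := 1)); [apply: xhomog_T | apply: xhomog_const].
Qed.

Lemma g_xhomog : xhomog n g.
Proof.
apply: xhomog_sum => l _.
by apply: (xhomogM (a := 0) (b := n)); [apply: xhomog_T | apply: xhomog_const].
Qed.

Lemma det_in_ideal r (M : 'M[S]_r) (U : S -> Prop) (u : 'I_r -> S) i : is_ideal U ->
  (forall j, U (\sum_a u a * M a j)) -> U (u i * \det M).
Proof.
move=> iU HU.
have -> : u i * \det M = \sum_j (\sum_a u a * M a j) * \adj M j i.
  under eq_bigr do rewrite mulr_suml.
  rewrite exchange_big /= (eq_bigr (fun a => u a * (M *m \adj M) a i)); last first.
    by move=> a _; rewrite mxE mulr_sumr; apply: eq_bigr => j _; rewrite mulrA.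
  rewrite mul_mx_adj (bigD1 i) //= big1 ?addr0 => [|a /negPf ai]; first by rewrite mxE eqxx mulr1n.
  by rewrite mxE ai mulr0n mulr0.
by apply: ideal_sum => // j _; apply: idealMr.
Qed.

(** Row choices in [minors_ideal] may repeat, giving 0; an injective choice permutes the rows and
    Cramer's rule applies. *)
Lemma minor_in_ideal r p (M : 'M[S]_(r, p)) (U : S -> Prop) (u : 'I_r -> S) z i :
  is_ideal U -> (forall j, U (\sum_a u a * M a j)) -> minors_ideal r M z -> U (u i * z).
Proof.
move=> iU HU; move: z; apply: (gen_sub (U := fun z => U (u i * z))).
  split=> [|x y Ux Uy|s x Ux]; first by rewrite mulr0; apply: ideal0.
    by rewrite mulrDr; apply: idealD.
  by rewrite mulrCA; apply: idealMl.
move=> _ [a [b ->]].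
have [inj_a|ninj] := boolP (injectiveb a); last first.
  have /injectivePn[x [y xy axy]] := ninj.
  rewrite (determinant_alternate xy) ?mulr0; first exact: ideal0.
  by move=> j; rewrite !mxE axy.
have {}inj_a := injectiveP _ inj_a.
have [a' aK a'K] := injF_bij inj_a.
rewrite -(a'K i); apply: (det_in_ideal (u := fun l => u (a l))) => // j.
rewrite (_ : \sum_l _ = \sum_l u l * M l (b j)) // [RHS](reindex_inj inj_a).
by apply: eq_bigr => l _; rewrite mxE.
Qed.

Lemma idl_J_x z i : J z -> idl ysL (X i * z).
Proof.
have iI := is_ideal_idl ysL.
move: z; apply: (gen_sub (U := fun z => idl ysL (X i * z))).
  split=> [|x y Ux Uy|s x Ux]; first by rewrite mulr0; apply: ideal0.
    by rewrite mulrDr; apply: idealD.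
  by rewrite mulrCA; apply: idealMl.
move=> z [/ideal_ofP[c ->]|].
  by apply: idealMl => //; apply: ideal_sum => // j _; apply: idealMl => //; apply: idl_L.
by apply: (minor_in_ideal (u := X)) => // j; rewrite xB; apply: idl_L.
Qed.

Let T := idl (rcons ysL xd).

Lemma T_L j : T (L j).
Proof. by apply: idl_mem; rewrite mem_rcons inE mem_ysL orbT. Qed.

Lemma T_xd : T xd. Proof. by apply: idl_mem; rewrite mem_rcons mem_head. Qed.

(** Modulo x_d the row of the other variables times [Bdel] is [L], so Cramer's rule handles these;
    x_d itself lies in [T]. *)
Lemma T_KJ_x z i : KJ z -> T (X i * z).
Proof.
have iT : is_ideal T := is_ideal_idl _.
have iU : is_ideal (fun z => T (X i * z)).
  split=> [|x y Ux Uy|s x Ux]; first by rewrite mulr0; apply: ideal0.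
    by rewrite mulrDr; apply: idealD.
  by rewrite mulrCA; apply: idealMl.
have TL z' : ideal_of L z' -> T (X i * z').
  case/ideal_ofP => c ->; apply: (idealMl _ iT); apply: (ideal_sum _ iT) => j _.
  exact: (idealMl _ iT) (T_L j).
move: z; apply: (gen_sub iU) => z [|Jz]; last first.
  apply: (idl_sub iT _ (idl_J_x i Jz)) => y yL; apply: idl_mem.
  by rewrite mem_rcons inE yL orbT.
move: z; apply: (gen_sub iU) => z [|]; last first.
  by case/ideal_ofP => c ->; rewrite big_ord1; apply: (idealMl _ iT); apply: (idealMl _ iT) T_xd.
move: z; apply: (gen_sub iU) => z [/TL //|Mz].
have [i' ->|->] := unliftP ord_max i; last by apply: (idealMr _ iT) T_xd.
have -> : X (lift ord_max i') = X (widen_ord (leqnSn d) i').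
  by congr X; apply/val_inj/lift_max.
apply: (minor_in_ideal (u := fun l => X (widen_ord (leqnSn d) l)) i' iT _ Mz) => j.
rewrite (_ : \sum_a _ = L j - xd * B ord_max j).
  by apply: (idealB iT); [apply: T_L | apply: (idealMr _ iT) T_xd].
rewrite -xB big_ord_recr /= addrK; apply: eq_bigr => l _; by rewrite mxE.
Qed.

Let ysx := rcons ysL (xd ^+ n).

Lemma T_prod r (f : 'I_r -> S) : (forall j, T (f j)) ->
  idl (rcons ysL (xd ^+ r)) (\prod_j f j).
Proof.
move=> Tf; have iI := is_ideal_idl ysL; rewrite idl_rcons.
elim: r f Tf => [|r IH] f Tf.
  by rewrite big_ord0 expr0; exists 1; rewrite mulr1 subrr; apply: ideal0.
rewrite big_ord_recr /=; have [b Hb] := IH _ (fun j => Tf (widen_ord (leqnSn r) j)).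
have := Tf ord_max; rewrite /T idl_rcons => -[c Hc].
exists (b * c).
set p := \prod_(j < r) _ in Hb *; set q := f ord_max in Hc *.
rewrite (_ : _ - _ = (p - xd ^+ r * b) * q + xd ^+ r * b * (q - xd * c)).
  by apply: idealD => //; [apply: idealMr | apply: idealMl].
by rewrite exprSr; ring.
Qed.

(** One X_i per factor moves a product of n elements of K + J into (L, x_d^n), and one moves J into
    (L); n + 1 serves both. *)
Lemma symb_pow_local z i : ideal_add (ideal_pow KJ n) J z -> idl ysx (X i ^+ n.+1 * z).
Proof.
have iI : is_ideal (idl ysx) := is_ideal_idl _.
have iU : is_ideal (fun z => idl ysx (X i ^+ n.+1 * z)).
  split=> [|x y Ux Uy|s x Ux]; first by rewrite mulr0; apply: ideal0.
    by rewrite mulrDr; apply: idealD.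
  by rewrite mulrCA; apply: idealMl.
move: z; apply: (gen_sub iU) => z [|Jz]; last first.
  rewrite exprSr -mulrA; apply: (idealMl _ iI); rewrite /ysx idl_rcons.
  exact/adjoin_sub/idl_J_x.
move: z; apply: (gen_sub iU) => _ [f [Kf ->]].
rewrite exprS -mulrA; apply: (idealMl _ iI).
rewrite -[n in X in X * _]card_ord -prodr_const -big_split /=.
by apply: T_prod => j; apply: T_KJ_x.
Qed.

Lemma regular_L i : regular_upto (X i) (@zero_ideal S) ysL.
Proof. exact: (regular_cols HB h_phi G (ltn0Sn d) m_cols i uniq_jsL). Qed.

Lemma regular_Lg i : regular_upto (X i) (@zero_ideal S) (rcons ysL g).
Proof.
have := regular_cols HB h_phi G (ltn0Sn d) m_cols i uniq_jsg.
by rewrite /colforms map_rcons colform_g.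
Qed.

Lemma xvar_neq0 i : 'X_i != 0 :> R.
Proof. by rewrite -msize_poly_eq0 msizeX. Qed.

Lemma growth_L_xd (Q : S -> Prop) i : prime_ideal Q -> (forall j, Q (L j)) -> Q xd ->
  ~ Q (X i) -> growth_le (scalar_S k D m) (@filtr_S k D m) Q D.+1.
Proof.
move=> pQ QL Qxd nQX.
have QL' y : y \in ysL -> Q y by case/mem_ysLP => j ->.
have := growth_cols_lt HB h_phi G (ltn0Sn d) m_cols pQ uniq_jsL QL' nQX (xvar_neq0 _) Qxd.
rewrite size_jsL; congr (growth_le _ _ _ _); move: lt_dm; rewrite /D; lia.
Qed.

(** A zerodivisor x_d would give a prime over (L, x_d) of dimension at least D + 2, against
    [growth_L_xd]. Powers follow by iteration. *)
Lemma regular_Lxd i : regular_upto (X i) (@zero_ideal S) ysx.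
Proof.
apply/regular_upto_rcons; split; first exact: regular_L.
have iI := is_ideal_idl ysL; rewrite -/(idl ysL).
have nzd z : idl ysL (xd * z) -> exists M, idl ysL (X i ^+ M * z).
  move=> xz; apply: contrapT => nz.
  have [|Q [pQ HQ nQX bnd]] := regular_unmixed (@dim_formula_S k D m) (z := z) (regular_L i).
    by move=> M UM; apply: nz; exists M.
  have := bnd _ (@growth_L_xd Q i pQ _ (HQ _ xz) nQX).
  rewrite size_ysL; move: lt_dm; rewrite /D => ltm H.
  suff : (d.+1 + m <= d.+2 + (m - 2))%N by lia.
  by apply: H => j; apply: HQ; apply: idealMr => //; apply: idl_L.
elim: (n) => [|r IH] z; first by rewrite expr0 mul1r => Uz; exists 0%N; rewrite expr0 mul1r.
rewrite exprS -mulrA => /nzd[M UM].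
have [|M' UM'] := IH (X i ^+ M * z); first by rewrite mulrCA.
by exists (M' + M)%N; rewrite exprD -mulrA.
Qed.

Definition rees : {rmorphism S -> {poly R}} := mmap (@polyC R) (fun j => alpha j *: 'X).

Lemma rees_C c : rees c%:MP = c%:P. Proof. by rewrite /rees /= mmapC. Qed.

Lemma rees_T l : rees 'X_l = (alpha l)%:P * 'X.
Proof. by rewrite /rees /= mmapX mmap1U mul_polyC. Qed.

Lemma rees_colform j : rees (colform phi j) = 0.
Proof.
rewrite rmorph_sum (eq_bigr (fun l => (alpha l * phi l j)%:P * 'X)); last first.
  by move=> l _; rewrite rmorphM rees_T rees_C polyCM; ring.
rewrite -mulr_suml -rmorph_sum.
have -> : \sum_l alpha l * phi l j = 0; last by rewrite rmorph0 mul0r.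
have := (HB.1 (col j phi)).2; under eq_bigr do rewrite mxE; apply.
by exists (delta_mx j 0); rewrite -colE.
Qed.

Lemma rees_L j : rees (L j) = 0. Proof. by rewrite -colform_L rees_colform. Qed.
Lemma rees_g : rees g = 0. Proof. by rewrite -colform_g rees_colform. Qed.

Lemma is_ideal_rees : is_ideal (fun a => rees a = 0).
Proof.
split=> [|x y Ux Uy|s x Ux]; rewrite ?rmorph0 ?rmorphD ?rmorphM ?Ux ?Uy ?addr0 //.
by rewrite mulr0.
Qed.

Lemma rees_torsion i z M : rees (X i ^+ M * z) = 0 -> rees z = 0.
Proof.
rewrite rmorphM rmorphXn rees_C => /eqP; rewrite mulf_eq0 => /orP[|/eqP //].
by rewrite expf_eq0 polyC_eq0 (negPf (xvar_neq0 i)) andbF.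
Qed.

(** The Koszul relation between alpha_j and alpha_l is a syzygy, hence a combination of the columns
    of [phi]. *)
Lemma syzygy_in_forms l j : idl (rcons ysL g) ((alpha j)%:MP * 'X_l - (alpha l)%:MP * 'X_j).
Proof.
have iI := is_ideal_idl (rcons ysL g).
pose u : 'cV[R]_m := \col_s (alpha j *+ (s == l) - alpha l *+ (s == j)).
have delta a s : \sum_t alpha t * (a *+ (t == s)) = alpha s * a.
  rewrite (bigD1 s) //= eqxx big1 ?addr0 // => t /negPf->.
  by rewrite mulr0n mulr0.
have [w E] : exists w, u = phi *m w.
  apply/(HB.1 u); under eq_bigr do rewrite mxE mulrBr.
  by rewrite sumrB !delta; ring.
have deltaT (a : R) s : \sum_t 'X_t * (a *+ (t == s))%:MP = a%:MP * 'X_s :> S.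
  rewrite (bigD1 s) //= eqxx big1 ?addr0 ?mulr1n; first by rewrite mulrC.
  by move=> t /negPf->; rewrite mulr0n mpolyC0 mulr0.
have -> : (alpha j)%:MP * 'X_l - (alpha l)%:MP * 'X_j = \sum_t 'X_t * (u t ord0)%:MP :> S.
  by under [RHS]eq_bigr do rewrite mxE mpolyCB mulrBr; rewrite sumrB !deltaT.
rewrite E (eq_bigr (fun t => \sum_c (w c ord0)%:MP * ('X_t * (phi t c)%:MP))); last first.
  move=> t _; rewrite mxE rmorph_sum mulr_sumr; apply: eq_bigr => c _.
  by rewrite /= mpolyCM; ring.
rewrite exchange_big /=; apply: ideal_sum => // c _; rewrite -mulr_sumr.
apply: idealMl => //; apply: idl_mem; rewrite mem_rcons inE.
rewrite -/(colform phi c) -colform_g; case: (split_ordP c) => c' ->.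
  by rewrite colform_L mem_ysL orbT.
by rewrite (ord1 c') eqxx.
Qed.

(* Modulo the forms, [alpha_j T_l = alpha_l T_j]: multiplying by a power of
   [alpha_j] turns [a] into its value at [alpha] times a power of [T_j]. *)
Lemma rees_kernel_torsion a j : rees a = 0 ->
  exists s, idl (rcons ysL g) ((alpha j ^+ s)%:MP * a).
Proof.
have iI := is_ideal_idl (rcons ysL g); set I := idl _ in iI *.
have syz := syzygy_in_forms.
have mon (nu : 'X_{1..m}) :
    I ((alpha j ^+ mdeg nu)%:MP * 'X_[nu] - (\prod_l alpha l ^+ nu l)%:MP * 'X_j ^+ mdeg nu).
  rewrite mpolyXE_id mdegE -prodrXr -[X in _ - _ * X]prodrXr !rmorph_prod /= -!big_split /=.
  apply: (big_ind2 (fun x y => I (x - y))).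
  - by rewrite subrr; apply: ideal0.
  - move=> x1 y1 x2 y2 h1 h2; rewrite subrMM.
    by apply: idealD => //; [apply: idealMr | apply: idealMl].
  - move=> l _; rewrite !rmorphXn -!exprMn /=.
    set x := (alpha j)%:MP * _; set y := (alpha l)%:MP * _.
    by rewrite subrXX; apply: idealMr => //; apply: syz.
move=> a0; exists (msize a).
(* The value of p at T_j / alpha_j, with denominators cleared by a power of alpha_j. *)
pose tr (p : {poly R}) : S := \sum_(t < (msize a).+1) (alpha j ^+ (msize a - t) * p`_t)%:MP * 'X_j ^+ t.
have tr0 : tr (rees a) = 0.
  by rewrite a0 /tr big1 // => t _; rewrite coef0 mulr0 mpolyC0 mul0r.
rewrite -[_ * a]subr0 -tr0 [X in _ * X - _]mpolyE mulr_sumr.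
have -> : tr (rees a) = \sum_(nu <- msupp a) (alpha j ^+ (msize a - mdeg nu) * a@_nu *
    \prod_l alpha l ^+ nu l)%:MP * 'X_j ^+ mdeg nu.
  rewrite /tr /rees /= /mmap.
  under eq_bigr do rewrite coef_sum mulr_sumr raddf_sum mulr_suml.
  rewrite exchange_big /= [LHS]big_seq [RHS]big_seq; apply: eq_bigr => nu nua.
  have E : (a@_nu)%:P * mmap1 (fun l => alpha l *: 'X) nu =
      (a@_nu * \prod_l alpha l ^+ nu l)%:P * 'X^(mdeg nu) :> {poly R}.
    rewrite polyCM -mulrA; congr (_ * _).
    rewrite /mmap1 rmorph_prod /= mdegE -prodrXr -big_split /=.
    by apply: eq_bigr => l _; rewrite -mul_polyC exprMn rmorphXn.
  have lt_nu : (mdeg nu < (msize a).+1)%N by apply/ltnW/msize_mdeg_lt.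
  rewrite (bigD1 (Ordinal lt_nu)) //= E coefCM coefXn eqxx mulr1 mulrA [X in _ + X]big1 ?addr0 //.
  move=> t /negPf nt; rewrite coefCM coefXn (_ : (t == mdeg nu :> nat) = false).
    by rewrite mulr0 mulr0 mpolyC0 mul0r.
  by rewrite -nt.
rewrite -sumrB big_seq; apply: ideal_sum => // nu nua.
have le_nu : (mdeg nu <= msize a)%N by apply/ltnW/msize_mdeg_lt.
rewrite -mul_mpolyC -{1}(subnK le_nu) exprD !mpolyCM.
set p := (alpha j ^+ (_ - _))%:MP; set q := (a@_nu)%:MP.
set y := (alpha j ^+ _)%:MP; set w := (\prod_l _)%:MP.
have E (p' q' y' w' s t : S) : p' * y' * (q' * s) - p' * q' * w' * t = p' * q' * (y' * s - w' * t).
  by ring.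
by rewrite E; apply: (idealMl _ iI); apply: mon.
Qed.

(** Otherwise a prime of dimension at least D + 1 over (L, g) would contain a power of a nonzero
    alpha_j, which forces dimension at most D. *)
Lemma rees_kernel_local a i : rees a = 0 -> exists M, idl (rcons ysL g) (X i ^+ M * a).
Proof.
move=> a0; apply: contrapT => nz; have iI := is_ideal_idl (rcons ysL g).
have [|Q [pQ HQ nQX bnd]] := regular_unmixed (@dim_formula_S k D m) (z := a) (regular_Lg i).
  by move=> M UM; apply: nz; exists M.
have Qy y : y \in colforms phi (rcons jsL jg) -> Q y.
  rewrite /colforms map_rcons colform_g => yy; apply: HQ; apply: idealMr => //.
  exact: idl_mem.
have [j nzj] := alpha_nz; have [s /HQ Qs] := rees_kernel_torsion j a0.
have nzs : alpha j ^+ s != 0 by rewrite expf_neq0.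
have := bnd _ (growth_cols_lt HB h_phi G (ltn0Sn d) m_cols pQ uniq_jsg Qy nQX nzs Qs).
by rewrite !size_rcons size_ysL size_jsL; move: lt_dm; rewrite /D; lia.
Qed.

Lemma KJ_sub_prime (Q : S -> Prop) i : prime_ideal Q -> ~ Q (X i) ->
  (forall j, Q (L j)) -> Q xd -> subI KJ Q.
Proof.
move=> pQ nQX QL Qxd z KJz; have [iQ _ pQM] := pQ.
have [//|//|//] := pQM (X i) z.
apply: (idl_sub iQ _ (T_KJ_x i KJz)) => y; rewrite mem_rcons inE => /orP[/eqP -> //|].
by case/mem_ysLP => j ->.
Qed.

(* If the conclusion fails, the prime given by unmixedness has dimension [D + 1],
   the largest possible over [K], so it is a minimal prime of [K]. *)
Lemma symb_pow_xlocal f i : symb_pow_lift J K n f -> exists M, idl ysx (X i ^+ M * f).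
Proof.
move=> Kf; apply: contrapT => nz; have iI : is_ideal (idl ysx) := is_ideal_idl _.
have [|Q [pQ HQ nQX bnd]] := regular_unmixed (@dim_formula_S k D m) (z := f) (regular_Lxd i).
  by move=> M UM; apply: nz; exists M.
have Qys y : y \in ysx -> Q y.
  by move=> yy; apply: HQ; apply: idealMr => //; apply: idl_mem.
have QL j : Q (L j) by apply: Qys; rewrite mem_rcons inE mem_ysL orbT.
have Qxn : Q (xd ^+ n) by apply: Qys; rewrite mem_rcons mem_head.
have Qxd : Q xd by apply: contrapT => nQxd; apply: primeX Qxn.
have minQ : minimal_prime KJ Q.
  split=> [//||Q' pQ' KQ' Q'Q F QF]; first exact: (KJ_sub_prime pQ nQX QL Qxd).
  apply: contrapT => nQ'F.
  have nQ'X : ~ Q' (X i) by move/Q'Q.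
  have Q'L j : Q' (L j) by apply: KQ'; apply: gen_in; right; apply: J_L.
  have Q'xd : Q' xd.
    apply: KQ'; apply: gen_in; left; apply: gen_in; right; apply: gen_in.
    by exists ord0.
  (* A strictly smaller prime over K has dimension at most D + 1, leaving at most D for Q. *)
  have gQ := growth_le_strict (filtration_S k D m) pQ' (prime_is_ideal pQ) Q'Q QF nQ'F
    (growth_L_xd pQ' Q'L Q'xd nQ'X).
  by have := bnd _ gQ; rewrite size_rcons size_ysL; move: lt_dm; rewrite /D; lia.
have [s [nQs Hs]] := Kf Q minQ.
have := symb_pow_local i Hs; rewrite mulrA => /HQ.
by apply: primeM => //; apply: primeX.
Qed.

(* A prime [P] containing all the variables is not minimal over [K]: a vector
   [xi] in the left kernel of [Bdel] modulo [P] gives a prime below it, the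
   preimage of [P[t]] under the substitution of [xi t] for [x]. *)
Lemma minimal_prime_off_x (P : S -> Prop) : minimal_prime KJ P -> exists i, ~ P (X i).
Proof.
move=> [pP KJP minP]; apply: contrapT => no.
have PX i : P (X i) by apply: contrapT => nPX; apply: no; exists i.
have [iP nP1 _] := pP.
have [F [f [kerf fracf]]] := residue_field pP.
have lt_rk : (\rank (map_mx f Bdel) < d)%N.
  rewrite ltn_neqAle rank_leq_row andbT; apply/eqP => E.
  have := rank_minor (map_mx f Bdel); rewrite E => -[a [b [_ /eqP[]]]].
  have -> : \matrix_(x, y) map_mx f Bdel (a x) (b y) = map_mx f (\matrix_(x, y) Bdel (a x) (b y)).
    by apply/matrixP => x y; rewrite !mxE.
  rewrite det_map_mx; apply/kerf/KJP; apply: gen_in; left; apply: gen_in; left.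
  by apply: gen_in; right; apply: gen_in; exists a, b.
have [xi [j0 [nz Pxi]]] : exists (xi : 'I_d -> S) j0, ~ P (xi j0) /\
    forall c, P (\sum_j xi j * Bdel j c).
  have : kermx (map_mx f Bdel) != 0 by rewrite -mxrank_eq0 mxrank_ker subn_eq0 -ltnNge.
  have := mulmx_ker (map_mx f Bdel); move: (kermx _) => N NM /matrix0Pn[r [j0 nz]].
  have /choice[ab Hab] j : exists ab : S * S, f ab.2 != 0 /\ N r j * f ab.2 = f ab.1.
    by have [a [b [? ?]]] := fracf (N r j); exists (a, b).
  (* A kernel vector over the residue field, multiplied by the common denominator [beta], lifts to
     S. *)
  pose beta := \prod_l (ab l).2.
  pose xi j := (ab j).1 * \prod_(l | l != j) (ab l).2.
  have fxi j : f (xi j) = N r j * f beta.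
    rewrite rmorphM -(Hab j).2 -mulrA -rmorphM /beta [in RHS](bigD1 j) //=.
  have fbeta : f beta != 0.
    by rewrite rmorph_prod; apply/prodf_neq0 => l _; case: (Hab l).
  exists xi, j0; split=> [/kerf|c].
    by rewrite fxi => /eqP; rewrite mulf_eq0 (negPf nz) (negPf fbeta).
  apply/kerf; rewrite rmorph_sum.
  rewrite (eq_bigr (fun j => f beta * (N r j * map_mx f Bdel j c))); last first.
    by move=> j _; rewrite rmorphM fxi [map_mx f Bdel j c]mxE mulrCA mulrA.
  have := congr1 (fun A : 'M_(_, _) => A r c) NM; rewrite mxE [in RHS]mxE => E.
  by rewrite -mulr_sumr E mulr0.
(* The last coordinate is 0 so that x_d falls into the new prime. *)
pose xi' (i : 'I_D) : S := if insub (i : nat) is Some j then xi j else 0.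
have xi'_lt j : xi' (widen_ord (leqnSn d) j) = xi j by rewrite /xi' /= valK.
have xi'_max : xi' ord_max = 0 by rewrite /xi' insubF //= ltnn.
pose Th : {rmorphism S -> {poly S}} :=
  mmap (dilate (scalar_S k D m) xi') (fun l => ('X_l)%:P).
have ThC (c : R) : Th c%:MP = dilate (scalar_S k D m) xi' c by rewrite /Th /= mmapC.
have ThX i : Th (X i) = (xi' i)%:P * 'X.
  by rewrite ThC /dilate /= mmapX mmap1U.
have ThT l : Th 'X_l = ('X_l)%:P by rewrite /Th /= mmapX mmap1U.
have Thk (c : k) : Th (c%:MP)%:MP = ((c%:MP)%:MP)%:P by rewrite ThC /dilate /= mmapC.
(* Entries of B involve only the T_l, so the minors in P remain in the new prime. *)
have ThB i j : Th (B i j) = (B i j)%:P.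
  have [c ->] := linB i j; rewrite !rmorph_sum; apply: eq_bigr => l _.
  by rewrite !rmorphM Thk ThT.
have Thdet r (M : 'M[S]_r) : (forall a b, Th (M a b) = (M a b)%:P) -> Th (\det M) = (\det M)%:P.
  move=> hM; rewrite -!det_map_mx; congr (\det _).
  by apply/matrixP => a b; rewrite !mxE.
pose Q' (F : S) := forall j, P (Th F)`_j.
have pQ' : prime_ideal Q' := prime_preim Th (prime_poly_ext pP).
have iQ' := prime_is_ideal pQ'.
have QC (z : S) : P z -> Th z = z%:P -> Q' z.
  by move=> Pz E j; rewrite E coefC; case: eqP => // _; exact: (ideal0 iP).
have Q'L j : Q' (L j).
  rewrite -xB => l; rewrite rmorph_sum (eq_bigr (fun i => (xi' i * B i j)%:P * 'X)); last first.
    by move=> i _; rewrite rmorphM ThX ThB polyCM mulrAC.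
  rewrite -mulr_suml -rmorph_sum /= coefCM; apply: idealMr => //.
  rewrite big_ord_recr /= xi'_max mul0r addr0.
  have := Pxi j; congr P; apply: eq_bigr => i _; by rewrite xi'_lt [Bdel _ _]mxE.
have idL U : ideal_of L U -> Q' U.
  by case/ideal_ofP => c ->; apply: (ideal_sum _ iQ') => j _; apply: (idealMl _ iQ').
have minB : subI (minors_ideal D B) Q'.
  apply: (gen_sub iQ') => _ [a [b ->]]; apply: QC.
    apply/KJP; apply: gen_in; right; apply: gen_in; right; apply: gen_in.
    by exists a, b.
  by apply: Thdet => x y; rewrite mxE ThB.
have minBdel : subI (minors_ideal d Bdel) Q'.
  apply: (gen_sub iQ') => _ [a [b ->]]; apply: QC.
    apply/KJP; apply: gen_in; left; apply: gen_in; left; apply: gen_in; right; apply: gen_in.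
    by exists a, b.
  by apply: Thdet => x y; rewrite !mxE ThB.
have Q'xd : Q' xd.
  by move=> l; rewrite ThX xi'_max mul0r coef0; exact: (ideal0 iP).
have KJQ' : subI KJ Q'.
  apply: (gen_sub iQ') => z []; last by apply: (gen_sub iQ') => {}z [/idL|/minB].
  apply: (gen_sub iQ') => {}z []; first by apply: (gen_sub iQ') => {}z [/idL|/minBdel].
  by case/ideal_ofP => c ->; rewrite big_ord1; apply: (idealMl _ iQ').
have Q'P : subI Q' P.
  (* At t = 0 the substitution sends every x_i to 0, a congruence modulo P as P contains the x_i. *)
  suff H z : P (z - (Th z)`_0).
    by move=> z /(_ 0%N) Pz; rewrite -(subrK (Th z)`_0 z); apply: idealD.
  apply: (congr_substitution (h := coefp 0 \o Th) iP) => [c|i|l] /=.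
  - by rewrite Thk coefC subrr; exact: (ideal0 iP).
  - by rewrite ThX coefMX subr0; apply: PX.
  - by rewrite ThT coefC subrr; exact: (ideal0 iP).
(* Minimality would put X_j0 into the smaller prime, that is xi_j0 into P. *)
have := minP Q' pQ' KJQ' Q'P (X (widen_ord (leqnSn d) j0)) (PX _) 1%N.
by rewrite ThX xi'_lt coefCM coefX mulr1.
Qed.

Lemma symb_pow_divisible f : symb_pow_lift J K n f ->
  exists a, rees a = 0 /\ J (g * f - xd ^+ n * a).
Proof.
move=> Kf.
have : idl ysx (g * f).
  apply: (graded_saturation n_gt0 L_xhomog _ regular_Lxd); first exact: xhomog_xvar.
    rewrite -[n]addn0; apply: xgeM => //; exact/xhomog_xge/g_xhomog.
  move=> i; have [M UM] := symb_pow_xlocal i Kf; exists M.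
  by rewrite mulrCA; apply: idealMl => //; apply: is_ideal_idl.
rewrite /ysx idl_rcons => -[a Ha]; exists a; split; last exact: idl_J.
have : rees (g * f - xd ^+ n * a) = 0.
  exact: (idl_ysL_sub is_ideal_rees rees_L Ha).
rewrite rmorphB rmorphM rees_g mul0r sub0r => /eqP; rewrite oppr_eq0 => /eqP.
exact: rees_torsion.
Qed.

Lemma rees_kernel_symb_pow a : rees a = 0 ->
  exists f, symb_pow_lift J K n f /\ J (g * f - xd ^+ n * a).
Proof.
move=> a0; have iI := is_ideal_idl ysL.
have : idl (rcons ysL g) (xd ^+ n * a).
  apply: (graded_saturation n_gt0 L_xhomog g_xhomog regular_Lg).
    apply: (xge_le (t := (n + 0)%N)); first by rewrite addn0.
    by apply: xgeM => //; apply: xhomog_xge; apply: xhomog_xvar.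
  move=> i; have [M UM] := rees_kernel_local i a0; exists M.
  by rewrite mulrCA; apply: idealMl => //; apply: is_ideal_idl.
rewrite idl_rcons => -[f Hf]; exists f; split; last first.
  by rewrite -opprB; apply: idealN; [exact: is_ideal_J | exact: idl_J].
move=> P minP; have [i nPX] := minimal_prime_off_x minP.
have [pP _ _] := minP.
have [M] := rees_kernel_local i a0; rewrite idl_rcons => -[b Hb].
have /regular_upto_rcons[_ nzd] := regular_Lg i.
(* Both a and x_d^n a are multiples of g up to powers of X_i; comparing them and cancelling g puts f
   in (L, x_d^n) off X_i, and X_i is outside P. *)
have [|M' Hz] := nzd (X i ^+ M * f - xd ^+ n * b).
  rewrite -/(idl ysL) (_ : g * _ = xd ^+ n * (X i ^+ M * a - g * b) - X i ^+ M * (xd ^+ n * a - g * f)).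
    by apply: (idealB iI); apply: (idealMl _ iI).
  by ring.
exists (X i ^+ (M' + M)); split; first exact: primeX.
rewrite (_ : _ * f = X i ^+ M' * (X i ^+ M * f - xd ^+ n * b) + X i ^+ M' * b * xd ^+ n); last first.
  by rewrite exprD; ring.
have iT : is_ideal (ideal_add (ideal_pow KJ n) J) by exact: is_ideal_gen.
apply: (idealD iT).
  by apply: gen_in; right; apply: idl_J.
apply: (idealMl _ iT); apply: gen_in; left; apply: gen_in.
exists (fun=> xd); split; last by rewrite prodr_const card_ord.
move=> _; apply: gen_in; left; apply: gen_in; right; apply: gen_in.
by exists ord0.
Qed.

End MainArgument.

(* The paper's d (number of variables) is d.+1 here; R = k[x_1..x_(d+1)],
   S = R[T_1..T_m]; the Hilbert-Burch matrix is phi = [phi1 | v] with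
   phi1 the first m-2 columns (linear) and v the last column (degree n). *)
Theorem theorem3p11 (k : fieldType) (d m n : nat)
  (alpha : 'I_m -> {mpoly k[d.+1]})
  (phi1 : 'M[{mpoly k[d.+1]}]_(m, m - 2)) (v : 'cV[{mpoly k[d.+1]}]_m)
  (B : 'M[{mpoly {mpoly k[d.+1]}[m]}]_(d.+1, m - 2)) :
  (d.+1 < m)%N ->
  (1 <= n)%N ->
  perfect_ideal (ideal_of alpha) ->
  ideal_height_eq (ideal_of alpha) 2 ->
  hilbert_burch alpha (row_mx phi1 v) ->
  (forall i j, homog_deg 1 (phi1 i j)) ->
  (forall i, homog_deg n (v i ord0)) ->
  G_cond (ideal_of alpha) d.+1 ->
  (* B = B(phi') : entries are linear forms in k[T_1..T_m] and
     [x_1 ... x_(d+1)] . B = [L_1 ... L_(m-2)] *)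
  (forall i j, exists c : 'I_m -> k,
      B i j = \sum_(l < m) ((c l)%:MP)%:MP * 'X_l) ->
  (forall j, \sum_(i < d.+1) (('X_i : {mpoly k[d.+1]})%:MP) * B i j
             = \sum_(l < m) 'X_l * (phi1 l j)%:MP) ->
  let L := fun j : 'I_(m - 2) =>
             \sum_(l < m) ('X_l : {mpoly {mpoly k[d.+1]}[m]}) * (phi1 l j)%:MP in
  let g := \sum_(l < m) ('X_l : {mpoly {mpoly k[d.+1]}[m]}) * (v l ord0)%:MP in
  let xd := (('X_ord_max : {mpoly k[d.+1]})%:MP : {mpoly {mpoly k[d.+1]}[m]}) in
  let J := ideal_add (ideal_of L) (minors_ideal d.+1 B) in
  let Bdel := \matrix_(i < d, j < m - 2) B (widen_ord (leqnSn d) i) j in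
  let K := ideal_add (ideal_add (ideal_of L) (minors_ideal d Bdel))
                     (ideal_of (fun _ : 'I_1 => xd)) in
  (* calA = kernel of S -> R[t], T_j |-> alpha_j t *)
  let calA := fun F : {mpoly {mpoly k[d.+1]}[m]} =>
      mmap (fun c : {mpoly k[d.+1]} => c%:P) (fun j => alpha j *: 'X) F = 0 in
  (* D = g Kbar^(n) / xd^n is contained in A *)
  (forall f, symb_pow_lift J K n f ->
      exists a, J (g * f - xd ^+ n * a)) /\
  (* D is contained in Abar *)
  (forall f, symb_pow_lift J K n f ->
      exists a, calA a /\ J (g * f - xd ^+ n * a)) /\
  (* Abar is contained in D *)
  (forall a, calA a ->
      exists f, symb_pow_lift J K n f /\ J (g * f - xd ^+ n * a)).
Proof.
move=> lt_dm n_gt0 _ ht HB h1 hv hG hB xB L g xd J Bdel K calA.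
(* If all alpha_j were 0, the zero prime would contain the ideal and have height at least 2. *)
have nz : exists j, alpha j != 0.
  apply: contrapT => no; have a0 j : alpha j = 0.
    by apply/eqP/negPn/negP => nz; apply: no; exists j.
  have p0 : prime_ideal (@zero_ideal {mpoly k[d.+1]}).
    split; [exact: is_ideal0 | by move/eqP; rewrite oner_eq0 |].
    by move=> a b /eqP; rewrite mulf_eq0 => /orP[]/eqP; [left|right].
  have [|Q [pQ chain [Q0 _]]] := ht.1 _ p0.
    move=> _ /ideal_ofP[c ->]; rewrite /zero_ideal big1 // => j _.
    by rewrite a0 mulr0.
  have [_ [x [Qx []]]] := chain 1%N isT.
  by rewrite (Q0 x Qx); apply: (ideal0 (prime_is_ideal (pQ 1%N isT))).
have div := @symb_pow_divisible k d m n alpha phi1 v B lt_dm n_gt0 HB h1 hv hG xB.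
split=> [f /div[a [_ Ja]]|]; first by exists a.
split=> [|a]; first exact: div.
exact: (@rees_kernel_symb_pow k d m n alpha phi1 v B lt_dm n_gt0 nz HB h1 hv hG hB xB).
Qed.
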